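(* Let $n\ge1$ be an integer and $0\le\alpha<1$. For the class $\mathcal{CS}_n(\alpha)$, the sharp $\mathcal{S}^*_{\rho,n}$-radius is given by $$R_{\mathcal{S}^*_{\rho,n}}(\mathcal{CS}_n(\alpha)) = \left(\frac{\sinh^{-1}(1)}{n-\alpha+1 +\sqrt{(n-\alpha+1)^2 + (\sinh^{-1}(1)+2(1-\alpha))\sinh^{-1}(1)}}\right)^{1/n}.$$
   Context: $\mathbb{D}=\{z\in\mathbb{C}:|z|<1\}$. For an integer $n\ge1$, $\mathcal{A}_n$ is the class of analytic functions $f$ on $\mathbb{D}$ of the form $f(z)=z+a_{n+1}z^{n+1}+a_{n+2}z^{n+2}+\cdots$, and $\mathcal{A}=\mathcal{A}_1$. For analytic $g,h$ on $\mathbb{D}$, $g\prec h$ (subordination) means $g=h\circ\omega$ for some analytic $\omega$ on $\mathbb{D}$ with $\omega(0)=0$ and $|\omega(z)|\le|z|$. $\sinh^{-1}(z)=\ln(z+\sqrt{1+z^2})$ is the principal branch (analytic in $\mathbb{D}$, $\sinh^{-1}(0)=0$). $\mathcal{S}^*_{\rho}=\{f\in\mathcal{A}: zf'(z)/f(z)\prec 1+\sinh^{-1}(z)\}$ and $\mathcal{S}^*_{\rho,n}=\mathcal{A}_n\cap\mathcal{S}^*_\rho$. For $0\le\alpha<1$, $\mathcal{P}_n(\alpha)$ is the class of analytic functions $p(z)=1+\sum_{k\ge n}c_kz^k$ on $\mathbb{D}$ with $p(z)\prec(1+(1-2\alpha)z)/(1-z)$ (i.e. $\operatorname{Re}p>\alpha$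 in $\mathbb{D}$), and $\mathcal{P}_n=\mathcal{P}_n(0)$. $\mathcal{S}^*_n(\alpha)=\{g\in\mathcal{A}_n: zg'(z)/g(z)\in\mathcal{P}_n(\alpha)\}$. $\mathcal{CS}_n(\alpha)=\{f\in\mathcal{A}_n: f(z)/g(z)\in\mathcal{P}_n \text{ for some } g\in\mathcal{S}^*_n(\alpha)\}$. For $G_1,G_2\subset\mathcal{A}$, the (sharp) $G_1$-radius $R_{G_1}(G_2)$ of $G_2$ is the greatest number $r_0\in(0,1]$ such that for every $g\in G_2$ and every $0<r\le r_0$ the function $z\mapsto r^{-1}g(rz)$ belongs to $G_1$. *)

(* Defs.v *)
From Stdlib Require Import Reals.
From Coquelicot Require Import Coquelicot.
Open Scope R_scope.

(** Functions on the unit disc are represented by total functions [C -> C];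
    only their values on the disc are ever used. *)

Definition in_disc (z : C) : Prop := Cmod z < 1.

Definition analytic (f : C -> C) : Prop :=
  forall z : C, in_disc z -> @ex_derive C_AbsRing C_NormedModule f z.

(** Principal branches, with argument in (-PI, PI]. The values of [Carg] and
    [Clog] at [0] are meaningless; [Casinh] does not use them. *)

Definition Carg (z : C) : R :=
  if Rle_dec 0 (Im z) then acos (Re z / Cmod z) else - acos (Re z / Cmod z).

Definition Clog (z : C) : C := (ln (Cmod z), Carg z).

Definition Csqrt (z : C) : C :=
  (sqrt ((Cmod z + Re z) / 2),
   if Rle_dec 0 (Im z) then sqrt ((Cmod z - Re z) / 2)
   else - sqrt ((Cmod z - Re z) / 2)).

Definition Casinh (z : C) : C := Clog (z + Csqrt (1 + z * z))%C.

Definition subordinate (g h : C -> C) : Prop :=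
  exists w : C -> C,
    analytic w /\ w (RtoC 0) = RtoC 0 /\
    (forall z : C, in_disc z -> Cmod (w z) <= Cmod z) /\
    (forall z : C, in_disc z -> g z = h (w z)).

(** [q] is the quotient [u / v] as an analytic function on the disc. Where this
    is used, [v] has a simple zero at the origin and [u] vanishes there, so the
    value of [q] at the origin is determined by analyticity (the singularity is
    removable); nowhere else may [v] vanish. *)
Definition analytic_quotient (u v q : C -> C) : Prop :=
  analytic q /\
  forall z : C, in_disc z -> z <> RtoC 0 ->
    v z <> RtoC 0 /\ q z = (u z / v z)%C.

Definition has_expansion (f : C -> C) (a : nat -> C) : Prop :=
  forall z : C, in_disc z -> @is_pseries C_AbsRing C_NormedModule a z (f z).

Definition class_A (n : nat) (f : C -> C) : Prop :=
  analytic f /\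
  exists a : nat -> C,
    a 0%nat = RtoC 0 /\ a 1%nat = RtoC 1 /\
    (forall k : nat, (2 <= k <= n)%nat -> a k = RtoC 0) /\
    has_expansion f a.

Definition class_P (n : nat) (alpha : R) (p : C -> C) : Prop :=
  analytic p /\
  (exists c : nat -> C,
    c 0%nat = RtoC 1 /\
    (forall k : nat, (1 <= k < n)%nat -> c k = RtoC 0) /\
    has_expansion p c) /\
  subordinate p
    (fun z : C => ((1 + RtoC (1 - 2 * alpha) * z) / (1 - z))%C).

(** [q] is the function [z f'(z) / f(z)]. *)
Definition log_derivative (f q : C -> C) : Prop :=
  analytic_quotient (fun z : C => z * C_derive f z)%C f q.

Definition starlike_rho (f : C -> C) : Prop :=
  class_A 1 f /\
  exists q : C -> C,
    log_derivative f q /\ subordinate q (fun z : C => 1 + Casinh z)%C.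

Definition starlike_rho_n (n : nat) (f : C -> C) : Prop :=
  class_A n f /\ starlike_rho f.

Definition starlike_order (n : nat) (alpha : R) (g : C -> C) : Prop :=
  class_A n g /\
  exists q : C -> C, log_derivative g q /\ class_P n alpha q.

Definition close_to_starlike (n : nat) (alpha : R) (f : C -> C) : Prop :=
  class_A n f /\
  exists g : C -> C, starlike_order n alpha g /\
    exists p : C -> C, analytic_quotient f g p /\ class_P n 0 p.

Definition dilation (r : R) (g : C -> C) : C -> C :=
  fun z : C => (/ RtoC r * g (RtoC r * z))%C.

Definition dilations_belong (G1 G2 : (C -> C) -> Prop) (r0 : R) : Prop :=
  forall g : C -> C, G2 g ->
    forall r : R, 0 < r <= r0 -> G1 (dilation r g).

(** [r0] is the (sharp) [G1]-radius of [G2]. *)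
Definition is_radius (G1 G2 : (C -> C) -> Prop) (r0 : R) : Prop :=
  0 < r0 <= 1 /\ dilations_belong G1 G2 r0 /\
  forall r1 : R, 0 < r1 <= 1 -> dilations_belong G1 G2 r1 -> r1 <= r0.

(* Main.v *)
Require Import Defs.
From Stdlib Require Import Reals.
From Coquelicot Require Import Coquelicot.
From Stdlib Require Import Lra Lia Classical ClassicalEpsilon.
Open Scope R_scope.

(** For [f = p g] with [p] in [P_n] and [g] starlike of order [alpha], the
    quantity [z f' / f] is the sum of [z g' / g], which lies in [P_n(alpha)], and
    of [z p' / p]. Schwarz's lemma with a zero of order [n] bounds the distance of
    the first one to [1], and a Schwarz-Pick inequality with a zero of order [n]
    bounds the second one; with [s = |z| ^ n] this gives
    [|z f' / f - 1| <= (2 (n - alpha + 1) s + 2 (1 - alpha) s ^ 2) / (1 - s ^ 2)].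
    The right-hand side equals [arcsinh 1] exactly at [s = r0 ^ n], and it is convex
    in [s], so after dilation by [r <= r0] it is at most [arcsinh 1 * |z|]; since
    [|sinh v| <= sinh |v|], the function [w = sinh (z f' / f - 1)] satisfies
    [|w z| <= |z|] and realizes the subordination. Sharpness comes from
    [f = z (1 + z ^ n) / (1 - z ^ n) ^ (1 + 2 (1 - alpha) / n)], for which
    [z f' / f = 1 + arcsinh 1] at [z = r0].

    Holomorphic functions are handled without integration: power series have
    second-order Taylor expansions, and these suffice for a maximum principle. *)

(** * Second-order Taylor expansions *)

(** The obstacle is that [analytic] only asserts complex differentiability at each point, which
    without Cauchy's theory gives no second-order expansion. Expansions enter through the power
    series carried by the classes: the Schwarz function of a member [p] of [class_P] is solved for
    in terms of [p], and so inherits the expansions of [p] and a zero of order [n]. The radius is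
    exact because all estimates are attained at one point. Where [z ^ n = s] is positive, the
    extremal pair reaches the bounds on [z g' / g - 1] and on [z p' / p] together, with the same
    sign; and [1 + arcsinh 1] is a boundary point, nearest to 1, of the image of the disc under
    [1 + arcsinh]. The fractional power in the extremal function is built as a binomial series and
    handled through its differential equation, so no branch of a power is needed. *)

Lemma Cmod_minus_le (a b : C) : Cmod (a - b) <= Cmod a + Cmod b.
Proof.
  unfold Cminus. rewrite <- (Cmod_opp b). apply Cmod_triangle.
Qed.

Lemma Cmod_minus_sym (a b : C) : Cmod (a - b) = Cmod (b - a).
Proof. rewrite <- Cmod_opp. f_equal. ring. Qed.

Lemma Cmod_minus_ge (a b : C) : Cmod a - Cmod b <= Cmod (a - b).
Proof.
  assert (H := Cmod_triangle (a - b) b).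
  replace (a - b + b)%C with a in H by ring. lra.
Qed.

Definition bigO (k : nat) (h : C -> C) : Prop :=
  exists K d : R, 0 <= K /\ 0 < d /\
    forall t : C, Cmod t < d -> Cmod (h t) <= K * Cmod t ^ k.

Lemma bigO_ext (k : nat) (f g : C -> C) (d : R) :
  0 < d -> (forall t : C, Cmod t < d -> f t = g t) -> bigO k f -> bigO k g.
Proof.
  intros Hd Hfg (K & e & HK & He & H).
  exists K, (Rmin d e). split; [assumption|]. split; [now apply Rmin_pos|].
  intros t Ht. rewrite <- Hfg.
  - apply H. eapply Rlt_le_trans; [apply Ht|apply Rmin_r].
  - eapply Rlt_le_trans; [apply Ht|apply Rmin_l].
Qed.

Lemma bigO_plus (k : nat) (f g : C -> C) :
  bigO k f -> bigO k g -> bigO k (fun t => f t + g t)%C.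
Proof.
  intros (K & d & HK & Hd & H) (K' & d' & HK' & Hd' & H').
  exists (K + K'), (Rmin d d'). split; [lra|]. split; [now apply Rmin_pos|].
  intros t Ht.
  assert (A := H t (Rlt_le_trans _ _ _ Ht (Rmin_l _ _))).
  assert (B := H' t (Rlt_le_trans _ _ _ Ht (Rmin_r _ _))).
  assert (D := Cmod_triangle (f t) (g t)). lra.
Qed.

Lemma bigO_mult (j k : nat) (f g : C -> C) :
  bigO j f -> bigO k g -> bigO (j + k) (fun t => f t * g t)%C.
Proof.
  intros (K & d & HK & Hd & H) (K' & d' & HK' & Hd' & H').
  exists (K * K'), (Rmin d d').
  split; [now apply Rmult_le_pos|]. split; [now apply Rmin_pos|].
  intros t Ht.
  assert (A := H t (Rlt_le_trans _ _ _ Ht (Rmin_l _ _))).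
  assert (B := H' t (Rlt_le_trans _ _ _ Ht (Rmin_r _ _))).
  rewrite Cmod_mult, pow_add.
  replace (K * K' * (Cmod t ^ j * Cmod t ^ k))
    with ((K * Cmod t ^ j) * (K' * Cmod t ^ k)) by ring.
  apply Rmult_le_compat; auto using Cmod_ge_0.
Qed.

Lemma bigO_const (c : C) : bigO 0 (fun _ => c).
Proof.
  exists (Cmod c), 1. split; [apply Cmod_ge_0|]. split; [lra|].
  intros t _. simpl. lra.
Qed.

Lemma bigO_pow (k : nat) : bigO k (fun t => t ^ k)%C.
Proof.
  exists 1, 1. split; [lra|]. split; [lra|].
  intros t _. rewrite Cmod_pow. lra.
Qed.

Lemma bigO_id : bigO 1 (fun t => t).
Proof.
  exists 1, 1. split; [lra|]. split; [lra|]. intros t _. simpl. lra.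
Qed.

Lemma bigO_weaken (j k : nat) (f : C -> C) :
  (j <= k)%nat -> bigO k f -> bigO j f.
Proof.
  intros Hjk (K & d & HK & Hd & H).
  exists K, (Rmin d 1). split; [assumption|].
  split; [apply Rmin_pos; lra|].
  intros t Ht.
  assert (A := H t (Rlt_le_trans _ _ _ Ht (Rmin_l _ _))).
  assert (B := Rlt_le_trans _ _ _ Ht (Rmin_r _ _)).
  eapply Rle_trans; [apply A|]. apply Rmult_le_compat_l; [assumption|].
  replace k with (j + (k - j))%nat by lia.
  rewrite pow_add. rewrite <- (Rmult_1_r (Cmod t ^ j)) at 2.
  apply Rmult_le_compat_l; [apply pow_le, Cmod_ge_0|].
  rewrite <- (pow1 (k - j)). apply pow_incr. split; [apply Cmod_ge_0|lra].
Qed.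

Lemma bigO_opp (k : nat) (f : C -> C) : bigO k f -> bigO k (fun t => - f t)%C.
Proof.
  intros (K & d & HK & Hd & H). exists K, d. repeat split; auto.
  intros t Ht. rewrite Cmod_opp. auto.
Qed.

(* Second order suffices for the maximum principle: the average of [|f| ^ 2] over
   [z + t], [t ^ 4 = d ^ 4], is at least its value at [z] up to [O(d ^ 3)]. *)
Definition taylor2 (f : C -> C) (z b c : C) : Prop :=
  bigO 3 (fun t => f (z + t) - (f z + b * t + c * (t * t)))%C.

Lemma taylor2_ext (f g : C -> C) (z b c : C) (d : R) :
  0 < d -> (forall t : C, Cmod t < d -> f (z + t) = g (z + t))%C ->
  taylor2 f z b c -> taylor2 g z b c.
Proof.
  intros Hd Hfg H. unfold taylor2 in *.
  assert (E : f z = g z).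
  { rewrite <- (Cplus_0_r z). apply Hfg. rewrite Cmod_0. assumption. }
  refine (bigO_ext _ _ _ d Hd _ H).
  intros t Ht. simpl. now rewrite Hfg, E.
Qed.

Lemma taylor2_bounded (f : C -> C) (z b c : C) :
  taylor2 f z b c -> bigO 0 (fun t => f (z + t))%C.
Proof.
  intros H.
  apply (bigO_ext _ (fun t => (f (z + t) - (f z + b * t + c * (t * t)))
                    + (f z + b * t + c * (t * t)))%C _ 1);
    [lra|intros; ring|].
  apply bigO_plus; [now apply (bigO_weaken 0 3); [lia|]|].
  apply bigO_plus; [apply bigO_plus|].
  - apply bigO_const.
  - apply (bigO_mult 0 0); [apply bigO_const|].
    apply (bigO_weaken 0 1); [lia|apply bigO_id].
  - apply (bigO_mult 0 0); [apply bigO_const|].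
    apply (bigO_weaken 0 2); [lia|].
    apply (bigO_mult 1 1); apply bigO_id.
Qed.

Lemma taylor2_order1 (f : C -> C) (z b c : C) :
  taylor2 f z b c -> bigO 2 (fun t => f (z + t) - (f z + b * t))%C.
Proof.
  intros H.
  apply (bigO_ext _ (fun t => (f (z + t) - (f z + b * t + c * (t * t)))
                    + c * (t * t))%C _ 1);
    [lra|intros; ring|].
  apply bigO_plus; [now apply (bigO_weaken 2 3); [lia|]|].
  apply (bigO_mult 0 2); [apply bigO_const|].
  apply (bigO_mult 1 1); apply bigO_id.
Qed.

Lemma taylor2_order0 (f : C -> C) (z b c : C) :
  taylor2 f z b c -> bigO 1 (fun t => f (z + t) - f z)%C.
Proof.
  intros H.
  apply (bigO_ext _ (fun t => (f (z + t) - (f z + b * t)) + b * t)%C _ 1);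
    [lra|intros; ring|].
  apply bigO_plus.
  - apply (bigO_weaken 1 2); [lia|]. now apply taylor2_order1 with c.
  - apply (bigO_mult 0 1); [apply bigO_const|apply bigO_id].
Qed.

Lemma taylor2_const (a z : C) : taylor2 (fun _ => a) z (RtoC 0) (RtoC 0).
Proof.
  exists 0, 1. split; [lra|]. split; [lra|]. intros t _.
  replace (a - (a + 0 * t + 0 * (t * t)))%C with (RtoC 0) by ring.
  rewrite Cmod_0. lra.
Qed.

Lemma taylor2_id (z : C) : taylor2 (fun x => x) z (RtoC 1) (RtoC 0).
Proof.
  exists 0, 1. split; [lra|]. split; [lra|]. intros t _.
  replace (z + t - (z + 1 * t + 0 * (t * t)))%C with (RtoC 0) by ring.
  rewrite Cmod_0. lra.
Qed.

Lemma taylor2_plus (f g : C -> C) (z b c b' c' : C) :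
  taylor2 f z b c -> taylor2 g z b' c' ->
  taylor2 (fun x => f x + g x)%C z (b + b')%C (c + c')%C.
Proof.
  intros H H'. refine (bigO_ext _ _ _ 1 Rlt_0_1 _ (bigO_plus _ _ _ H H')).
  intros t _. ring.
Qed.

Lemma taylor2_opp (f : C -> C) (z b c : C) :
  taylor2 f z b c -> taylor2 (fun x => - f x)%C z (- b)%C (- c)%C.
Proof.
  intros H. refine (bigO_ext _ _ _ 1 Rlt_0_1 _ (bigO_opp _ _ H)).
  intros t _. ring.
Qed.

Lemma taylor2_minus (f g : C -> C) (z b c b' c' : C) :
  taylor2 f z b c -> taylor2 g z b' c' ->
  taylor2 (fun x => f x - g x)%C z (b - b')%C (c - c')%C.
Proof.
  intros H H'. apply taylor2_plus; [assumption|]. now apply taylor2_opp.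
Qed.

Lemma taylor2_mult (f g : C -> C) (z b c b' c' : C) :
  taylor2 f z b c -> taylor2 g z b' c' ->
  taylor2 (fun x => f x * g x)%C z (b * g z + f z * b')%C
    (c * g z + b * b' + f z * c')%C.
Proof.
  intros H H'.
  (* With [P] the quadratic polynomial and [R] the remainder of each factor, the error is
     [R_f g + P_f R_g] plus the terms of degree 3 and 4 of [P_f P_g]. *)
  apply (bigO_ext _ (fun t =>
    (f (z + t) - (f z + b * t + c * (t * t))) * g (z + t)
    + ((f z + b * t + c * (t * t)) * (g (z + t) - (g z + b' * t + c' * (t * t)))
    + t ^ 3 * (b * c' + c * b' + c * c' * t)))%C _ 1);
    [lra|intros; simpl; ring|].
  assert (Hid : bigO 0 (fun t => t)) by (apply (bigO_weaken 0 1); [lia|apply bigO_id]).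
  apply bigO_plus; [|apply bigO_plus].
  - apply (bigO_mult 3 0); [assumption|]. now apply taylor2_bounded with b' c'.
  - apply (bigO_mult 0 3); [|assumption].
    apply bigO_plus; [apply bigO_plus|].
    + apply bigO_const.
    + apply (bigO_mult 0 0); [apply bigO_const|assumption].
    + apply (bigO_mult 0 0); [apply bigO_const|now apply (bigO_mult 0 0)].
  - apply (bigO_mult 3 0); [apply bigO_pow|].
    apply bigO_plus; [apply bigO_const|].
    apply (bigO_mult 0 0); [apply bigO_const|assumption].
Qed.

Lemma taylor2_nonzero_near (f : C -> C) (z b c : C) :
  taylor2 f z b c -> f z <> RtoC 0 ->
  exists d : R, 0 < d /\
    forall t : C, Cmod t < d -> Cmod (f z) / 2 <= Cmod (f (z + t)%C).
Proof.
  intros H Hz.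
  destruct (taylor2_order0 _ _ _ _ H) as (K & d & HK & Hd & HKd).
  assert (Hp : 0 < Cmod (f z)) by now apply Cmod_gt_0.
  exists (Rmin d (Cmod (f z) / (2 * (K + 1)))).
  split.
  { apply Rmin_pos; [assumption|]. apply Rdiv_lt_0_compat; lra. }
  intros t Ht.
  assert (A := HKd t (Rlt_le_trans _ _ _ Ht (Rmin_l _ _))).
  assert (B := Rlt_le_trans _ _ _ Ht (Rmin_r _ _)).
  assert (D := Cmod_minus_ge (f z) (f z - f (z + t))%C).
  replace (f z - (f z - f (z + t)))%C with (f (z + t))%C in D by ring.
  rewrite (Cmod_minus_sym (f z)) in D.
  apply (Rmult_lt_compat_r (2 * (K + 1))) in B; [|lra].
  unfold Rdiv in B. rewrite Rmult_assoc, Rinv_l in B by lra.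
  assert (P := Cmod_ge_0 t). simpl in A. nra.
Qed.

Lemma taylor2_inv (f : C -> C) (z b c : C) :
  taylor2 f z b c -> f z <> RtoC 0 ->
  taylor2 (fun x => / f x)%C z (- b / (f z * f z))%C
    (b * b / (f z * f z * f z) - c / (f z * f z))%C.
Proof.
  intros H Hz.
  destruct (taylor2_nonzero_near _ _ _ _ H Hz) as (d & Hd & Hn).
  assert (Hp : 0 < Cmod (f z)) by now apply Cmod_gt_0.
  set (B := (- b / (f z * f z))%C).
  set (D := (b * b / (f z * f z * f z) - c / (f z * f z))%C).
  (* With [Q] the candidate polynomial, [1 / f - Q = (1 - Q f) / f]. Writing [f = P + R], the
     coefficients [B] and [D] are those for which [1 - Q P] starts at [t ^ 3]. *)
  apply (bigO_ext _ (fun t =>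
    ((- (/ f z + B * t + D * (t * t)))
      * (f (z + t) - (f z + b * t + c * (t * t)))
     + t ^ 3 * (- (B * c + D * b) + - (D * c) * t)) * / f (z + t))%C _ d Hd).
  { intros t Ht. specialize (Hn t Ht).
    assert (Hne : f (z + t)%C <> RtoC 0) by (apply Cmod_gt_0; lra).
    unfold B, D. simpl. field. split; assumption. }
  assert (Hid : bigO 0 (fun t => t)) by (apply (bigO_weaken 0 1); [lia|apply bigO_id]).
  apply (bigO_mult 3 0).
  - apply bigO_plus.
    + apply (bigO_mult 0 3); [|assumption].
      apply bigO_opp. apply bigO_plus; [apply bigO_plus|].
      * apply bigO_const.
      * apply (bigO_mult 0 0); [apply bigO_const|assumption].
      * apply (bigO_mult 0 0); [apply bigO_const|now apply (bigO_mult 0 0)].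
    + apply (bigO_mult 3 0); [apply bigO_pow|].
      apply bigO_plus; [apply bigO_const|].
      apply (bigO_mult 0 0); [apply bigO_const|assumption].
  - exists (/ (Cmod (f z) / 2)), d. split; [|split; [assumption|]].
    { left. apply Rinv_0_lt_compat. lra. }
    intros t Ht. specialize (Hn t Ht).
    assert (Hne : f (z + t)%C <> RtoC 0) by (apply Cmod_gt_0; lra).
    rewrite Cmod_inv by assumption. simpl. rewrite Rmult_1_r.
    apply Rinv_le_contravar; lra.
Qed.

Lemma taylor2_div (f g : C -> C) (z b c b' c' : C) :
  taylor2 f z b c -> taylor2 g z b' c' -> g z <> RtoC 0 ->
  exists c'' : C,
  taylor2 (fun x => f x / g x)%C z ((b * g z - f z * b') / (g z * g z))%C c''.
Proof.
  intros H H' Hz. eexists.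
  replace ((b * g z - f z * b') / (g z * g z))%C
    with (b * (/ g z) + f z * (- b' / (g z * g z)))%C by (field; assumption).
  apply (taylor2_mult f (fun x => / g x)%C); [eassumption|].
  apply taylor2_inv; eassumption.
Qed.

Lemma taylor2_pow (f : C -> C) (z b c : C) (n : nat) :
  taylor2 f z b c ->
  exists c' : C,
  taylor2 (fun x => f x ^ n)%C z (INR n * f z ^ (pred n) * b)%C c'.
Proof.
  intros H. induction n as [|n [c' IH]].
  - exists (RtoC 0). simpl.
    replace (0 * 1 * b)%C with (RtoC 0) by ring. apply taylor2_const.
  - eexists.
    replace (INR (S n) * f z ^ pred (S n) * b)%C
      with (b * f z ^ n + f z * (INR n * f z ^ pred n * b))%C.
    + apply (taylor2_mult f (fun x => f x ^ n)%C); eassumption.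
    + rewrite S_INR, RtoC_plus. destruct n as [|n]; simpl; [simpl; ring|].
      ring.
Qed.

(** * From Taylor expansions to complex derivatives *)

Lemma is_derive_eps (f : C -> C) (z l : C) :
  (forall eps : R, 0 < eps -> exists d : R, 0 < d /\ forall t : C, Cmod t < d ->
     Cmod (f (z + t) - f z - l * t)%C <= eps * Cmod t) ->
  @is_derive C_AbsRing C_NormedModule f z l.
Proof.
  intros H. split; [apply is_linear_scal_l|].
  intros x Hx. 
  apply (@is_filter_lim_locally_unique _ (AbsRing_NormedModule C_AbsRing)) in Hx.
  subst x.
  intros eps. destruct (H eps (cond_pos eps)) as (d & Hd & Hf).
  apply (@locally_le_locally_norm C_AbsRing (AbsRing_NormedModule C_AbsRing)).
  exists (mkposreal d Hd). intros y Hy.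
  change (Cmod (y - z)%C < d) in Hy.
  change (Cmod (f y - f z - (y - z) * l)%C <= eps * Cmod (y - z)%C).
  specialize (Hf (y - z)%C Hy).
  assert (E : forall u v : C, (u + (v - u))%C = v) by (intros; ring).
  rewrite E in Hf. now rewrite (Cmult_comm (y - z)).
Qed.

Lemma bigO_is_derive (f : C -> C) (z b : C) :
  bigO 2 (fun t => f (z + t) - (f z + b * t))%C ->
  @is_derive C_AbsRing C_NormedModule f z b.
Proof.
  intros (K & d & HK & Hd & HKd). apply is_derive_eps.
  intros eps Heps. exists (Rmin d (eps / (K + 1))). split.
  { apply Rmin_pos; [assumption|]. apply Rdiv_lt_0_compat; lra. }
  intros t Ht.
  assert (A := HKd t (Rlt_le_trans _ _ _ Ht (Rmin_l _ _))).
  assert (B := Rlt_le_trans _ _ _ Ht (Rmin_r _ _)).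
  replace (f (z + t) - f z - b * t)%C with (f (z + t) - (f z + b * t))%C by ring.
  apply (Rmult_lt_compat_r (K + 1)) in B; [|lra].
  unfold Rdiv in B. rewrite Rmult_assoc, Rinv_l in B by lra.
  assert (P := Cmod_ge_0 t). simpl in A. nra.
Qed.

Lemma taylor2_is_derive (f : C -> C) (z b c : C) :
  taylor2 f z b c -> @is_derive C_AbsRing C_NormedModule f z b.
Proof. intros H. apply bigO_is_derive. now apply taylor2_order1 with c. Qed.

(** * The maximum principle *)

(** Semicontinuity rather than continuity, because the lemma is applied on a square to a function
    that drops abruptly outside a disc. *)
Lemma usc_attains_max (u : R -> R -> R) (r B : R) :
  0 <= r ->
  (forall x y, -r <= x <= r -> -r <= y <= r -> u x y <= B) ->
  (forall x y eps, -r <= x <= r -> -r <= y <= r -> 0 < eps ->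
     exists d, 0 < d /\ forall x' y', -r <= x' <= r -> -r <= y' <= r ->
       Rabs (x' - x) < d -> Rabs (y' - y) < d -> u x' y' < u x y + eps) ->
  exists x0 y0, -r <= x0 <= r /\ -r <= y0 <= r /\
    forall x y, -r <= x <= r -> -r <= y <= r -> u x y <= u x0 y0.
Proof.
  intros Hr HB Husc.
  set (E := fun s => exists x y, -r <= x <= r /\ -r <= y <= r /\ s = u x y).
  destruct (completeness E) as [M [Hub Hlub]].
  { exists B. intros s (x & y & Hx & Hy & ->). now apply HB. }
  { exists (u 0 0), 0, 0. repeat split; lra. }
  assert (Hle : forall x y, -r <= x <= r -> -r <= y <= r -> u x y <= M).
  { intros x y Hx Hy. apply Hub. exists x, y. auto. }
  apply NNPP. intros Hno.
  assert (Hlt : forall x y, -r <= x <= r -> -r <= y <= r -> u x y < M).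
  { intros x y Hx Hy. destruct (Rle_lt_or_eq_dec _ _ (Hle x y Hx Hy)) as [H|H];
      [assumption|].
    exfalso. apply Hno. exists x, y. split; [assumption|]. split; [assumption|].
    rewrite H. assumption. }
  (* The gauge is also bounded by half the defect [M - u], so that the uniform
     lower bound of the gauge given by compactness keeps [u] away from [M]. *)
  assert (Hgauge : forall x y, exists d : posreal, -r <= x <= r -> -r <= y <= r ->
    d <= (M - u x y) / 2 /\
    forall x' y', -r <= x' <= r -> -r <= y' <= r ->
       Rabs (x' - x) < d -> Rabs (y' - y) < d -> u x' y' < u x y + (M - u x y) / 2).
  { intros x y.
    destruct (classic (-r <= x <= r /\ -r <= y <= r)) as [[Hx Hy]|Hn].
    - assert (He : 0 < (M - u x y) / 2) by (specialize (Hlt x y Hx Hy); lra).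
      destruct (Husc x y _ Hx Hy He) as (d & Hd & Hdd).
      exists (mkposreal _ (Rmin_pos _ _ Hd He)). intros _ _. simpl. split.
      + apply Rmin_r.
      + intros x' y' Hx' Hy' H1 H2. apply Hdd; auto.
        * eapply Rlt_le_trans; [apply H1|apply Rmin_l].
        * eapply Rlt_le_trans; [apply H2|apply Rmin_l].
    - exists (mkposreal 1 Rlt_0_1). tauto. }
  set (delta := fun x y => proj1_sig (constructive_indefinite_description _ (Hgauge x y))).
  destruct (compactness_value_2d (-r) r (-r) r delta) as [d Hd].
  assert (Hbound : forall x y, -r <= x <= r -> -r <= y <= r -> u x y <= M - d).
  { intros x y Hx Hy. apply NNPP. intros Hc. apply (Hd x y Hx Hy).
    intros (a & b & Ha & Hb & Hxa & Hyb & Hdd). apply Hc.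
    unfold delta in *.
    destruct (constructive_indefinite_description _ (Hgauge a b)) as [e He]. simpl in *.
    destruct (He Ha Hb) as [He1 He2].
    specialize (He2 x y Hx Hy Hxa Hyb). lra. }
  assert (M <= M - d).
  { apply Hlub. intros s (x & y & Hx & Hy & ->). now apply Hbound. }
  assert (P := cond_pos d). lra.
Qed.

Lemma Cmod_near_components (a b : C) (d : R) :
  Rabs (fst a - fst b) < d / 2 -> Rabs (snd a - snd b) < d / 2 -> Cmod (a - b) < d.
Proof.
  intros H1 H2.
  assert (Hd : 0 < d) by (assert (P := Rabs_pos (fst a - fst b)); lra).
  eapply Rle_lt_trans; [apply Cmod_2Rmax|].
  simpl. fold (fst a - fst b). fold (snd a - snd b).
  assert (Hm : Rmax (Rabs (fst a - fst b)) (Rabs (snd a - snd b)) < d / 2)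
    by (apply Rmax_lub_lt; assumption).
  assert (Hm0 : 0 <= Rmax (Rabs (fst a - fst b)) (Rabs (snd a - snd b)))
    by (eapply Rle_trans; [apply Rabs_pos|apply Rmax_l]).
  assert (Hs : sqrt 2 < 2).
  { rewrite <- (sqrt_square 2) at 2 by lra. apply sqrt_lt_1; lra. }
  assert (Hs0 := sqrt_pos 2).
  unfold Rminus in *. nra.
Qed.

Lemma Cmod_components_le (z : C) (r : R) :
  Cmod z <= r -> -r <= fst z <= r /\ -r <= snd z <= r.
Proof.
  intros H. assert (A := Rmax_Cmod z).
  assert (B := Rmax_l (Rabs (fst z)) (Rabs (snd z))).
  assert (D := Rmax_r (Rabs (fst z)) (Rabs (snd z))).
  split; apply Rabs_le_between; lra.
Qed.

Lemma usc_disc_attains_max (u : C -> R) (r B : R) :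
  0 <= r ->
  (forall z, Cmod z <= r -> 0 <= u z <= B) ->
  (forall z eps, Cmod z <= r -> 0 < eps -> exists d, 0 < d /\
     forall z', Cmod z' <= r -> Cmod (z' - z) < d -> u z' < u z + eps) ->
  exists z0, Cmod z0 <= r /\ forall z, Cmod z <= r -> u z <= u z0.
Proof.
  intros Hr Hu Husc.
  (* The value -1 lies below all values of [u] on the disc, so the extension stays upper
     semicontinuous and its maximum falls in the disc. *)
  set (v := fun x y : R => if Rle_dec (Cmod (x, y)) r then u (x, y) else -1).
  assert (H00 : Cmod (0, 0) <= r) by (change (0,0) with (RtoC 0); rewrite Cmod_0; lra).
  destruct (usc_attains_max v r B) as (x0 & y0 & _ & _ & Hmax).
  - assumption.
  - intros x y _ _. unfold v. destruct (Rle_dec (Cmod (x, y)) r) as [H|H].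
    + now apply Hu.
    + destruct (Hu _ H00). lra.
  - intros x y eps _ _ He. unfold v at 2.
    destruct (Rle_dec (Cmod (x, y)) r) as [H|H].
    + destruct (Husc (x, y) eps H He) as (d & Hd & Hdd).
      exists (d / 2). split; [lra|]. intros x' y' _ _ H1 H2.
      unfold v. destruct (Rle_dec (Cmod (x', y')) r) as [H'|H'].
      * apply Hdd; [assumption|]. now apply Cmod_near_components.
      * destruct (Hu _ H). lra.
    + apply Rnot_le_lt in H.
      exists ((Cmod (x, y) - r) / 2). split; [lra|]. intros x' y' _ _ H1 H2.
      unfold v. destruct (Rle_dec (Cmod (x', y')) r) as [H'|H']; [|lra].
      exfalso.
      assert (A : Cmod ((x', y') - (x, y))%C < Cmod (x, y) - r)
        by now apply Cmod_near_components.
      rewrite Cmod_minus_sym in A.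
      assert (D := Cmod_minus_ge (x, y) ((x, y) - (x', y'))%C).
      assert (E : forall a b : C, (a - (a - b))%C = b) by (intros; ring).
      rewrite E in D. lra.
  - assert (Hin : Cmod (x0, y0) <= r).
    { apply Rnot_lt_le. intros Hc.
      assert (A := Hmax 0 0). unfold v in A.
      destruct (Rle_dec (Cmod (x0, y0)) r); [lra|].
      destruct (Rle_dec (Cmod (0, 0)) r); [|lra].
      destruct (Hu _ H00). specialize (A ltac:(lra) ltac:(lra)). lra. }
    exists (x0, y0). split; [assumption|]. intros [x y] Hz.
    destruct (Cmod_components_le _ _ Hz) as [Hx Hy].
    specialize (Hmax x y Hx Hy). unfold v in Hmax.
    destruct (Rle_dec (Cmod (x, y)) r); [|lra].
    destruct (Rle_dec (Cmod (x0, y0)) r); lra.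
Qed.

Lemma Cmod_sq (z : C) : Cmod z ^ 2 = fst z ^ 2 + snd z ^ 2.
Proof. apply Cmod2_alt. Qed.

(* Averaging over the fourth roots of unity kills all cross terms. *)
Lemma fourth_roots_average (a b c : C) (d : R) :
  let P := fun t : C => (a + b * t + c * (t * t))%C in
  Cmod (P (d, 0)) ^ 2 + Cmod (P (- d, 0)) ^ 2
  + Cmod (P (0, d)) ^ 2 + Cmod (P (0, - d)) ^ 2
  = 4 * (Cmod a ^ 2 + d ^ 2 * Cmod b ^ 2 + d ^ 4 * Cmod c ^ 2).
Proof.
  intros P. unfold P. rewrite !Cmod_sq. destruct a, b, c. simpl. ring.
Qed.

(** The term [eps |z| ^ 2] makes the mean-value inequality strict: averaging it over four points at
    distance [s] gains exactly [eps s ^ 2], which beats the cubic error of the expansion for small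
    [s]. *)
Lemma taylor2_no_strict_max (H : C -> C) (z0 b c : C) (r eps : R) :
  taylor2 H z0 b c -> Cmod z0 < r -> 0 < eps ->
  exists z, Cmod z <= r /\
    Cmod (H z0) ^ 2 + eps * Cmod z0 ^ 2 < Cmod (H z) ^ 2 + eps * Cmod z ^ 2.
Proof.
  intros (K & d & HK & Hd & HKd) Hz0 Heps. apply NNPP. intros Hno.
  assert (Hle : forall z, Cmod z <= r ->
    Cmod (H z) ^ 2 + eps * Cmod z ^ 2 <= Cmod (H z0) ^ 2 + eps * Cmod z0 ^ 2).
  { intros z Hz. apply Rnot_lt_le. intros Hc. apply Hno. now exists z. }
  set (P := fun t : C => (H z0 + b * t + c * (t * t))%C).
  set (M := Cmod (H z0) + Cmod b + Cmod c).
  assert (HM : 0 <= M).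
  { assert (A1 := Cmod_ge_0 (H z0)). assert (A2 := Cmod_ge_0 b).
    assert (A3 := Cmod_ge_0 c). unfold M. lra. }
  assert (HMK : 0 <= M * K) by now apply Rmult_le_pos.
  (* In order: the expansion is valid at distance [s], the four points stay in the disc, [|P| <= M]
     on them, and [2 M K s ^ 3 < eps s ^ 2]. *)
  set (s := Rmin (Rmin (d / 2) (r - Cmod z0)) (Rmin 1 (eps / (2 * (M * K) + 1) / 2))).
  assert (Hq : 0 < eps / (2 * (M * K) + 1)) by (apply Rdiv_lt_0_compat; lra).
  assert (Hs : 0 < s) by (unfold s; repeat apply Rmin_pos; lra).
  assert (Hs1 : s <= d / 2) by (unfold s; eapply Rle_trans; apply Rmin_l).
  assert (Hs2 : s <= r - Cmod z0)
    by (unfold s; eapply Rle_trans; [apply Rmin_l|apply Rmin_r]).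
  assert (Hs3 : s <= 1) by (unfold s; eapply Rle_trans; [apply Rmin_r|apply Rmin_l]).
  assert (Hs4 : 2 * (M * K) * s < eps).
  { assert (A : s <= eps / (2 * (M * K) + 1) / 2)
      by (unfold s; eapply Rle_trans; [apply Rmin_r|apply Rmin_r]).
    apply (Rmult_le_compat_r (2 * (M * K) + 1)) in A; [|lra].
    replace (eps / (2 * (M * K) + 1) / 2 * (2 * (M * K) + 1)) with (eps / 2) in A
      by (field; lra).
    nra. }
  assert (Hpt : forall t, Cmod t = s ->
    Cmod (P t) ^ 2 + eps * Cmod (z0 + t)%C ^ 2
      <= Cmod (H z0) ^ 2 + eps * Cmod z0 ^ 2 + 2 * M * K * s ^ 3).
  { intros t Ht.
    assert (A := HKd t ltac:(lra)). rewrite Ht in A. fold (P t) in A.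
    assert (A2 := Cmod_minus_ge (P t) (H (z0 + t))%C).
    rewrite Cmod_minus_sym in A2.
    assert (A3 := Hle (z0 + t)%C).
    assert (A4 := Cmod_triangle z0 t).
    specialize (A3 ltac:(lra)).
    assert (A5 : Cmod (P t) <= M).
    { unfold P, M. eapply Rle_trans; [apply Cmod_triangle|].
      apply Rplus_le_compat.
      - eapply Rle_trans; [apply Cmod_triangle|]. apply Rplus_le_compat_l.
        rewrite Cmod_mult, Ht. assert (Z := Cmod_ge_0 b). nra.
      - rewrite !Cmod_mult, Ht. assert (Z := Cmod_ge_0 c).
        assert (s * s <= 1) by nra. nra. }
    assert (A6 := Cmod_ge_0 (P t)). assert (A7 := Cmod_ge_0 (H (z0 + t)%C)).
    assert (A8 : 0 <= K * s ^ 3) by (apply Rmult_le_pos; [assumption|apply pow_le; lra]).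
    (* Squaring [|H| >= |P| - K s ^ 3] needs a nonnegative right-hand side; otherwise the left-hand
       side of the claim is at most 0. *)
    assert (A9 : Cmod (P t) ^ 2 - 2 * Cmod (P t) * (K * s ^ 3) <= Cmod (H (z0 + t)%C) ^ 2).
    { destruct (Rle_dec (Cmod (P t)) (K * s ^ 3)); simpl; nra. }
    nra. }
  assert (Hav := fourth_roots_average (H z0) b c s). cbv zeta in Hav. fold P in Hav.
  (* The same identity for the polynomial [z0 + t] computes the gain from the term [eps |z| ^ 2]. *)
  assert (Hav2 := fourth_roots_average z0 (RtoC 1) (RtoC 0) s). cbv beta zeta in Hav2.
  assert (Hsq : forall t : C, (z0 + 1 * t + 0 * (t * t))%C = (z0 + t)%C) by (intros; ring).
  rewrite !Hsq, Cmod_1, Cmod_0 in Hav2.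
  assert (Hm : forall x y, x ^ 2 + y ^ 2 = s ^ 2 -> Cmod (x, y) = s).
  { intros x y Hxy. unfold Cmod. simpl fst. simpl snd. rewrite Hxy.
    rewrite <- Rsqr_pow2. apply sqrt_Rsqr. lra. }
  assert (P1 := Hpt (s, 0) (Hm s 0 ltac:(ring))).
  assert (P2 := Hpt (- s, 0) (Hm (- s) 0 ltac:(ring))).
  assert (P3 := Hpt (0, s) (Hm 0 s ltac:(ring))).
  assert (P4 := Hpt (0, - s) (Hm 0 (- s) ltac:(ring))).
  assert (Q1 : 0 <= s ^ 2 * Cmod b ^ 2) by (apply Rmult_le_pos; apply pow2_ge_0).
  assert (Q2 : 0 <= s ^ 4 * Cmod c ^ 2)
    by (apply Rmult_le_pos; [apply pow_le; lra|apply pow2_ge_0]).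
  assert (Q3 : 2 * M * K * s ^ 3 < eps * s ^ 2).
  { replace (2 * M * K * s ^ 3) with (2 * (M * K) * s * s ^ 2) by ring.
    apply Rmult_lt_compat_r; [apply pow_lt; lra|assumption]. }
  nra.
Qed.

Lemma taylor2_usc (H : C -> C) (z b c : C) (eps : R) :
  taylor2 H z b c -> 0 < eps ->
  exists d, 0 < d /\ forall z', Cmod (z' - z) < d -> Cmod (H z') < Cmod (H z) + eps.
Proof.
  intros HT Heps. destruct (taylor2_order0 _ _ _ _ HT) as (K & d & HK & Hd & HKd).
  exists (Rmin d (eps / (K + 1))). split.
  { apply Rmin_pos; [assumption|]. apply Rdiv_lt_0_compat; lra. }
  intros z' Hz'.
  assert (A := HKd (z' - z)%C (Rlt_le_trans _ _ _ Hz' (Rmin_l _ _))).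
  assert (B := Rlt_le_trans _ _ _ Hz' (Rmin_r _ _)).
  replace (z + (z' - z))%C with z' in A by ring.
  apply (Rmult_lt_compat_r (K + 1)) in B; [|lra].
  unfold Rdiv in B. rewrite Rmult_assoc, Rinv_l in B by lra.
  assert (P := Cmod_ge_0 (z' - z)). simpl in A.
  assert (D := Cmod_minus_ge (H z') (H z)). nra.
Qed.

(** The second alternative admits functions patched by 0 at a puncture, where no expansion is known:
    a maximum of [|H| ^ 2 + eps |z| ^ 2] at such a point is harmless since [H] vanishes there. *)
Lemma max_principle_closed_disc (H : C -> C) (r B K : R) :
  0 <= r -> 0 <= B ->
  (forall z, Cmod z <= r -> Cmod (H z) <= K) ->
  (forall z, Cmod z <= r ->
     (exists b c, taylor2 H z b c) \/
     (H z = RtoC 0 /\ forall eps, 0 < eps -> exists d, 0 < d /\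
        forall z', Cmod (z' - z) < d -> Cmod (H z') < eps)) ->
  (forall z, Cmod z = r -> Cmod (H z) <= B) ->
  forall z, Cmod z <= r -> Cmod (H z) <= B.
Proof.
  intros Hr HB HK Hreg Hbd.
  assert (Hcont : forall z eps, Cmod z <= r -> 0 < eps -> exists d, 0 < d /\
    forall z', Cmod (z' - z) < d -> Cmod (H z') < Cmod (H z) + eps).
  { intros z eps Hz He. destruct (Hreg z Hz) as [(b & c & HT)|[H0 HC]].
    - now apply taylor2_usc with b c.
    - destruct (HC eps He) as (d & Hd & Hdd). exists d. split; [assumption|].
      intros z' Hz'. rewrite H0, Cmod_0. specialize (Hdd z' Hz'). lra. }
  assert (Hsq : forall eps, 0 < eps -> forall z, Cmod z <= r ->
    Cmod (H z) ^ 2 <= B ^ 2 + eps * r ^ 2).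
  { intros eps He.
    assert (HK0 : 0 <= K).
    { assert (A := HK (RtoC 0)). rewrite Cmod_0 in A. specialize (A Hr).
      assert (Z := Cmod_ge_0 (H (RtoC 0))). lra. }
    destruct (usc_disc_attains_max
      (fun z => Cmod (H z) ^ 2 + eps * Cmod z ^ 2) r (K ^ 2 + eps * r ^ 2))
      as (z0 & Hz0 & Hmax).
    - assumption.
    - intros z Hz. specialize (HK z Hz).
      assert (A := Cmod_ge_0 (H z)). assert (A2 := Cmod_ge_0 z).
      assert (Cmod (H z) ^ 2 <= K ^ 2) by (apply pow_incr; lra).
      assert (Cmod z ^ 2 <= r ^ 2) by (apply pow_incr; lra).
      split; [|nra]. apply Rplus_le_le_0_compat; [apply pow2_ge_0|].
      apply Rmult_le_pos; [lra|apply pow2_ge_0].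
    - intros z e Hz Hee.
      (* As [e1] and [e2] are at most 1, the squares [(|H z| + e1) ^ 2] and [(|z| + e2) ^ 2] grow
         linearly in them; each change is kept below [e / 2]. *)
      set (e1 := Rmin 1 (e / 2 / (2 * Cmod (H z) + 2))).
      set (e2 := Rmin 1 (e / 2 / ((2 * Cmod z + 2) * eps))).
      assert (A := Cmod_ge_0 (H z)). assert (A2 := Cmod_ge_0 z).
      assert (He1 : 0 < e1).
      { apply Rmin_pos; [lra|]. apply Rdiv_lt_0_compat; lra. }
      assert (He2 : 0 < e2).
      { apply Rmin_pos; [lra|]. apply Rdiv_lt_0_compat; [lra|].
        apply Rmult_lt_0_compat; lra. }
      destruct (Hcont z e1 Hz He1) as (d & Hd & Hdd).
      exists (Rmin d e2). split; [now apply Rmin_pos|].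
      intros z' Hz' Hzz.
      assert (B1 := Hdd z' (Rlt_le_trans _ _ _ Hzz (Rmin_l _ _))).
      assert (B2 := Rlt_le_trans _ _ _ Hzz (Rmin_r _ _)).
      assert (B3 := Cmod_minus_ge z' z).
      assert (B4 : e1 <= 1) by apply Rmin_l.
      assert (B5 : e2 <= 1) by apply Rmin_l.
      assert (B6 : e1 * (2 * Cmod (H z) + 2) <= e / 2).
      { replace (e / 2) with (e / 2 / (2 * Cmod (H z) + 2) * (2 * Cmod (H z) + 2))
          by (field; lra).
        apply Rmult_le_compat_r; [lra|apply Rmin_r]. }
      assert (B7 : e2 * ((2 * Cmod z + 2) * eps) <= e / 2).
      { replace (e / 2) with (e / 2 / ((2 * Cmod z + 2) * eps) * ((2 * Cmod z + 2) * eps))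
          by (field; lra).
        apply Rmult_le_compat_r; [nra|apply Rmin_r]. }
      assert (B8 := Cmod_ge_0 (H z')). assert (B9 := Cmod_ge_0 z').
      assert (D1 : Cmod (H z') ^ 2 < (Cmod (H z) + e1) ^ 2) by nra.
      assert (D2 : Cmod z' ^ 2 <= (Cmod z + e2) ^ 2) by (apply pow_incr; lra).
      assert (D3 : eps * Cmod z' ^ 2 <= eps * (Cmod z + e2) ^ 2)
        by (apply Rmult_le_compat_l; lra).
      assert (D4 : (Cmod (H z) + e1) ^ 2 <= Cmod (H z) ^ 2 + e / 2) by nra.
      assert (D5 : eps * (e2 * e2) <= eps * e2) by (apply Rmult_le_compat_l; nra).
      nra.
    - assert (Hz0b : Cmod (H z0) ^ 2 <= B ^ 2).
      { destruct (Rle_lt_or_eq_dec _ _ Hz0) as [Hlt|Heq].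
        - destruct (Hreg z0 Hz0) as [(b & c & HT)|[H0 _]].
          + destruct (taylor2_no_strict_max _ _ _ _ _ _ HT Hlt He) as (z & Hz & Hc).
            specialize (Hmax z Hz). simpl in Hmax, Hc. lra.
          + rewrite H0, Cmod_0. simpl. nra.
        - apply pow_incr. split; [apply Cmod_ge_0|auto]. }
      intros z Hz. specialize (Hmax z Hz). simpl in Hmax.
      assert (A2 := Cmod_ge_0 z0).
      assert (Cmod z0 ^ 2 <= r ^ 2) by (apply pow_incr; lra).
      assert (0 <= eps * Cmod z ^ 2) by (apply Rmult_le_pos; [lra|apply pow2_ge_0]).
      assert (eps * Cmod z0 ^ 2 <= eps * r ^ 2) by (apply Rmult_le_compat_l; lra).
      simpl in *. lra. }
  intros z Hz. apply Rnot_lt_le. intros Hc.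
  (* This [eps] makes [eps r ^ 2] at most half of the supposed excess. *)
  assert (A := Hsq ((Cmod (H z) ^ 2 - B ^ 2) / (2 * (r ^ 2 + 1)))).
  assert (Hg : 0 < Cmod (H z) ^ 2 - B ^ 2) by nra.
  assert (Hr2 := pow2_ge_0 r).
  specialize (A ltac:(apply Rdiv_lt_0_compat; lra) z Hz).
  set (g := Cmod (H z) ^ 2 - B ^ 2) in *.
  assert (E : g / (2 * (r ^ 2 + 1)) * r ^ 2 <= g / 2).
  { replace (g / 2) with (g / (2 * (r ^ 2 + 1)) * (r ^ 2 + 1)) by (field; lra).
    apply Rmult_le_compat_l; [|lra]. left. apply Rdiv_lt_0_compat; lra. }
  unfold g in *. lra.
Qed.

Lemma pow_unbounded_le_1 (x B : R) : 0 <= x -> (forall m : nat, x ^ m <= B) -> x <= 1.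
Proof.
  intros Hx H. apply Rnot_lt_le. intros Hc.
  destruct (Pow_x_infinity x) with (b := B + 1) as [N HN].
  { rewrite Rabs_pos_eq; lra. }
  specialize (HN N (Nat.le_refl _)). rewrite Rabs_pos_eq in HN by now apply pow_le.
  specialize (H N). lra.
Qed.

(* Punctures at [0] and [z0] are harmless for bounded functions: apply the
   maximum principle to [S ^ m * z * (z - z0)] and let [m] go to infinity. *)
Lemma max_principle_punctured (S : C -> C) (z0 : C) (K : R) :
  Cmod z0 < 1 ->
  (forall z, Cmod z < 1 -> z <> RtoC 0 -> z <> z0 ->
     Cmod (S z) <= K /\ exists b c, taylor2 S z b c) ->
  (forall eps, 0 < eps -> exists r0, r0 < 1 /\
     forall z, r0 < Cmod z < 1 -> Cmod (S z) <= 1 + eps) ->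
  forall z, Cmod z < 1 -> z <> RtoC 0 -> z <> z0 -> Cmod (S z) <= 1.
Proof.
  intros Hz0 HS Hlim z Hz Hz1 Hz2.
  assert (HK : 0 <= K).
  { destruct (HS z Hz Hz1 Hz2). assert (A := Cmod_ge_0 (S z)). lra. }
  assert (Hpos : 0 < Cmod z * Cmod (z - z0)%C).
  { apply Rmult_lt_0_compat; apply Cmod_gt_0; [assumption|].
    now apply Cminus_eq_contra. }
  enough (Heps : forall eps, 0 < eps -> Cmod (S z) <= 1 + eps).
  { apply Rnot_lt_le. intros Hc. specialize (Heps ((Cmod (S z) - 1) / 2)). lra. }
  intros eps He.
  enough (Hq : Cmod (S z) / (1 + eps) <= 1).
  { apply (Rmult_le_compat_r (1 + eps)) in Hq; [|lra].
    unfold Rdiv in Hq. rewrite Rmult_assoc, Rinv_l in Hq; lra. }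
  apply pow_unbounded_le_1 with (2 / (Cmod z * Cmod (z - z0)%C)).
  { apply Rmult_le_pos; [apply Cmod_ge_0|]. left. apply Rinv_0_lt_compat. lra. }
  intros m.
  set (H := fun x : C => if Ceq_dec x (RtoC 0) then RtoC 0 else
                 if Ceq_dec x z0 then RtoC 0 else
                 (S x ^ m * (x * (x - z0)))%C).
  assert (HHle : forall x, Cmod x < 1 -> Cmod (H x) <= K ^ m * (Cmod x * Cmod (x - z0)%C)).
  { intros x Hx. unfold H.
    assert (P : 0 <= K ^ m * (Cmod x * Cmod (x - z0)%C)).
    { apply Rmult_le_pos; [now apply pow_le|].
      apply Rmult_le_pos; apply Cmod_ge_0. }
    destruct (Ceq_dec x (RtoC 0)); [now rewrite Cmod_0|].
    destruct (Ceq_dec x z0); [now rewrite Cmod_0|].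
    rewrite !Cmod_mult, Cmod_pow. apply Rmult_le_compat_r.
    - apply Rmult_le_pos; apply Cmod_ge_0.
    - apply pow_incr. split; [apply Cmod_ge_0|]. now apply HS. }
  assert (Hle2 : forall x, Cmod x < 1 -> Cmod x * Cmod (x - z0)%C <= 2).
  { intros x Hx. assert (A := Cmod_minus_le x z0). assert (A1 := Cmod_ge_0 x).
    assert (A2 := Cmod_ge_0 (x - z0)). nra. }
  destruct (Hlim eps He) as (r0 & Hr0 & Hr0b).
  (* The disc of radius [r] contains [z], and its boundary circle lies in the zone [r0 < |x| < 1]
     where [|S| <= 1 + eps]. *)
  set (r := Rmax (Cmod z) ((1 + Rmax r0 0) / 2)).
  assert (Hr0m : Rmax r0 0 < 1) by (apply Rmax_lub_lt; lra).
  assert (Hr : r < 1) by (apply Rmax_lub_lt; lra).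
  assert (Hrr : r0 < r).
  { assert (A := Rmax_r (Cmod z) ((1 + Rmax r0 0) / 2)). fold r in A.
    assert (A2 := Rmax_l r0 0). lra. }
  assert (Hr00 : 0 <= r).
  { assert (A := Rmax_l (Cmod z) ((1 + Rmax r0 0) / 2)). fold r in A.
    assert (A2 := Cmod_ge_0 z). lra. }
  assert (HKm := pow_le K m HK).
  assert (HHz : Cmod (H z) <= (1 + eps) ^ m * 2).
  { apply max_principle_closed_disc with r (K ^ m * 2).
    - assumption.
    - apply Rmult_le_pos; [apply pow_le|]; lra.
    - intros x Hx. eapply Rle_trans; [apply HHle; lra|].
      apply Rmult_le_compat_l; [assumption|]. apply Hle2. lra.
    - intros x Hx.
      destruct (classic (x = RtoC 0 \/ x = z0)) as [Hxx|Hxx].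
      + right.
        assert (Hp0 : Cmod x * Cmod (x - z0)%C = 0).
        { destruct Hxx as [->| ->].
          - rewrite Cmod_0. ring.
          - replace (z0 - z0)%C with (RtoC 0) by ring. rewrite Cmod_0. ring. }
        split.
        { apply Cmod_eq_0. apply Rle_antisym; [|apply Cmod_ge_0].
          eapply Rle_trans; [apply HHle; lra|]. rewrite Hp0. lra. }
        intros e Hee.
        exists (Rmin (1 - r) (e / (3 * (K ^ m + 1)))). split.
        { apply Rmin_pos; [lra|]. apply Rdiv_lt_0_compat; lra. }
        intros x' Hx'.
        assert (B1 := Rlt_le_trans _ _ _ Hx' (Rmin_l _ _)).
        assert (B2 := Rlt_le_trans _ _ _ Hx' (Rmin_r _ _)).
        assert (B3 := Cmod_minus_ge x' x).
        assert (B4 : Cmod x' < 1) by lra.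
        eapply Rle_lt_trans; [apply HHle; assumption|].
        assert (B5 : Cmod x' * Cmod (x' - z0)%C <= 3 * Cmod (x' - x)%C).
        { destruct Hxx as [->| ->].
          - replace (x' - 0)%C with x' in * by ring.
            assert (A := Cmod_minus_le x' z0). assert (A1 := Cmod_ge_0 x').
            rewrite Rmult_comm. apply Rmult_le_compat_r; lra.
          - apply Rmult_le_compat_r; [apply Cmod_ge_0|lra]. }
        apply (Rmult_lt_compat_r (3 * (K ^ m + 1))) in B2; [|lra].
        replace (e / (3 * (K ^ m + 1)) * (3 * (K ^ m + 1))) with e in B2 by (field; lra).
        assert (B6 := Cmod_ge_0 (x' - x)).
        assert (B7 : K ^ m * (Cmod x' * Cmod (x' - z0)%C) <= K ^ m * (3 * Cmod (x' - x)%C))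
          by (apply Rmult_le_compat_l; assumption).
        nra.
      + left. apply not_or_and in Hxx. destruct Hxx as [Hx0 Hxz].
        destruct (HS x ltac:(lra) Hx0 Hxz) as [_ (b & c & HT)].
        destruct (taylor2_pow _ _ _ _ m HT) as [c' HTm].
        do 2 eexists.
        apply (taylor2_ext (fun x => S x ^ m * (x * (x - z0)))%C _ _ _ _
                 (Rmin (Cmod x) (Cmod (x - z0)))).
        * apply Rmin_pos; apply Cmod_gt_0; [assumption|now apply Cminus_eq_contra].
        * intros t Ht.
          assert (T1 := Rlt_le_trans _ _ _ Ht (Rmin_l _ _)).
          assert (T2 := Rlt_le_trans _ _ _ Ht (Rmin_r _ _)).
          unfold H. destruct (Ceq_dec (x + t) (RtoC 0)) as [E|_].
          { exfalso. replace t with (- x)%C in T1 by (rewrite <- (Cplus_0_l (-x)%C), <- E; ring).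
            rewrite Cmod_opp in T1. lra. }
          destruct (Ceq_dec (x + t) z0) as [E|_]; [|reflexivity].
          exfalso. replace t with (- (x - z0))%C in T2 by (rewrite <- E; ring).
          rewrite Cmod_opp in T2. lra.
        * apply (taylor2_mult (fun x => S x ^ m)%C (fun x => x * (x - z0))%C);
            [exact HTm|].
          apply (taylor2_mult (fun x => x) (fun x => x - z0)%C); [apply taylor2_id|].
          apply (taylor2_minus (fun x => x) (fun _ => z0));
            [apply taylor2_id|apply taylor2_const].
    - intros x Hx. unfold H.
      assert (P : 0 <= (1 + eps) ^ m * 2) by (apply Rmult_le_pos; [apply pow_le|]; lra).
      destruct (Ceq_dec x (RtoC 0)); [now rewrite Cmod_0|].
      destruct (Ceq_dec x z0); [now rewrite Cmod_0|].
      rewrite !Cmod_mult, Cmod_pow. apply Rmult_le_compat.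
      + apply pow_le, Cmod_ge_0.
      + apply Rmult_le_pos; apply Cmod_ge_0.
      + apply pow_incr. split; [apply Cmod_ge_0|]. apply Hr0b. lra.
      + apply Hle2. lra.
    - apply Rmax_l. }
  unfold H in HHz.
  destruct (Ceq_dec z (RtoC 0)); [contradiction|].
  destruct (Ceq_dec z z0); [contradiction|].
  rewrite !Cmod_mult, Cmod_pow in HHz.
  unfold Rdiv. rewrite Rpow_mult_distr, pow_inv.
  assert (He1 : 0 < (1 + eps) ^ m) by (apply pow_lt; lra).
  apply (Rmult_le_reg_r ((1 + eps) ^ m * (Cmod z * Cmod (z - z0)%C))).
  { now apply Rmult_lt_0_compat. }
  replace (Cmod (S z) ^ m * / (1 + eps) ^ m * ((1 + eps) ^ m * (Cmod z * Cmod (z - z0)%C)))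
    with (Cmod (S z) ^ m * (Cmod z * Cmod (z - z0)%C)) by (field; lra).
  replace (2 * / (Cmod z * Cmod (z - z0)%C) * ((1 + eps) ^ m * (Cmod z * Cmod (z - z0)%C)))
    with ((1 + eps) ^ m * 2); [assumption|].
  field. split; apply Rgt_not_eq; apply Cmod_gt_0; [|assumption].
  now apply Cminus_eq_contra.
Qed.

(** * Schwarz and Schwarz-Pick inequalities with a zero of order n *)

(** The punctured maximum principle applies to [w x / x ^ n], with both punctures at 0: the order of
    vanishing bounds the quotient near 0, and [|x| ^ (- n)] tends to 1 at the circle. *)
Lemma schwarz_order (n : nat) (w : C -> C) :
  (1 <= n)%nat ->
  (forall z, Cmod z < 1 -> exists b c, taylor2 w z b c) ->
  (forall z, Cmod z < 1 -> Cmod (w z) <= 1) ->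
  bigO n w ->
  forall z, Cmod z < 1 -> Cmod (w z) <= Cmod z ^ n.
Proof.
  intros Hn HT Hw (K & d & HK & Hd & HKd) z Hz.
  destruct (Ceq_dec z (RtoC 0)) as [->|Hz0].
  { apply Rle_trans with (K * Cmod (RtoC 0) ^ n).
    - apply HKd. now rewrite Cmod_0.
    - rewrite Cmod_0, pow_i by lia. lra. }
  assert (Hp : 0 < Cmod z) by now apply Cmod_gt_0.
  assert (HS : forall x, Cmod x < 1 -> x <> RtoC 0 ->
             Cmod (w x / x ^ n)%C = Cmod (w x) / Cmod x ^ n).
  { intros x _ Hx. rewrite Cmod_div, Cmod_pow by now apply Cpow_nz. reflexivity. }
  assert (H := max_principle_punctured (fun x => w x / x ^ n)%C (RtoC 0)
                 (Rmax K (/ (Rmin d 1) ^ n))).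
  assert (Hd1 : 0 < Rmin d 1) by (apply Rmin_pos; lra).
  assert (HH : Cmod (w z / z ^ n)%C <= 1).
  { apply H; try assumption.
    - rewrite Cmod_0. lra.
    - intros x Hx Hx0 _. assert (Hxp : 0 < Cmod x) by now apply Cmod_gt_0.
      assert (Hxn : 0 < Cmod x ^ n) by now apply pow_lt.
      split.
      + rewrite HS by assumption.
        destruct (Rlt_dec (Cmod x) (Rmin d 1)) as [Hc|Hc].
        * eapply Rle_trans; [|apply Rmax_l].
          apply (Rmult_le_reg_r (Cmod x ^ n)); [assumption|].
          unfold Rdiv. rewrite Rmult_assoc, Rinv_l, Rmult_1_r by lra.
          apply HKd. eapply Rlt_le_trans; [apply Hc|apply Rmin_l].
        * eapply Rle_trans; [|apply Rmax_r].
          apply Rle_trans with (1 * / Cmod x ^ n).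
          { apply Rmult_le_compat_r; [|now apply Hw].
            left. now apply Rinv_0_lt_compat. }
          rewrite Rmult_1_l. apply Rinv_le_contravar; [now apply pow_lt|].
          apply pow_incr. lra.
      + destruct (HT x Hx) as (b & c & Hbc).
        destruct (taylor2_pow (fun x => x) x _ _ n (taylor2_id x)) as [c' Hc'].
        destruct (taylor2_div _ _ _ _ _ _ _ Hbc Hc') as [c'' Hc''];
          [now apply Cpow_nz|].
        do 2 eexists. exact Hc''.
    - intros eps He.
      assert (Hn0 : 0 < INR n) by (apply lt_0_INR; lia).
      (* For [|x| > 1 / q] the quotient is at most [q ^ n = 1 + eps]. *)
      set (q := Rpower (1 + eps) (/ INR n)).
      assert (Hq : 1 < q).
      { unfold q. assert (A := Rpower_lt (1 + eps) 0 (/ INR n)).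
        rewrite Rpower_O in A by lra.
        apply A; [lra|]. now apply Rinv_0_lt_compat. }
      assert (Hqn : q ^ n = 1 + eps).
      { unfold q. rewrite <- Rpower_pow by (apply exp_pos).
        rewrite Rpower_mult, Rinv_l, Rpower_1; lra. }
      exists (/ q). split.
      { rewrite <- Rinv_1. apply Rinv_lt_contravar; lra. }
      intros x [Hx1 Hx2].
      assert (Hqp : 0 < / q) by (apply Rinv_0_lt_compat; lra).
      assert (Hx0 : x <> RtoC 0) by (apply Cmod_gt_0; lra).
      rewrite HS by assumption.
      apply Rle_trans with (1 * / Cmod x ^ n).
      { apply Rmult_le_compat_r; [|now apply Hw].
        left. apply Rinv_0_lt_compat. apply pow_lt. lra. }
      rewrite Rmult_1_l, <- Hqn, <- (Rinv_inv (q ^ n)).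
      apply Rinv_le_contravar.
      { apply Rinv_0_lt_compat. apply pow_lt. lra. }
      rewrite <- pow_inv. apply pow_incr. lra. }
  rewrite HS in HH by assumption.
  apply (Rmult_le_compat_r (Cmod z ^ n)) in HH; [|apply pow_le; lra].
  unfold Rdiv in HH. rewrite Rmult_assoc, Rinv_l in HH; [lra|].
  apply Rgt_not_eq, pow_lt. assumption.
Qed.

Lemma moebius_identity (a b : C) :
  Cmod (1 - Cconj b * a)%C ^ 2
  = Cmod (a - b)%C ^ 2 + (1 - Cmod a ^ 2) * (1 - Cmod b ^ 2).
Proof.
  rewrite !Cmod_sq. destruct a, b. simpl. ring.
Qed.

Lemma moebius_le (a b : C) :
  Cmod a <= 1 -> Cmod b <= 1 -> Cmod (a - b) <= Cmod (1 - Cconj b * a).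
Proof.
  intros Ha Hb. assert (H := moebius_identity a b).
  assert (Ha0 := Cmod_ge_0 a). assert (Hb0 := Cmod_ge_0 b).
  assert (0 <= (1 - Cmod a ^ 2) * (1 - Cmod b ^ 2)) by (apply Rmult_le_pos; nra).
  apply Rsqr_incr_0_var; [|apply Cmod_ge_0]. rewrite !Rsqr_pow2. lra.
Qed.

(** Two-point Schwarz-Pick for [k phi], where [phi = w / z ^ n] and [phi z0 = p], with denominators
    cleared. The factor [k < 1] keeps [1 - k ^ 2 conj(p) phi] away from 0 even when [|phi| = 1]. The
    quotient [S] of the two sides is undefined only at 0 and [z0]. *)
Lemma schwarz_pick_scaled (n : nat) (w : C -> C) (z0 p z : C) (k : R) :
  (forall z, Cmod z < 1 -> exists b c, taylor2 w z b c) ->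
  (forall z, Cmod z < 1 -> Cmod (w z) <= Cmod z ^ n) ->
  Cmod z0 < 1 -> z0 <> RtoC 0 -> w z0 = (p * z0 ^ n)%C ->
  0 < k < 1 ->
  Cmod z < 1 -> z <> RtoC 0 -> z <> z0 ->
  Cmod (k * (w z - p * z ^ n) * (1 - Cconj z0 * z))%C
  <= Cmod ((z ^ n - k * k * Cconj p * w z) * (z - z0))%C.
Proof.
  intros HT Hw Hz0 Hz00 Hp Hk Hz Hz1 Hz2.
  assert (Hpm : Cmod p <= 1).
  { assert (A := Hw z0 Hz0). rewrite Hp, Cmod_mult, Cmod_pow in A.
    assert (B : 0 < Cmod z0 ^ n) by (apply pow_lt; now apply Cmod_gt_0).
    nra. }
  assert (Hp0 := Cmod_ge_0 p).
  assert (Hkm : Cmod (RtoC k) = k) by (rewrite Cmod_R; apply Rabs_pos_eq; lra).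
  set (num := fun x : C => (k * (w x - p * x ^ n))%C).
  set (den := fun x : C => (x ^ n - k * k * Cconj p * w x)%C).
  assert (Hden : forall x, Cmod x < 1 -> x <> RtoC 0 -> 0 < Cmod (den x)).
  { intros x Hx Hx0. unfold den.
    eapply Rlt_le_trans; [|apply Cmod_minus_ge].
    rewrite !Cmod_mult, Cmod_conj, Cmod_pow, Hkm.
    assert (A := Hw x Hx). assert (A2 := Cmod_ge_0 (w x)).
    assert (B : 0 < Cmod x ^ n) by (apply pow_lt; now apply Cmod_gt_0).
    assert (k * k < 1) by nra.
    assert (Cmod p * Cmod (w x) <= Cmod x ^ n) by nra.
    assert (0 <= Cmod p * Cmod (w x)) by nra.
    nra. }
  assert (Hnd : forall x, Cmod x < 1 -> x <> RtoC 0 -> Cmod (num x) <= Cmod (den x)).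
  { intros x Hx Hx0.
    assert (B : 0 < Cmod x ^ n) by (apply pow_lt; now apply Cmod_gt_0).
    assert (Hxn : (x ^ n)%C <> RtoC 0) by now apply Cpow_nz.
    assert (M := moebius_le (k * (w x / x ^ n))%C (k * p)%C).
    rewrite !Cmod_mult, Hkm, Cmod_div, Cmod_pow in M by assumption.
    assert (A : Cmod (w x) / Cmod x ^ n <= 1).
    { apply (Rmult_le_reg_r (Cmod x ^ n)); [assumption|].
      unfold Rdiv. rewrite Rmult_assoc, Rinv_l by lra.
      rewrite Rmult_1_l, Rmult_1_r. now apply Hw. }
    specialize (M ltac:(nra) ltac:(nra)).
    apply (Rmult_le_compat_r (Cmod x ^ n)) in M; [|lra].
    rewrite <- Cmod_pow, <- !Cmod_mult in M.
    unfold num, den.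
    replace (k * (w x - p * x ^ n))%C
      with ((k * (w x / x ^ n) - k * p) * x ^ n)%C by (field; assumption).
    replace (x ^ n - k * k * Cconj p * w x)%C
      with ((1 - Cconj (k * p) * (k * (w x / x ^ n))) * x ^ n)%C; [assumption|].
    rewrite Cmult_conj.
    replace (Cconj (RtoC k)) with (RtoC k)
      by (apply injective_projections; simpl; ring).
    field. assumption. }
  assert (HTn : forall x, Cmod x < 1 -> exists b c, taylor2 num x b c).
  { intros x Hx. destruct (HT x Hx) as (b & c & Hbc).
    destruct (taylor2_pow (fun x => x) x _ _ n (taylor2_id x)) as [c' Hc'].
    do 2 eexists. unfold num.
    apply (taylor2_mult (fun _ => RtoC k) (fun x => w x - p * x ^ n)%C);
      [apply taylor2_const|].
    apply (taylor2_minus w (fun x => p * x ^ n)%C); [exact Hbc|].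
    apply (taylor2_mult (fun _ => p) (fun x => x ^ n)%C); [apply taylor2_const|].
    exact Hc'. }
  assert (HTd : forall x, Cmod x < 1 -> exists b c, taylor2 den x b c).
  { intros x Hx. destruct (HT x Hx) as (b & c & Hbc).
    destruct (taylor2_pow (fun x => x) x _ _ n (taylor2_id x)) as [c' Hc'].
    do 2 eexists. unfold den.
    apply (taylor2_minus (fun x => x ^ n)%C (fun x => k * k * Cconj p * w x)%C);
      [exact Hc'|].
    apply (taylor2_mult (fun _ => k * k * Cconj p)%C w); [apply taylor2_const|].
    exact Hbc. }
  assert (Hlin : forall (a x : C), taylor2 (fun y => 1 - a * y)%C x
                    (0 - (0 * x + a * 1))%C (0 - (0 * x + 0 * 1 + a * 0))%C).
  { intros a x. apply (taylor2_minus (fun _ => RtoC 1) (fun y => a * y)%C);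
      [apply taylor2_const|].
    apply (taylor2_mult (fun _ => a) (fun y => y)); [apply taylor2_const|apply taylor2_id]. }
  assert (Hsub : forall (x : C), taylor2 (fun y => y - z0)%C x (1 - 0)%C (0 - 0)%C).
  { intros x. apply (taylor2_minus (fun y => y) (fun _ => z0));
      [apply taylor2_id|apply taylor2_const]. }
  set (S := fun x : C => (num x * (1 - Cconj z0 * x) / (den x * (x - z0)))%C).
  assert (HdenNZ : forall x, Cmod x < 1 -> x <> RtoC 0 -> x <> z0 ->
     (den x * (x - z0))%C <> RtoC 0).
  { intros x Hx Hx0 Hxz. apply Cmult_neq_0.
    - apply Cmod_gt_0. now apply Hden.
    - now apply Cminus_eq_contra. }
  assert (Hbl : forall x, Cmod x < 1 -> Cmod (1 - Cconj z0 * x)%C <= 2).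
  { intros x Hx. eapply Rle_trans; [apply Cmod_minus_le|].
    rewrite Cmod_1, Cmod_mult, Cmod_conj.
    assert (A := Cmod_ge_0 z0). assert (A2 := Cmod_ge_0 x). nra. }
  assert (HSle : forall x, Cmod x < 1 -> x <> RtoC 0 -> x <> z0 ->
     Cmod (S x) <= Cmod (1 - Cconj z0 * x)%C / Cmod (x - z0)%C).
  { intros x Hx Hx0 Hxz. unfold S.
    rewrite Cmod_div by now apply HdenNZ. rewrite !Cmod_mult.
    assert (A := Hden x Hx Hx0). assert (A2 := Hnd x Hx Hx0).
    assert (A3 : 0 < Cmod (x - z0)) by (apply Cmod_gt_0; now apply Cminus_eq_contra).
    apply (Rmult_le_reg_r (Cmod (den x) * Cmod (x - z0)%C)).
    { now apply Rmult_lt_0_compat. }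
    replace (Cmod (1 - Cconj z0 * x)%C / Cmod (x - z0)%C * (Cmod (den x) * Cmod (x - z0)%C))
      with (Cmod (den x) * Cmod (1 - Cconj z0 * x)%C) by (field; lra).
    unfold Rdiv. rewrite Rmult_assoc, Rinv_l, Rmult_1_r by nra.
    apply Rmult_le_compat_r; [apply Cmod_ge_0|assumption]. }
  assert (Hnum0 : num z0 = RtoC 0) by (unfold num; rewrite Hp; ring).
  destruct (HTn z0 Hz0) as (bn & cn & Hn0).
  destruct (taylor2_order0 _ _ _ _ Hn0) as (K1 & d1 & HK1 & Hd1 & HKd1).
  destruct (HTd z0 Hz0) as (bd & cd & Hd0).
  destruct (taylor2_nonzero_near _ _ _ _ Hd0) as (d2 & Hd2 & HKd2).
  { apply Cmod_gt_0. now apply Hden. }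
  assert (HDen0 := Hden z0 Hz0 Hz00).
  set (dd := Rmin d1 d2). assert (Hdd : 0 < dd) by now apply Rmin_pos.
  set (D0 := Cmod (den z0)) in *.
  assert (HSz : Cmod (S z) <= 1).
  (* Away from [z0] the bound is [|1 - conj(z0) x| / |x - z0|]. Near [z0] the zero of [num] cancels
     [x - z0] while [|den| >= D0 / 2]. *)
  { apply max_principle_punctured with z0 (Rmax (2 / dd) (K1 * 2 / (D0 / 2)));
      try assumption.
    - intros x Hx Hx0 Hxz.
      assert (A3 : 0 < Cmod (x - z0)) by (apply Cmod_gt_0; now apply Cminus_eq_contra).
      split.
      + destruct (Rlt_dec (Cmod (x - z0)) dd) as [Hc|Hc].
        * eapply Rle_trans; [|apply Rmax_r].
          assert (B1 := HKd1 (x - z0)%C (Rlt_le_trans _ _ _ Hc (Rmin_l _ _))).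
          assert (B2 := HKd2 (x - z0)%C (Rlt_le_trans _ _ _ Hc (Rmin_r _ _))).
          replace (z0 + (x - z0))%C with x in B1, B2 by ring.
          rewrite Hnum0 in B1. replace (num x - 0)%C with (num x) in B1 by ring.
          unfold S. rewrite Cmod_div by now apply HdenNZ. rewrite !Cmod_mult.
          specialize (Hbl x Hx).
          assert (Hb0 := Cmod_ge_0 (1 - Cconj z0 * x)).
          assert (Hq : Cmod (num x) * Cmod (1 - Cconj z0 * x)%C
                       <= K1 * Cmod (x - z0)%C * 2).
          { simpl in B1. apply Rmult_le_compat; try lra; apply Cmod_ge_0. }
          apply (Rmult_le_reg_r (Cmod (den x) * Cmod (x - z0)%C)).
          { apply Rmult_lt_0_compat; lra. }
          unfold Rdiv at 1. rewrite Rmult_assoc, Rinv_l, Rmult_1_r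
            by (apply Rgt_not_eq; apply Rmult_lt_0_compat; lra).
          eapply Rle_trans; [apply Hq|].
          replace (K1 * Cmod (x - z0)%C * 2)
            with (K1 * 2 / (D0 / 2) * (D0 / 2 * Cmod (x - z0)%C)) by (field; lra).
          apply Rmult_le_compat_l.
          { apply Rmult_le_pos; [lra|]. left. apply Rinv_0_lt_compat. lra. }
          apply Rmult_le_compat_r; [lra|]. exact B2.
        * eapply Rle_trans; [|apply Rmax_l].
          eapply Rle_trans; [now apply HSle|].
          apply Rmult_le_compat; [apply Cmod_ge_0| |now apply Hbl|].
          { left. now apply Rinv_0_lt_compat. }
          apply Rinv_le_contravar; lra.
      + destruct (HTn x Hx) as (b1 & c1 & H1).
        destruct (HTd x Hx) as (b2 & c2 & H2).
        destruct (taylor2_div (fun x => num x * (1 - Cconj z0 * x))%C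
          (fun x => den x * (x - z0))%C x _ _ _ _
          (taylor2_mult _ _ _ _ _ _ _ H1 (Hlin (Cconj z0) x))
          (taylor2_mult _ _ _ _ _ _ _ H2 (Hsub x))) as [c3 H3].
        { now apply HdenNZ. }
        do 2 eexists. exact H3.
    - intros eps He.
      set (r := Cmod z0) in *. assert (Hr0 : 0 <= r) by apply Cmod_ge_0.
      assert (Hsq : 0 < (1 - r) ^ 2) by (apply pow_lt; lra).
      (* Beyond the first threshold [|x - z0| >= (1 - r) / 2]; beyond the second
         [1 - |x| ^ 2 <= eps (1 - r) ^ 2 / 2]. With [moebius_identity] this gives
         [|1 - conj(z0) x| <= (1 + eps) |x - z0|]. *)
      exists (Rmax ((1 + r) / 2) (1 - eps * (1 - r) ^ 2 / 4)). split.
      { apply Rmax_lub_lt; nra. }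
      intros x [Hx1 Hx2].
      assert (B1 := Rle_lt_trans _ _ _ (Rmax_l _ _) Hx1).
      assert (B2 := Rle_lt_trans _ _ _ (Rmax_r _ _) Hx1).
      assert (B3 := Cmod_minus_ge x z0). fold r in B3.
      assert (Hx0 : x <> RtoC 0) by (apply Cmod_gt_0; lra).
      assert (Hxz : x <> z0).
      { intros ->. fold r in B1. lra. }
      eapply Rle_trans; [now apply HSle|].
      apply (Rmult_le_reg_r (Cmod (x - z0)%C)); [lra|].
      unfold Rdiv. rewrite Rmult_assoc, Rinv_l, Rmult_1_r by lra.
      apply Rsqr_incr_0_var; [|apply Rmult_le_pos; lra].
      rewrite !Rsqr_pow2, moebius_identity. fold r.
      set (y := Cmod x) in *. set (q := Cmod (x - z0)%C) in *.
      assert (E1 : (1 - y ^ 2) * (1 - r ^ 2) <= 2 * eps * q ^ 2).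
      { assert (F1 : 0 <= 1 - y ^ 2 <= eps * (1 - r) ^ 2 / 2) by nra.
        assert (F2 : (1 - y ^ 2) * (1 - r ^ 2) <= eps * (1 - r) ^ 2 / 2) by nra.
        assert (F3 : ((1 - r) / 2) ^ 2 <= q ^ 2) by (apply pow_incr; lra).
        assert (F4 : eps * ((1 - r) / 2) ^ 2 <= eps * q ^ 2)
          by (apply Rmult_le_compat_l; lra).
        nra. }
      rewrite Rpow_mult_distr.
      assert (0 <= eps ^ 2 * q ^ 2) by (apply Rmult_le_pos; apply pow2_ge_0).
      nra. }
  unfold S in HSz.
  rewrite Cmod_div in HSz by now apply HdenNZ.
  assert (Hpos : 0 < Cmod (den z * (z - z0))) by (apply Cmod_gt_0; now apply HdenNZ).
  apply (Rmult_le_compat_r (Cmod (den z * (z - z0)))) in HSz; [|lra].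
  unfold Rdiv in HSz. rewrite Rmult_assoc, Rinv_l in HSz by lra.
  rewrite Rmult_1_l, Rmult_1_r in HSz. exact HSz.
Qed.

(** The limit [k -> 1] of the scaled inequality, taken with [k = 1 - d]; replacing [k ^ 2] by 1
    costs at most [2 d] since [|p w z| <= 1]. *)
Lemma schwarz_pick_two_points (n : nat) (w : C -> C) (z0 p z : C) :
  (forall z, Cmod z < 1 -> exists b c, taylor2 w z b c) ->
  (forall z, Cmod z < 1 -> Cmod (w z) <= Cmod z ^ n) ->
  Cmod z0 < 1 -> z0 <> RtoC 0 -> w z0 = (p * z0 ^ n)%C ->
  Cmod z < 1 -> z <> RtoC 0 -> z <> z0 ->
  Cmod (w z - p * z ^ n)%C * Cmod (1 - Cconj z0 * z)%C
  <= Cmod (z ^ n - Cconj p * w z)%C * Cmod (z - z0)%C.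
Proof.
  intros HT Hw Hz0 Hz00 Hp Hz Hz1 Hz2.
  set (X := Cmod (w z - p * z ^ n)%C * Cmod (1 - Cconj z0 * z)%C).
  set (Z := Cmod (z ^ n - Cconj p * w z)%C). set (Y := Cmod (z - z0)%C).
  assert (HX : 0 <= X) by (apply Rmult_le_pos; apply Cmod_ge_0).
  assert (HZ : 0 <= Z) by apply Cmod_ge_0.
  assert (HY : 0 <= Y) by apply Cmod_ge_0.
  assert (Hq : Cmod (Cconj p * w z)%C <= 1).
  { rewrite Cmod_mult, Cmod_conj.
    assert (A := Hw z0 Hz0). rewrite Hp, Cmod_mult, Cmod_pow in A.
    assert (B : 0 < Cmod z0 ^ n) by (apply pow_lt; now apply Cmod_gt_0).
    assert (Cmod p <= 1) by nra.
    assert (A2 := Hw z Hz).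
    assert (Cmod z ^ n <= 1).
    { rewrite <- (pow1 n). apply pow_incr. split; [apply Cmod_ge_0|lra]. }
    assert (A3 := Cmod_ge_0 p). assert (A4 := Cmod_ge_0 (w z)). nra. }
  assert (Hd : forall d, 0 < d < 1 -> (1 - d) * X <= (Z + 2 * d) * Y).
  { intros d Hd.
    assert (A := schwarz_pick_scaled n w z0 p z (1 - d) HT Hw Hz0 Hz00 Hp
                   ltac:(lra) Hz Hz1 Hz2).
    rewrite !(Cmod_mult _ (z - z0)), !Cmod_mult, Cmod_R, Rabs_pos_eq in A by lra.
    fold Y in A. rewrite Rmult_assoc in A. fold X in A.
    eapply Rle_trans; [apply A|]. apply Rmult_le_compat_r; [assumption|].
    replace (z ^ n - RtoC (1 - d) * RtoC (1 - d) * Cconj p * w z)%C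
      with ((z ^ n - Cconj p * w z) + RtoC (2 * d - d * d) * (Cconj p * w z))%C
      by (rewrite !RtoC_minus, !RtoC_mult; ring).
    eapply Rle_trans; [apply Cmod_triangle|]. fold Z. apply Rplus_le_compat_l.
    rewrite Cmod_mult, Cmod_R, Rabs_pos_eq by nra.
    assert (A3 := Cmod_ge_0 (Cconj p * w z)). nra. }
  fold Z Y. apply Rnot_lt_le. intros Hc.
  set (g := X - Z * Y). assert (Hg : 0 < g) by (unfold g; lra).
  set (d := Rmin (/ 2) (g / (2 * (X + 2 * Y + 1)))).
  assert (Hd0 : 0 < d).
  { apply Rmin_pos; [lra|]. apply Rdiv_lt_0_compat; lra. }
  assert (Hd1 : d <= / 2) by apply Rmin_l.
  assert (Hd2 : d * (X + 2 * Y + 1) <= g / 2).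
  { replace (g / 2) with (g / (2 * (X + 2 * Y + 1)) * (X + 2 * Y + 1)) by (field; lra).
    apply Rmult_le_compat_r; [lra|apply Rmin_r]. }
  specialize (Hd d ltac:(lra)). unfold g in *. nra.
Qed.

(** This is [|phi' z0| (1 - |z0| ^ 2) <= 1 - |phi z0| ^ 2] for [phi = w / z ^ n], multiplied by
    [|z0| ^ (n + 1)]. It follows by dividing the two-point inequality at [z0 + s] by [s] and letting
    the real number [s > 0] tend to 0. *)
Lemma schwarz_pick_derivative (n : nat) (w : C -> C) (z0 p b c : C) :
  (1 <= n)%nat ->
  (forall z, Cmod z < 1 -> exists b c, taylor2 w z b c) ->
  (forall z, Cmod z < 1 -> Cmod (w z) <= Cmod z ^ n) ->
  Cmod z0 < 1 -> z0 <> RtoC 0 -> w z0 = (p * z0 ^ n)%C ->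
  taylor2 w z0 b c ->
  Cmod (z0 * b - INR n * w z0)%C * (1 - Cmod z0 ^ 2)
  <= Cmod z0 ^ (n + 1) * (1 - Cmod p ^ 2).
Proof.
  intros Hn HT Hw Hz0 Hz00 Hp Hb.
  set (r := Cmod z0) in *.
  assert (Hr : 0 < r) by now apply Cmod_gt_0.
  assert (Hpm : Cmod p <= 1).
  { assert (A := Hw z0 Hz0). rewrite Hp, Cmod_mult, Cmod_pow in A.
    assert (B : 0 < r ^ n) by now apply pow_lt.
    fold r in A. nra. }
  assert (Hp0 := Cmod_ge_0 p).
  destruct (taylor2_pow (fun x => x) z0 _ _ n (taylor2_id z0)) as [c' Hc'].
  assert (H1 := taylor2_minus _ _ _ _ _ _ _ Hb
    (taylor2_mult _ _ _ _ _ _ _ (taylor2_const p z0) Hc')).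
  assert (H2 := taylor2_minus _ _ _ _ _ _ _ Hc'
    (taylor2_mult _ _ _ _ _ _ _ (taylor2_const (Cconj p) z0) Hb)).
  apply taylor2_order1 in H1. apply taylor2_order0 in H2.
  match type of H1 with bigO 2 (fun t => _ - (_ + ?BB * t))%C => set (B := BB) in H1 end.
  destruct H1 as (K1 & d1 & HK1 & Hd1 & HKd1).
  destruct H2 as (K2 & d2 & HK2 & Hd2 & HKd2).
  set (N0 := r ^ n * (1 - Cmod p ^ 2)).
  assert (HN0 : Cmod (z0 ^ n - Cconj p * w z0)%C = N0).
  { replace (z0 ^ n - Cconj p * w z0)%C with (RtoC (1 - Cmod p ^ 2) * z0 ^ n)%C.
    - rewrite Cmod_mult, Cmod_R, Cmod_pow, Rabs_pos_eq by nra. unfold N0, r. ring.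
    - rewrite Hp, RtoC_minus, Cmod2_conj. ring. }
  assert (HB : Cmod (z0 * b - INR n * w z0)%C = r * Cmod B).
  { unfold r. rewrite <- Cmod_mult. f_equal. unfold B. rewrite Hp.
    destruct n as [|m]; [lia|]. simpl pred. rewrite Cpow_S. ring. }
  rewrite HB.
  replace (r ^ (n + 1) * (1 - Cmod p ^ 2)) with (r * N0)
    by (unfold N0; rewrite pow_add; simpl; ring).
  rewrite Rmult_assoc. apply Rmult_le_compat_l; [lra|].
  assert (HB0 := Cmod_ge_0 B).
  assert (Hs : forall s, 0 < s -> s < d1 -> s < d2 -> s < 1 - r -> s < r ->
     s < 1 - r ^ 2 ->
     (Cmod B - K1 * s) * ((1 - r ^ 2) - s) <= N0 + K2 * s).
  { intros s H0 H1 H2 H3 H4 H5.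
    assert (Hms : Cmod (RtoC s) = s) by (rewrite Cmod_R; apply Rabs_pos_eq; lra).
    assert (Htr := Cmod_triangle z0 (RtoC s)).
    assert (Hz : Cmod (z0 + s)%C < 1) by (fold r in Htr; lra).
    assert (Hz1 : (z0 + s)%C <> RtoC 0).
    { intros E. assert (F := Cmod_minus_ge z0 (z0 + s)%C).
      rewrite E, Cmod_0 in F. replace (z0 - 0)%C with (- RtoC s + (z0 + s))%C in F by ring.
      rewrite E, Cplus_0_r, Cmod_opp in F. fold r in F. lra. }
    assert (Hz2 : (z0 + s)%C <> z0).
    { intros E. assert (F : RtoC s = RtoC 0).
      { replace (RtoC s) with ((z0 + s) - z0)%C by ring. rewrite E. ring. }
      apply RtoC_inj in F. lra. }
    assert (A := schwarz_pick_two_points n w z0 p (z0 + s)%C HT Hw Hz0 Hz00 Hp Hz Hz1 Hz2).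
    replace (z0 + s - z0)%C with (RtoC s) in A by ring. rewrite Hms in A.
    assert (A1 := HKd1 (RtoC s) ltac:(lra)). assert (A2 := HKd2 (RtoC s) ltac:(lra)).
    rewrite Hms in A1, A2.
    assert (B1 : Cmod B * s - K1 * s ^ 2 <= Cmod (w (z0 + s)%C - p * (z0 + s) ^ n)%C).
    { assert (F := Cmod_minus_ge (B * s)%C (w (z0 + s)%C - p * (z0 + s) ^ n)%C).
      rewrite (Cmod_minus_sym (B * s)), Cmod_mult, Hms in F.
      replace (w z0 - p * z0 ^ n + B * s)%C with (B * s)%C in A1 by (rewrite Hp; ring).
      lra. }
    assert (B2 : (1 - r ^ 2) - s <= Cmod (1 - Cconj z0 * (z0 + s))%C).
    { replace (1 - Cconj z0 * (z0 + s))%C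
        with (RtoC (1 - r ^ 2) - Cconj z0 * s)%C
        by (unfold r; rewrite RtoC_minus, Cmod2_conj; ring).
      eapply Rle_trans; [|apply Cmod_minus_ge].
      rewrite Cmod_mult, Cmod_conj, Cmod_R, Hms. fold r.
      rewrite Rabs_pos_eq by nra. nra. }
    assert (B3 : Cmod ((z0 + s) ^ n - Cconj p * w (z0 + s))%C <= N0 + K2 * s).
    { assert (F := Cmod_minus_ge ((z0 + s) ^ n - Cconj p * w (z0 + s))%C
        (z0 ^ n - Cconj p * w z0)%C).
      rewrite HN0 in F. simpl in A2. rewrite Rmult_1_r in A2. lra. }
    destruct (Rle_dec (Cmod B - K1 * s) 0) as [Hneg|Hpos].
    - assert (F := Cmod_ge_0 ((z0 + s) ^ n - Cconj p * w (z0 + s)%C)). nra.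
    - apply Rnot_le_lt in Hpos.
      assert (F : (Cmod B * s - K1 * s ^ 2) * (1 - r ^ 2 - s)
        <= Cmod (w (z0 + s)%C - p * (z0 + s) ^ n)%C * Cmod (1 - Cconj z0 * (z0 + s))%C).
      { apply Rmult_le_compat; try lra. nra. }
      assert (G : Cmod ((z0 + s) ^ n - Cconj p * w (z0 + s))%C * s <= (N0 + K2 * s) * s)
        by (apply Rmult_le_compat_r; lra).
      apply (Rmult_le_reg_r s); [assumption|]. nra. }
  apply Rnot_lt_le. intros Hc.
  set (g := Cmod B * (1 - r ^ 2) - N0). assert (Hg : 0 < g) by (unfold g; lra).
  assert (Hr2 : 0 < 1 - r ^ 2) by nra.
  (* Expanding [Hs] yields [g <= s (K2 + K1 + |B|)], so any [s] with [s T < g] gives the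
     contradiction. *)
  set (T := K2 + K1 + Cmod B + 1).
  assert (HT0 : 0 < T) by (unfold T; lra).
  set (s := Rmin (Rmin (Rmin d1 d2) (Rmin (1 - r) r)) (Rmin (1 - r ^ 2) (g / T)) / 2).
  assert (Hs0 : 0 < Rmin (Rmin (Rmin d1 d2) (Rmin (1 - r) r)) (Rmin (1 - r ^ 2) (g / T))).
  { repeat apply Rmin_pos; try lra. now apply Rdiv_lt_0_compat. }
  assert (L1 := Rmin_l (Rmin (Rmin d1 d2) (Rmin (1 - r) r)) (Rmin (1 - r ^ 2) (g / T))).
  assert (L2 := Rmin_r (Rmin (Rmin d1 d2) (Rmin (1 - r) r)) (Rmin (1 - r ^ 2) (g / T))).
  assert (L3 := Rmin_l (Rmin d1 d2) (Rmin (1 - r) r)).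
  assert (L4 := Rmin_r (Rmin d1 d2) (Rmin (1 - r) r)).
  assert (L5 := Rmin_l d1 d2). assert (L6 := Rmin_r d1 d2).
  assert (L7 := Rmin_l (1 - r) r). assert (L8 := Rmin_r (1 - r) r).
  assert (L9 := Rmin_l (1 - r ^ 2) (g / T)). assert (L10 := Rmin_r (1 - r ^ 2) (g / T)).
  fold s in Hs0.
  assert (Hsg : s * T < g).
  { apply Rlt_le_trans with (g / T * T); [|right; field; lra].
    apply Rmult_lt_compat_r; [assumption|]. unfold s. lra. }
  specialize (Hs s ltac:(unfold s; lra) ltac:(unfold s; lra) ltac:(unfold s; lra)
    ltac:(unfold s; lra) ltac:(unfold s; lra) ltac:(unfold s; lra)).
  assert (0 < s) by (unfold s; lra).
  assert (0 <= K1 * s * s) by nra.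
  assert (K1 * s * (1 - r ^ 2) <= K1 * s) by nra.
  unfold g, T in *. nra.
Qed.

(** Bernoulli's inequality for [1 / y], weakened by [1 / y - 1 >= 1 - y]; it makes the increment in
    the induction of [coth_multiple_bound] nonnegative. *)
Lemma pow_defect_bound (n : nat) (y : R) :
  0 <= y <= 1 -> y ^ n * (1 + INR n * (1 - y)) <= 1.
Proof.
  intros Hy. induction n as [|n IH]; [simpl; lra|].
  rewrite S_INR. simpl pow.
  assert (P : 0 <= y ^ n) by (apply pow_le; lra).
  assert (Q := pos_INR n).
  assert (E : y * (1 + (INR n + 1) * (1 - y)) <= 1 + INR n * (1 - y)).
  { assert (0 <= (INR n + 1) * (1 - y) ^ 2) by (apply Rmult_le_pos; [lra|apply pow2_ge_0]).
    nra. }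
  replace (y * y ^ n * (1 + (INR n + 1) * (1 - y)))
    with (y ^ n * (y * (1 + (INR n + 1) * (1 - y)))) by ring.
  nra.
Qed.

(* [n * coth (n * t) >= coth t], with [y = exp (- 2 * t)]. *)
Lemma coth_multiple_bound (n : nat) (y : R) :
  (1 <= n)%nat -> 0 <= y <= 1 ->
  (1 + y) * (1 - y ^ n) <= INR n * (1 - y) * (1 + y ^ n).
Proof.
  intros Hn Hy.
  (* This is the right-hand side minus the left-hand side, expanded. *)
  enough (H : 0 <= (INR n - 1) * (1 - y ^ (n + 1)) - (INR n + 1) * (y - y ^ n)).
  { rewrite pow_add in H. simpl in H. nra. }
  induction n as [|n IH]; [lia|].
  destruct n as [|n]; [simpl; lra|].
  specialize (IH ltac:(lia)).
  remember (S n) as m. rewrite S_INR.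
  assert (B := pow_defect_bound m y Hy).
  (* Exactly the amount by which the expression grows from [m] to [m + 1]. *)
  assert (D : 0 <= (1 - y) * (1 - y ^ m * (1 + INR m * (1 - y))))
    by (apply Rmult_le_pos; lra).
  rewrite pow_add in *. simpl in *. nra.
Qed.

(** The factor [1 - |w| ^ 2] is essential: it later cancels against the denominator of [z p' / p].
    Equality holds for [w = z ^ n]. *)
Lemma schwarz_pick_order (n : nat) (w : C -> C) (z0 b c : C) :
  (1 <= n)%nat ->
  (forall z, Cmod z < 1 -> exists b c, taylor2 w z b c) ->
  (forall z, Cmod z < 1 -> Cmod (w z) <= Cmod z ^ n) ->
  Cmod z0 < 1 -> z0 <> RtoC 0 ->
  taylor2 w z0 b c ->
  Cmod (z0 * b)%C * (1 - (Cmod z0 ^ n) ^ 2) <= INR n * Cmod z0 ^ n * (1 - Cmod (w z0) ^ 2).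
Proof.
  intros Hn HT Hw Hz0 Hz00 Hb.
  set (p := (w z0 / z0 ^ n)%C).
  assert (Hzn : (z0 ^ n)%C <> RtoC 0) by now apply Cpow_nz.
  assert (Hp : w z0 = (p * z0 ^ n)%C) by (unfold p; field; assumption).
  assert (A := schwarz_pick_derivative n w z0 p b c Hn HT Hw Hz0 Hz00 Hp Hb).
  set (r := Cmod z0) in *.
  assert (Hr : 0 < r) by now apply Cmod_gt_0.
  assert (Hrn : 0 < r ^ n) by now apply pow_lt.
  assert (Hwp : Cmod (w z0) = Cmod p * r ^ n)
    by (rewrite Hp, Cmod_mult, Cmod_pow; reflexivity).
  assert (Hpm : Cmod p <= 1).
  { assert (D := Hw z0 Hz0). fold r in D. nra. }
  assert (Hp0 := Cmod_ge_0 p).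
  assert (B : Cmod (z0 * b)%C <= Cmod (z0 * b - INR n * w z0)%C + INR n * Cmod (w z0)).
  { assert (F := Cmod_triangle (z0 * b - INR n * w z0) (INR n * w z0)).
    rewrite Cmod_mult, Cmod_R, Rabs_pos_eq in F by apply pos_INR.
    replace (z0 * b - INR n * w z0 + INR n * w z0)%C with (z0 * b)%C in F by ring.
    exact F. }
  rewrite Hwp in *. set (x := Cmod p) in *.
  set (X := Cmod (z0 * b)%C) in *.
  set (D := Cmod (z0 * b - INR n * w z0)%C) in *.
  set (N := INR n) in *.
  assert (HN := coth_multiple_bound n (r ^ 2) Hn ltac:(nra)). fold N in HN.
  rewrite <- pow_mult in HN. rewrite Nat.mul_comm, pow_mult in HN.
  set (s := r ^ n) in *. rewrite pow_add in A. fold s in A. simpl (r ^ 1) in A.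
  assert (Hs1 : s <= 1) by (unfold s; rewrite <- (pow1 n); apply pow_incr; lra).
  assert (HN0 : 0 <= N) by apply pos_INR.
  (* [H2] below is affine in [x], so its endpoints suffice: [x = 1] is [H1], which comes from the
     coth bound at [y = r ^ 2] and [2 r <= 1 + r ^ 2]; [x = 0] is [H3]. *)
  assert (H1 : 2 * r * (1 - s ^ 2) <= N * (1 - r ^ 2) * (1 + s ^ 2)).
  { assert (0 <= (1 - r) ^ 2 * (1 - s ^ 2)) by (apply Rmult_le_pos; [apply pow2_ge_0|nra]).
    nra. }
  assert (H2 : (1 - s ^ 2) * r * (1 + x) <= N * (1 - r ^ 2) * (1 + s ^ 2 * x)).
  { assert (H3 : r * (1 - s ^ 2) <= N * (1 - r ^ 2)).
    { assert (0 <= N * (1 - r ^ 2)) by (apply Rmult_le_pos; nra).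
      assert (s ^ 2 <= 1) by nra. nra. }
    nra. }
  assert (Hr2 : 0 < 1 - r ^ 2) by nra.
  apply (Rmult_le_reg_r (1 - r ^ 2)); [assumption|].
  assert (H4 : X * (1 - r ^ 2) <= D * (1 - r ^ 2) + N * (x * s) * (1 - r ^ 2)) by nra.
  assert (Hs2 : 0 <= 1 - s ^ 2) by nra.
  assert (H5 : X * (1 - r ^ 2) * (1 - s ^ 2)
    <= (s * r * (1 - x ^ 2) + N * (x * s) * (1 - r ^ 2)) * (1 - s ^ 2))
    by (apply Rmult_le_compat_r; lra).
  (* The difference between the goal and [H5] factors in this way, the factor [1 - x] reflecting
     equality at [|p| = 1]. *)
  assert (H6 : 0 <= s * (1 - x) * (N * (1 - r ^ 2) * (1 + s ^ 2 * x)
      - (1 - s ^ 2) * r * (1 + x))).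
  { apply Rmult_le_pos; [apply Rmult_le_pos|]; lra. }
  nra.
Qed.

(** * Complex power series *)

Definition Cseries (u : nat -> C) (l : C) : Prop := @is_series C_AbsRing C_NormedModule u l.

Lemma pow_n_Cpow (z : C) (k : nat) : @pow_n C_Ring z k = (z ^ k)%C.
Proof. induction k as [|k IH]; [reflexivity|]. simpl. rewrite IH. reflexivity. Qed.

Lemma Cseries_ext (u v : nat -> C) (l : C) :
  (forall k, u k = v k) -> Cseries u l -> Cseries v l.
Proof. apply is_series_ext. Qed.

Lemma is_pseries_Cseries (a : nat -> C) (z l : C) :
  @is_pseries C_AbsRing C_NormedModule a z l <-> Cseries (fun k => a k * z ^ k)%C l.
Proof.
  assert (E : forall k, @scal C_AbsRing C_NormedModule (@pow_n C_AbsRing z k) (a k)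
                = (a k * z ^ k)%C).
  { intros k. change (@pow_n C_Ring z k * a k = a k * z ^ k)%C.
    rewrite pow_n_Cpow. ring. }
  split; apply is_series_ext; intros k; [apply E|symmetry; apply E].
Qed.

Lemma Cseries_unique (u : nat -> C) (l l' : C) : Cseries u l -> Cseries u l' -> l = l'.
Proof.
  intros H H'. apply (filterlim_locally_unique (F := eventually) (sum_n u)); assumption.
Qed.

Lemma Cseries_plus (u v : nat -> C) (l l' : C) :
  Cseries u l -> Cseries v l' -> Cseries (fun k => u k + v k)%C (l + l')%C.
Proof. exact (@is_series_plus C_AbsRing C_NormedModule u v l l'). Qed.

Lemma Cseries_scal (c : C) (u : nat -> C) (l : C) :
  Cseries u l -> Cseries (fun k => c * u k)%C (c * l)%C.
Proof. exact (@is_series_scal C_AbsRing C_NormedModule c u l). Qed.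

Lemma Cseries_minus (u v : nat -> C) (l l' : C) :
  Cseries u l -> Cseries v l' -> Cseries (fun k => u k - v k)%C (l - l')%C.
Proof. exact (@is_series_minus C_AbsRing C_NormedModule u v l l'). Qed.

Lemma Cseries_shift (u : nat -> C) (l : C) :
  Cseries u l -> Cseries (fun k => u (S k)) (l - u O)%C.
Proof.
  intros H. apply (@is_series_incr_1 C_AbsRing C_NormedModule).
  change (Cseries u ((l - u O) + u O)%C).
  replace ((l - u O) + u O)%C with l by ring. assumption.
Qed.

Lemma Cseries_unshift (u : nat -> C) (l : C) :
  Cseries (fun k => u (S k)) l -> Cseries u (l + u O)%C.
Proof.
  intros H. apply (@is_series_decr_1 C_AbsRing C_NormedModule).
  change (Cseries (fun k => u (S k)) ((l + u O) - u O)%C).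
  replace ((l + u O) - u O)%C with l by ring. assumption.
Qed.

Lemma Cseries_exists (u : nat -> C) (B : nat -> R) :
  (forall k, Cmod (u k) <= B k) -> ex_series B -> exists l, Cseries u l.
Proof.
  intros H HB. exact (@ex_series_le C_AbsRing C_CompleteNormedModule u B H HB).
Qed.

Lemma Cseries_bound (u : nat -> C) (l : C) (B : nat -> R) (S : R) :
  Cseries u l -> (forall k, Cmod (u k) <= B k) -> is_series B S -> Cmod l <= S.
Proof.
  intros Hu HB HS.
  assert (H1 : is_lim_seq (fun n => Cmod (sum_n (u : nat -> C_NormedModule) n)) (Cmod l)).
  { apply (filterlim_comp _ _ _ (sum_n (u : nat -> C_NormedModule))
             (@norm C_AbsRing C_NormedModule) _ (locally (l : C_NormedModule))).
    - exact Hu.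
    - apply (@filterlim_norm C_AbsRing C_NormedModule). }
  change (Rbar_le (Cmod l) S).
  apply (is_lim_seq_le (fun n => Cmod (sum_n (u : nat -> C_NormedModule) n)) (sum_n B)).
  - intros n.
    eapply Rle_trans; [apply (@norm_sum_n_m C_AbsRing C_NormedModule)|].
    apply sum_n_m_le. exact HB.
  - assumption.
  - exact HS.
Qed.

Lemma Cseries_terms_bounded (u : nat -> C) (l : C) :
  Cseries u l -> exists M, 0 <= M /\ forall k, Cmod (u k) <= M.
Proof.
  intros H.
  destruct (@filterlim_bounded C_AbsRing C_NormedModule (sum_n u)) as [M HM].
  { exists l. exact H. }
  assert (HM' : forall k, Cmod (sum_n (u : nat -> C_NormedModule) k) <= M) by exact HM.
  assert (H0 : 0 <= M) by (eapply Rle_trans; [apply Cmod_ge_0|apply (HM' O)]).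
  exists (2 * M). split; [lra|]. intros [|k].
  - specialize (HM' O). rewrite sum_O in HM'. lra.
  - assert (A := HM' (S k)). assert (B := HM' k). rewrite sum_Sn in A.
    change (Cmod (sum_n (u : nat -> C_NormedModule) k + u (S k))%C <= M) in A.
    assert (D := Cmod_minus_le (sum_n (u : nat -> C_NormedModule) k + u (S k))%C
      (sum_n (u : nat -> C_NormedModule) k)).
    replace (sum_n (u : nat -> C_NormedModule) k + u (S k)
      - sum_n (u : nat -> C_NormedModule) k)%C with (u (S k)) in D by ring.
    lra.
Qed.

Lemma has_expansion_Cseries (f : C -> C) (a : nat -> C) (z : C) :
  has_expansion f a -> Cmod z < 1 -> Cseries (fun k => a k * z ^ k)%C (f z).
Proof. intros H Hz. apply is_pseries_Cseries. now apply H. Qed.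

Lemma Cseries_has_expansion (f : C -> C) (a : nat -> C) :
  (forall z, Cmod z < 1 -> Cseries (fun k => a k * z ^ k)%C (f z)) -> has_expansion f a.
Proof. intros H z Hz. apply is_pseries_Cseries. now apply H. Qed.

Lemma expansion_at_0 (f : C -> C) (a : nat -> C) :
  has_expansion f a -> f (RtoC 0) = a O.
Proof.
  intros H. assert (H0 : Cmod (RtoC 0) < 1) by (rewrite Cmod_0; lra).
  apply (filterlim_locally_unique (F := eventually)
    (sum_n (fun k => scal (@pow_n C_Ring (RtoC 0) k) (a k)))).
  - exact (H _ H0).
  - exact (@is_pseries_0 C_AbsRing C_NormedModule a).
Qed.

Lemma coefficients_bound (f : C -> C) (a : nat -> C) (x : R) :
  has_expansion f a -> 0 < x < 1 ->
  exists M, 0 <= M /\ forall k, Cmod (a k) * x ^ k <= M.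
Proof.
  intros H Hx.
  assert (Hm : Cmod (RtoC x) = x) by (rewrite Cmod_R; apply Rabs_pos_eq; lra).
  destruct (Cseries_terms_bounded _ _ (has_expansion_Cseries _ _ (RtoC x) H ltac:(lra)))
    as (M & HM & HMk).
  exists M. split; [assumption|]. intros k. specialize (HMk k).
  rewrite Cmod_mult, Cmod_pow, Hm in HMk. assumption.
Qed.

Lemma is_series_geom_scal (M q : R) : 0 <= q < 1 -> is_series (fun k => M * q ^ k) (M * / (1 - q)).
Proof.
  intros Hq. apply (@is_series_scal R_AbsRing R_NormedModule M).
  apply is_series_geom. rewrite Rabs_pos_eq; lra.
Qed.

(** The weight [k ^ 3 + 1] dominates the factors [k], [k ^ 2] and [k ^ 3] that arise when [z ^ k] is
    expanded to second order with remainder. *)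
Lemma coefficients_cubic_bound (f : C -> C) (a : nat -> C) (x : R) :
  has_expansion f a -> 0 < x < 1 ->
  exists M q, 0 <= M /\ 0 <= q < 1 /\ forall k, Cmod (a k) * (INR k ^ 3 + 1) * x ^ k <= M * q ^ k.
Proof.
  intros H Hx.
  (* Of the five factors [q ^ k] of [x ^ k], one bounds the coefficient, three absorb [k ^ 3]
     through [k q ^ k <= 1 / h], and one is left for geometric decay. *)
  set (q := Rpower x (/ 5)).
  assert (Hq0 : 0 < q) by apply exp_pos.
  assert (Hq5 : q ^ 5 = x).
  { unfold q. rewrite <- Rpower_pow by (apply exp_pos).
    rewrite Rpower_mult. replace (/ 5 * INR 5) with 1 by (simpl; field).
    apply Rpower_1; lra. }
  assert (Hq1 : q < 1).
  { apply Rnot_le_lt. intros Hc. assert (A := pow_R1_Rle q 5 Hc). lra. }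
  destruct (coefficients_bound f a q H ltac:(lra)) as (M & HM & HMk).
  set (h := / q - 1).
  assert (Hh : 0 < h).
  { unfold h. assert (1 < / q); [|lra]. rewrite <- Rinv_1. apply Rinv_lt_contravar; lra. }
  assert (Hkq : forall k, 0 <= INR k * q ^ k <= / h).
  { intros k. split; [apply Rmult_le_pos; [apply pos_INR|apply pow_le; lra]|].
    assert (A := poly k h Hh). replace (1 + h) with (/ q) in A by (unfold h; ring).
    rewrite pow_inv in A. assert (P : 0 < q ^ k) by now apply pow_lt.
    apply (Rmult_le_reg_l h); [assumption|]. rewrite Rinv_r by lra.
    apply (Rmult_le_compat_r (q ^ k)) in A; [|lra]. rewrite Rinv_l in A by lra. nra. }
  exists (M * ((/ h) ^ 3 + 1)), q.
  assert (Hi : 0 < / h) by now apply Rinv_0_lt_compat.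
  assert (Hi3 : 0 < (/ h) ^ 3) by now apply pow_lt.
  split; [apply Rmult_le_pos; lra|]. split; [lra|]. intros k.
  rewrite <- Hq5, <- pow_mult, Nat.mul_comm, pow_mult.
  specialize (HMk k). specialize (Hkq k).
  assert (P : 0 < q ^ k) by now apply pow_lt.
  assert (P1 : q ^ k <= 1) by (rewrite <- (pow1 k); apply pow_incr; lra).
  set (y := q ^ k) in *. set (m := INR k) in *.
  assert (A : (m * y) ^ 3 <= (/ h) ^ 3) by (apply pow_incr; lra).
  assert (B : (m ^ 3 + 1) * y ^ 3 <= (/ h) ^ 3 + 1).
  { rewrite Rpow_mult_distr in A. assert (y ^ 3 <= 1) by (rewrite <- (pow1 3); apply pow_incr; lra).
    lra. }
  replace (Cmod (a k) * (m ^ 3 + 1) * y ^ 5)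
    with ((Cmod (a k) * y) * ((m ^ 3 + 1) * y ^ 3) * y) by ring.
  apply Rmult_le_compat_r; [lra|].
  apply Rmult_le_compat; try assumption.
  - apply Rmult_le_pos; [apply Cmod_ge_0|lra].
  - apply Rmult_le_pos; [|apply pow_le; lra].
    assert (0 <= m ^ 3) by (apply pow_le; apply pos_INR). lra.
Qed.

(* The [t ^ 2] coefficient of [(z + t) ^ k]. *)
Fixpoint pow_coef2 (z : C) (k : nat) : C :=
  match k with
  | O => RtoC 0
  | S j => (z * pow_coef2 z j + INR j * z ^ pred j)%C
  end.

(** The powers of [x] on the left avoid negative exponents such as [k - 3]. The induction uses
    [R_(k+1) = (z + t) R_k + t ^ 3 c_k], with [R_k] the remainder and [c_k] the quadratic
    coefficient. *)
Lemma pow_taylor_bounds (z t : C) (x : R) (k : nat) :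
  0 < x -> Cmod z <= x -> Cmod (z + t)%C <= x ->
  Cmod (INR k * z ^ pred k)%C * x <= INR k * x ^ k /\
  Cmod (pow_coef2 z k) * x ^ 2 <= INR k ^ 2 * x ^ k /\
  Cmod ((z + t) ^ k - (z ^ k + INR k * z ^ pred k * t + pow_coef2 z k * (t * t)))%C * x ^ 3
    <= INR k ^ 3 * x ^ k * Cmod t ^ 3.
Proof.
  intros Hx Hz Hzt.
  assert (Hd : forall j, Cmod (INR j * z ^ pred j)%C * x <= INR j * x ^ j).
  { intros [|j]; [simpl; rewrite Cmod_mult, Cmod_0; lra|].
    rewrite Cmod_mult, Cmod_R, Rabs_pos_eq by apply pos_INR.
    rewrite Rmult_assoc. apply Rmult_le_compat_l; [apply pos_INR|].
    simpl pred. rewrite Cmod_pow. simpl. rewrite Rmult_comm.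
    apply Rmult_le_compat_l; [lra|]. apply pow_incr. split; [apply Cmod_ge_0|assumption]. }
  split; [apply Hd|]. induction k as [|k [IH1 IH2]].
  - simpl. rewrite Cmod_0.
    replace (1 - (1 + 0 * 1 * t + 0 * (t * t)))%C with (RtoC 0) by ring.
    rewrite Cmod_0. lra.
  - assert (Pk := pos_INR k). assert (Px : 0 < x ^ k) by now apply pow_lt.
    specialize (Hd k).
    assert (Pc := Cmod_ge_0 (pow_coef2 z k)).
    assert (E1 : Cmod (pow_coef2 z (S k))
       <= x * Cmod (pow_coef2 z k) + Cmod (INR k * z ^ pred k)%C).
    { simpl pow_coef2. eapply Rle_trans; [apply Cmod_triangle|].
      rewrite Cmod_mult. apply Rplus_le_compat_r. now apply Rmult_le_compat_r. }
    set (d := Cmod (INR k * z ^ pred k)%C) in *.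
    assert (Pd : 0 <= d) by apply Cmod_ge_0.
    split.
    + rewrite S_INR. simpl (x ^ S k).
      assert (F1 : Cmod (pow_coef2 z (S k)) * x ^ 2
        <= (x * Cmod (pow_coef2 z k) + d) * x ^ 2)
        by (apply Rmult_le_compat_r; [apply pow2_ge_0|assumption]).
      assert (F2 : x * (Cmod (pow_coef2 z k) * x ^ 2) <= x * (INR k ^ 2 * x ^ k))
        by (apply Rmult_le_compat_l; lra).
      assert (F3 : x * (d * x) <= x * (INR k * x ^ k)) by (apply Rmult_le_compat_l; lra).
      assert (F4 : 0 <= (INR k + 1) * (x * x ^ k)) by (apply Rmult_le_pos; nra).
      nra.
    + set (Rk := ((z + t) ^ k - (z ^ k + INR k * z ^ pred k * t + pow_coef2 z k * (t * t)))%C)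
        in *.
      replace ((z + t) ^ S k - (z ^ S k + INR (S k) * z ^ pred (S k) * t
         + pow_coef2 z (S k) * (t * t)))%C
        with ((z + t) * Rk + t ^ 3 * pow_coef2 z k)%C.
      2:{ unfold Rk. rewrite S_INR, RtoC_plus. destruct k; simpl; ring. }
      assert (Pt : 0 <= Cmod t ^ 3) by (apply pow_le, Cmod_ge_0).
      assert (E2 : Cmod ((z + t) * Rk + t ^ 3 * pow_coef2 z k)%C
        <= x * Cmod Rk + Cmod t ^ 3 * Cmod (pow_coef2 z k)).
      { eapply Rle_trans; [apply Cmod_triangle|]. rewrite !Cmod_mult, Cmod_pow.
        apply Rplus_le_compat_r. apply Rmult_le_compat_r; [apply Cmod_ge_0|assumption]. }
      apply (Rmult_le_compat_r (x ^ 3)) in E2; [|apply pow_le; lra].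
      eapply Rle_trans; [apply E2|].
      rewrite S_INR. simpl (x ^ S k).
      set (T := Cmod t ^ 3) in *.
      assert (F1 : x * (Cmod Rk * x ^ 3) <= x * (INR k ^ 3 * x ^ k * T))
        by (apply Rmult_le_compat_l; lra).
      assert (F2 : T * x * (Cmod (pow_coef2 z k) * x ^ 2) <= T * x * (INR k ^ 2 * x ^ k))
        by (apply Rmult_le_compat_l; [apply Rmult_le_pos; lra|assumption]).
      assert (F3 : 0 <= T * (x * x ^ k) * (2 * INR k ^ 2 + 3 * INR k + 1)).
      { apply Rmult_le_pos; [apply Rmult_le_pos; [assumption|]|]; nra. }
      nra.
Qed.

(** Termwise summation of the expansions of the monomials. The series for [b] is kept in the
    conclusion because [expansion_C_derive] reads the coefficients of [f'] from it. *)
Lemma expansion_taylor2_series (f : C -> C) (a : nat -> C) (z : C) :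
  has_expansion f a -> Cmod z < 1 ->
  exists b c, Cseries (fun k => a k * (INR k * z ^ pred k))%C b /\ taylor2 f z b c.
Proof.
  intros Hf Hz. assert (Hz0 := Cmod_ge_0 z).
  set (x := (1 + Cmod z) / 2).
  assert (Hx : 0 < x < 1) by (unfold x; lra).
  destruct (coefficients_cubic_bound f a x Hf Hx) as (M & q & HM & Hq & HMk).
  assert (Hk1 : forall k, INR k <= INR k ^ 3 + 1 /\ INR k ^ 2 <= INR k ^ 3 + 1).
  { intros k. assert (P := pos_INR k). split.
    - assert (0 <= (INR k - 1) ^ 2 * (INR k + 2)) by (apply Rmult_le_pos; [apply pow2_ge_0|lra]).
      simpl in *. nra.
    - assert (0 <= (INR k - 1) ^ 2 * (INR k + 1)) by (apply Rmult_le_pos; [apply pow2_ge_0|lra]).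
      simpl in *. nra. }
  assert (Hzx : Cmod z <= x) by (unfold x; lra).
  (* Common shape of the three estimates of [pow_taylor_bounds]: [e] is a power of [x], [N] a power
     of [k], and [y] is 1 or [|t| ^ 3]. Each becomes a geometric majorant. *)
  assert (Hgen : forall k (v N e y : R), 0 <= v -> 0 < e -> v * e <= N * x ^ k * y ->
      N <= INR k ^ 3 + 1 -> 0 <= y -> Cmod (a k) * v <= M * / e * y * q ^ k).
  { intros k v N e y Hv He Hve HN Hy.
    assert (Px : 0 < x ^ k) by (apply pow_lt; lra).
    assert (Pa := Cmod_ge_0 (a k)).
    apply (Rmult_le_reg_r e); [assumption|].
    replace (M * / e * y * q ^ k * e) with (M * q ^ k * y) by (field; lra).
    apply Rle_trans with (Cmod (a k) * (N * x ^ k * y)).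
    { rewrite Rmult_assoc. now apply Rmult_le_compat_l. }
    apply Rle_trans with (Cmod (a k) * (INR k ^ 3 + 1) * x ^ k * y).
    - replace (Cmod (a k) * (INR k ^ 3 + 1) * x ^ k * y)
        with (Cmod (a k) * ((INR k ^ 3 + 1) * x ^ k * y)) by ring.
      apply Rmult_le_compat_l; [assumption|].
      apply Rmult_le_compat_r; [assumption|]. apply Rmult_le_compat_r; lra.
    - apply Rmult_le_compat_r; [assumption|]. apply HMk. }
  destruct (Cseries_exists (fun k => a k * (INR k * z ^ pred k))%C
     (fun k => (M * / x * 1) * q ^ k)) as [b Hb].
  { intros k. rewrite Cmod_mult.
    destruct (pow_taylor_bounds z 0 x k ltac:(lra) Hzx) as [B _];
      [now rewrite Cplus_0_r|].
    apply (Hgen k _ (INR k)); [apply Cmod_ge_0|lra| |apply Hk1|lra].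
    rewrite Rmult_1_r. exact B. }
  { eexists. apply is_series_geom_scal. exact Hq. }
  destruct (Cseries_exists (fun k => a k * pow_coef2 z k)%C
     (fun k => (M * / x ^ 2 * 1) * q ^ k)) as [c Hc].
  { intros k. rewrite Cmod_mult.
    destruct (pow_taylor_bounds z 0 x k ltac:(lra) Hzx) as [_ [B _]];
      [now rewrite Cplus_0_r|].
    apply (Hgen k _ (INR k ^ 2)); [apply Cmod_ge_0|apply pow_lt; lra| |apply Hk1|lra].
    rewrite Rmult_1_r. exact B. }
  { eexists. apply is_series_geom_scal. exact Hq. }
  exists b, c. split; [assumption|].
  exists (M * / x ^ 3 * / (1 - q)), (x - Cmod z).
  assert (Hx3 : 0 < x ^ 3) by (apply pow_lt; lra).
  split.
  { apply Rmult_le_pos; [apply Rmult_le_pos|]; [assumption| |];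
      left; apply Rinv_0_lt_compat; lra. }
  split; [unfold x; lra|]. intros t Ht.
  assert (Hzt : Cmod (z + t)%C <= x) by (assert (A := Cmod_triangle z t); lra).
  replace (M * / x ^ 3 * / (1 - q) * Cmod t ^ 3)
    with ((M * / x ^ 3 * Cmod t ^ 3) * / (1 - q)) by ring.
  apply (Cseries_bound (fun k => a k * (z + t) ^ k
      - (a k * z ^ k + t * (a k * (INR k * z ^ pred k))
         + (t * t) * (a k * pow_coef2 z k)))%C _
      (fun k => (M * / x ^ 3 * Cmod t ^ 3) * q ^ k)).
  - replace (b * t)%C with (t * b)%C by ring.
    replace (c * (t * t))%C with ((t * t) * c)%C by ring.
    apply (Cseries_minus (fun k => a k * (z + t) ^ k)%C
      (fun k => a k * z ^ k + t * (a k * (INR k * z ^ pred k))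
         + (t * t) * (a k * pow_coef2 z k))%C).
    + apply has_expansion_Cseries; [assumption|lra].
    + apply (Cseries_plus (fun k => a k * z ^ k + t * (a k * (INR k * z ^ pred k)))%C
        (fun k => (t * t) * (a k * pow_coef2 z k))%C).
      * apply (Cseries_plus (fun k => a k * z ^ k)%C
          (fun k => t * (a k * (INR k * z ^ pred k)))%C).
        -- apply has_expansion_Cseries; [assumption|lra].
        -- now apply Cseries_scal.
      * now apply Cseries_scal.
  - intros k.
    replace (a k * (z + t) ^ k - (a k * z ^ k + t * (a k * (INR k * z ^ pred k))
         + t * t * (a k * pow_coef2 z k)))%C
      with (a k * ((z + t) ^ k - (z ^ k + INR k * z ^ pred k * t
             + pow_coef2 z k * (t * t))))%C by ring.
    rewrite Cmod_mult.
    destruct (pow_taylor_bounds z t x k ltac:(lra) Hzx Hzt) as [_ [_ B]].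
    apply (Hgen k _ (INR k ^ 3)); [apply Cmod_ge_0|assumption|exact B|lra|].
    apply pow_le, Cmod_ge_0.
  - apply is_series_geom_scal. exact Hq.
Qed.

Lemma taylor2_C_derive (f : C -> C) (z b c : C) : taylor2 f z b c -> C_derive f z = b.
Proof. intros H. apply is_C_derive_unique. exact (taylor2_is_derive _ _ _ _ H). Qed.

Lemma expansion_taylor2 (f : C -> C) (a : nat -> C) (z : C) :
  has_expansion f a -> Cmod z < 1 -> exists c, taylor2 f z (C_derive f z) c.
Proof.
  intros Hf Hz. destruct (expansion_taylor2_series f a z Hf Hz) as (b & c & _ & H).
  exists c. now rewrite (taylor2_C_derive _ _ _ _ H).
Qed.

Lemma expansion_C_derive (f : C -> C) (a : nat -> C) :
  has_expansion f a -> has_expansion (C_derive f) (fun k => INR (S k) * a (S k))%C.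
Proof.
  intros Hf. apply Cseries_has_expansion. intros z Hz.
  destruct (expansion_taylor2_series f a z Hf Hz) as (b & c & Hb & H).
  rewrite (taylor2_C_derive _ _ _ _ H).
  apply Cseries_shift in Hb.
  replace (b - a 0%nat * (INR 0 * z ^ pred 0))%C with b in Hb by (simpl; ring).
  refine (Cseries_ext _ _ _ _ Hb). intros k. simpl pred. ring.
Qed.

Lemma expansion_analytic (f : C -> C) (a : nat -> C) : has_expansion f a -> analytic f.
Proof.
  intros Hf z Hz. destruct (expansion_taylor2 f a z Hf Hz) as [c H].
  eexists. exact (taylor2_is_derive _ _ _ _ H).
Qed.

Lemma expansion_order (f : C -> C) (a : nat -> C) (n : nat) :
  has_expansion f a -> (forall k, (1 <= k < n)%nat -> a k = RtoC 0) ->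
  bigO n (fun z => f z - a O)%C.
Proof.
  intros Hf Ha. destruct (coefficients_bound f a (/ 2) Hf ltac:(lra)) as (M & HM & HMk).
  (* Since [|a_k| <= M 2 ^ k], for [|z| < 1/4] the terms with [k >= n] are at most
     [M 4 ^ n |z| ^ n 2 ^ (- k)]; the factor 2 is the sum of the geometric series. *)
  exists (M * (4 ^ n) * 2), (/ 4). split.
  { apply Rmult_le_pos; [|lra]. apply Rmult_le_pos; [assumption|]. apply pow_le. lra. }
  split; [lra|]. intros z Hz. assert (Hz0 := Cmod_ge_0 z).
  assert (Hs := has_expansion_Cseries f a z Hf ltac:(lra)).
  apply Cseries_shift in Hs. simpl in Hs. rewrite Cmult_1_r in Hs.
  replace (M * 4 ^ n * 2 * Cmod z ^ n)
    with ((M * 4 ^ n * Cmod z ^ n) * / (1 - / 2)) by field.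
  refine (Cseries_bound _ _ (fun k => (M * 4 ^ n * Cmod z ^ n) * (/ 2) ^ k) _ Hs _
            (is_series_geom_scal (M * 4 ^ n * Cmod z ^ n) (/ 2) ltac:(lra))).
  intros k. change (z * z ^ k)%C with (z ^ S k)%C. rewrite Cmod_mult, Cmod_pow.
  assert (P1 : 0 <= 4 ^ n) by (apply pow_le; lra).
  assert (P2 : 0 <= Cmod z ^ n) by now apply pow_le.
  assert (P3 : 0 <= (/ 2) ^ k) by (apply pow_le; lra).
  destruct (Nat.lt_ge_cases (S k) n) as [Hk|Hk].
  { rewrite Ha by lia. rewrite Cmod_0, Rmult_0_l.
    repeat apply Rmult_le_pos; lra. }
  specialize (HMk (S k)).
  assert (A : Cmod z ^ S k <= Cmod z ^ n * (/ 4) ^ (S k - n)).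
  { replace (S k) with (n + (S k - n))%nat at 1 by lia. rewrite pow_add.
    apply Rmult_le_compat_l; [assumption|]. apply pow_incr. lra. }
  assert (B : (/ 4) ^ (S k - n) = 4 ^ n * ((/ 2) ^ S k * (/ 2) ^ S k)).
  { rewrite <- Rpow_mult_distr. replace (/ 2 * / 2) with (/ 4) by field.
    replace (S k) with (n + (S k - n))%nat at 2 by lia.
    rewrite pow_add, <- Rmult_assoc, <- Rpow_mult_distr, Rinv_r, pow1 by lra. ring. }
  rewrite B in A.
  assert (Pa := Cmod_ge_0 (a (S k))).
  assert (P5 : 0 <= (/ 2) ^ S k) by (apply pow_le; lra).
  apply Rle_trans with (Cmod (a (S k)) * (Cmod z ^ n * (4 ^ n * ((/ 2) ^ S k * (/ 2) ^ S k)))).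
  { now apply Rmult_le_compat_l. }
  replace (Cmod (a (S k)) * (Cmod z ^ n * (4 ^ n * ((/ 2) ^ S k * (/ 2) ^ S k))))
    with ((Cmod (a (S k)) * (/ 2) ^ S k) * (4 ^ n * Cmod z ^ n * (/ 2) ^ S k)) by ring.
  replace (M * 4 ^ n * Cmod z ^ n * (/ 2) ^ k)
    with (M * (4 ^ n * Cmod z ^ n * (/ 2) ^ k)) by ring.
  apply Rmult_le_compat; try assumption.
  - now apply Rmult_le_pos.
  - apply Rmult_le_pos; [now apply Rmult_le_pos|assumption].
  - apply Rmult_le_compat_l; [now apply Rmult_le_pos|]. simpl. lra.
Qed.

(** * Complex derivatives and the inverse hyperbolic sine *)

Definition Cderiv (f : C -> C) (z l : C) : Prop :=
  @is_derive C_AbsRing C_NormedModule f z l.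

(* [C_NormedModule] and [AbsRing_NormedModule C_AbsRing] carry the same norm but
   are not convertible. *)
Lemma Cderiv_AbsRing (f : C -> C) (z l : C) :
  Cderiv f z l <-> @is_derive C_AbsRing (AbsRing_NormedModule C_AbsRing) f z l.
Proof.
  split; intros [_ H]; (split; [apply is_linear_scal_l|exact H]).
Qed.

Lemma Cderiv_ext_near (f g : C -> C) (z l : C) (d : R) :
  0 < d -> (forall x : C, Cmod (x - z) < d -> f x = g x) -> Cderiv f z l -> Cderiv g z l.
Proof.
  intros Hd Hfg H. refine (is_derive_ext_loc f g z l _ H).
  apply (@locally_le_locally_norm C_AbsRing (AbsRing_NormedModule C_AbsRing)).
  exists (mkposreal d Hd). intros y Hy. apply Hfg. exact Hy.
Qed.

Lemma Cderiv_const (a z : C) : Cderiv (fun _ => a) z (RtoC 0).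
Proof. exact (taylor2_is_derive _ _ _ _ (taylor2_const a z)). Qed.

Lemma Cderiv_id (z : C) : Cderiv (fun x => x) z (RtoC 1).
Proof. exact (taylor2_is_derive _ _ _ _ (taylor2_id z)). Qed.

Lemma Cderiv_plus (f g : C -> C) (z l l' : C) :
  Cderiv f z l -> Cderiv g z l' -> Cderiv (fun x => f x + g x)%C z (l + l')%C.
Proof. exact (@is_derive_plus C_AbsRing C_NormedModule f g z l l'). Qed.

Lemma Cderiv_minus (f g : C -> C) (z l l' : C) :
  Cderiv f z l -> Cderiv g z l' -> Cderiv (fun x => f x - g x)%C z (l - l')%C.
Proof. exact (@is_derive_minus C_AbsRing C_NormedModule f g z l l'). Qed.

Lemma Cderiv_mult (f g : C -> C) (z l l' : C) :
  Cderiv f z l -> Cderiv g z l' -> Cderiv (fun x => f x * g x)%C z (l * g z + f z * l')%C.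
Proof.
  intros Hf Hg. apply Cderiv_AbsRing.
  apply (@is_derive_mult C_AbsRing f g z l l'); [now apply Cderiv_AbsRing..|].
  exact Cmult_comm.
Qed.

Lemma Cderiv_comp (f g : C -> C) (z l l' : C) :
  Cderiv f (g z) l -> Cderiv g z l' -> Cderiv (fun x => f (g x)) z (l' * l)%C.
Proof.
  intros Hf Hg. apply (@is_derive_comp C_AbsRing C_NormedModule f g z l l');
    [assumption|]. now apply Cderiv_AbsRing.
Qed.

Lemma Cderiv_inv (f : C -> C) (z l : C) :
  Cderiv f z l -> f z <> RtoC 0 -> Cderiv (fun x => / f x)%C z (- l / (f z * f z))%C.
Proof.
  intros Hf Hz.
  replace (- l / (f z * f z))%C with (l * (- (1) / (f z * f z)))%C by (field; assumption).
  apply (Cderiv_comp Cinv f); [|assumption].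
  exact (taylor2_is_derive _ _ _ _ (taylor2_inv _ _ _ _ (taylor2_id (f z)) Hz)).
Qed.

Lemma Cderiv_div (f g : C -> C) (z l l' : C) :
  Cderiv f z l -> Cderiv g z l' -> g z <> RtoC 0 ->
  Cderiv (fun x => f x / g x)%C z ((l * g z - f z * l') / (g z * g z))%C.
Proof.
  intros Hf Hg Hz.
  replace ((l * g z - f z * l') / (g z * g z))%C
    with (l * / g z + f z * (- l' / (g z * g z)))%C by (field; assumption).
  apply (Cderiv_mult f (fun x => / g x)%C); [assumption|]. now apply Cderiv_inv.
Qed.

Lemma Cderiv_pow (n : nat) (z : C) :
  Cderiv (fun x => x ^ n)%C z (INR n * z ^ pred n)%C.
Proof.
  destruct (taylor2_pow _ _ _ _ n (taylor2_id z)) as [c H].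
  replace (INR n * z ^ pred n)%C with (INR n * z ^ pred n * 1)%C by ring.
  exact (taylor2_is_derive _ _ _ _ H).
Qed.

Lemma analytic_Cderiv (f : C -> C) (z : C) :
  analytic f -> Cmod z < 1 -> Cderiv f z (C_derive f z).
Proof. intros Hf Hz. apply C_derive_correct; [exact z|]. now apply Hf. Qed.

Lemma Cderiv_unique (f : C -> C) (z l : C) : Cderiv f z l -> C_derive f z = l.
Proof. apply is_C_derive_unique. Qed.

(** * Real estimates for sinh, sin, cos and exp *)

Lemma sinh_plus_cosh (x : R) : sinh x + cosh x = exp x.
Proof. unfold sinh, cosh. field. Qed.

Lemma cosh_sq (x : R) : cosh x ^ 2 = 1 + sinh x ^ 2.
Proof.
  unfold sinh, cosh. rewrite exp_Ropp. field. apply Rgt_not_eq, exp_pos.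
Qed.

Lemma cosh_pos (x : R) : 0 < cosh x.
Proof. unfold cosh. assert (A := exp_pos x). assert (B := exp_pos (- x)). lra. Qed.

Lemma cosh_ge_1 (x : R) : 1 <= cosh x.
Proof. assert (A := cosh_sq x). assert (B := cosh_pos x). nra. Qed.

Lemma sinh_nonneg (x : R) : 0 <= x -> 0 <= sinh x.
Proof.
  intros [H| <-]; [|rewrite sinh_0; lra].
  rewrite <- sinh_0. left. now apply sinh_lt.
Qed.

Lemma sinh_mean_value (a b : R) :
  a < b -> exists c, sinh b - sinh a = cosh c * (b - a) /\ a < c < b.
Proof.
  intros H. apply (MVT_cor2 sinh cosh a b H). intros c _. apply derivable_pt_lim_sinh.
Qed.

Lemma sinh_ge_id (x : R) : 0 <= x -> x <= sinh x.
Proof.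
  intros [H| <-]; [|rewrite sinh_0; lra].
  destruct (sinh_mean_value 0 x H) as (c & Hc & _). rewrite sinh_0 in Hc.
  assert (A := cosh_ge_1 c). nra.
Qed.

Lemma cosh_le (x y : R) : 0 <= x <= y -> cosh x <= cosh y.
Proof.
  intros H.
  assert (A : sinh x <= sinh y).
  { destruct (proj2 H) as [L| ->]; [left; now apply sinh_lt|lra]. }
  assert (B := sinh_nonneg x (proj1 H)).
  assert (D := cosh_sq x). assert (E := cosh_sq y).
  assert (F := cosh_pos x). assert (G := cosh_pos y). nra.
Qed.

(** Convexity on the half-line: the slopes over [[0, a t]] and [[a t, a]] are values of [cosh], in
    increasing order. *)
Lemma sinh_chord (a t : R) : 0 <= a -> 0 <= t <= 1 -> sinh (a * t) <= t * sinh a.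
Proof.
  intros Ha Ht.
  destruct (Req_dec (a * t) 0) as [E|E].
  { rewrite E, sinh_0. apply Rmult_le_pos; [lra|now apply sinh_nonneg]. }
  assert (Hat : 0 < a * t) by (assert (0 <= a * t) by (apply Rmult_le_pos; lra); lra).
  destruct (Req_dec t 1) as [->|Ht1]; [rewrite Rmult_1_r; lra|].
  assert (Hata : a * t < a) by nra.
  destruct (sinh_mean_value 0 (a * t) Hat) as (c1 & E1 & H1).
  destruct (sinh_mean_value (a * t) a Hata) as (c2 & E2 & H2).
  rewrite sinh_0 in E1. assert (A := cosh_le c1 c2 ltac:(lra)).
  assert (0 <= (cosh c2 - cosh c1) * (a * t * (1 - t)))
    by (apply Rmult_le_pos; [lra|apply Rmult_le_pos; lra]).
  nra.
Qed.

Lemma Rabs_sin_le (y : R) : Rabs (sin y) <= Rabs y.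
Proof.
  assert (H : forall u, 0 <= u -> Rabs (sin u) <= u).
  { intros u [Hu| <-]; [|rewrite sin_0, Rabs_R0; lra].
    destruct (MVT_cor2 sin cos 0 u Hu) as (c & Hc & _).
    { intros c _. apply derivable_pt_lim_sin. }
    rewrite sin_0 in Hc. replace (sin u) with (cos c * u) by lra.
    rewrite Rabs_mult, (Rabs_pos_eq u) by lra.
    assert (B := COS_bound c). assert (Rabs (cos c) <= 1) by (apply Rabs_le; lra). nra. }
  destruct (Rle_dec 0 y) as [Hy|Hy].
  - rewrite (Rabs_pos_eq y Hy). auto.
  - rewrite <- (Rabs_Ropp y), <- Rabs_Ropp, <- sin_neg.
    rewrite (Rabs_pos_eq (- y)) by lra. apply H. lra.
Qed.

Lemma Rabs_cos_minus_1_le (y : R) : Rabs (cos y - 1) <= y ^ 2.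
Proof.
  replace y with (2 * (y / 2)) at 1 by field. rewrite cos_2a_sin.
  assert (A := Rabs_sin_le (y / 2)). assert (P := Rabs_pos (sin (y / 2))).
  replace (1 - 2 * sin (y / 2) * sin (y / 2) - 1) with (- (2 * (sin (y / 2)) ^ 2)) by ring.
  rewrite Rabs_Ropp, Rabs_pos_eq by (assert (Q := pow2_ge_0 (sin (y / 2))); lra).
  rewrite <- (pow2_abs (sin (y / 2))).
  assert (B : Rabs (sin (y / 2)) ^ 2 <= Rabs (y / 2) ^ 2) by (apply pow_incr; lra).
  rewrite (pow2_abs (y / 2)) in B. assert (D := pow2_ge_0 y). lra.
Qed.

Lemma Rabs_sin_minus_id_le (y : R) : Rabs y <= 1 -> Rabs (sin y - y) <= y ^ 2.
Proof.
  assert (H : forall u, 0 <= u <= 1 -> Rabs (sin u - u) <= u ^ 2).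
  { intros u [[Hu| <-] Hu1]; [|rewrite sin_0, Rminus_0_r, Rabs_R0; lra].
    destruct (MVT_cor2 sin cos 0 u Hu) as (c & Hc & Hcu).
    { intros c _. apply derivable_pt_lim_sin. }
    rewrite sin_0 in Hc. replace (sin u - u) with ((cos c - 1) * u) by lra.
    rewrite Rabs_mult, (Rabs_pos_eq u) by lra.
    assert (B := Rabs_cos_minus_1_le c). assert (Q := Rabs_pos (cos c - 1)).
    assert (c ^ 2 <= u) by nra. nra. }
  intros Hy. destruct (Rle_dec 0 y) as [Hy0|Hy0].
  - rewrite Rabs_pos_eq in Hy by assumption. auto.
  - rewrite <- Rabs_Ropp in Hy. rewrite Rabs_pos_eq in Hy by lra.
    rewrite <- Rabs_Ropp. replace (- (sin y - y)) with (sin (- y) - - y)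
      by (rewrite sin_neg; ring).
    replace (y ^ 2) with ((- y) ^ 2) by ring. apply H. lra.
Qed.

Lemma exp_taylor1 (x : R) : Rabs x <= / 2 -> Rabs (exp x - 1 - x) <= 2 * x ^ 2.
Proof.
  intros Hx. apply Rabs_le_between in Hx.
  assert (A := exp_ineq1_le x). assert (B := exp_ineq1_le (- x)).
  assert (D : exp x * exp (- x) = 1) by (rewrite <- exp_plus, Rplus_opp_r; apply exp_0).
  assert (P := exp_pos x).
  apply Rabs_le. split; [assert (Q := pow2_ge_0 x); lra|].
  (* The upper bound on [exp x] comes from the lower bound [1 - x] on its inverse. *)
  assert (E : exp x * (1 - x) <= 1) by nra.
  assert (F : 1 <= (1 + x + 2 * x ^ 2) * (1 - x)).
  { assert (0 <= x ^ 2 * (1 - 2 * x)) by (apply Rmult_le_pos; [apply pow2_ge_0|lra]). nra. }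
  assert (exp x <= 1 + x + 2 * x ^ 2); [|lra].
  apply (Rmult_le_reg_r (1 - x)); lra.
Qed.

(** * Complex exponential and hyperbolic sine *)

Definition Cexp (z : C) : C := (exp (fst z) * cos (snd z), exp (fst z) * sin (snd z)).

Lemma Cexp_plus (z t : C) : Cexp (z + t) = (Cexp z * Cexp t)%C.
Proof.
  unfold Cexp. destruct z as [x y], t as [u v]. simpl.
  rewrite exp_plus, cos_plus, sin_plus.
  apply injective_projections; simpl; ring.
Qed.

Lemma Cderiv_Cexp (z : C) : Cderiv Cexp z (Cexp z).
Proof.
  apply bigO_is_derive.
  apply (bigO_ext _ (fun t => Cexp z * (Cexp t - (1 + t)))%C _ 1); [lra| |].
  { intros t _. rewrite Cexp_plus. ring. }
  apply (bigO_mult 0 2); [apply bigO_const|].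
  (* Both components of [Cexp t - 1 - t] turn out to be at most [2 |t| ^ 2], so 20 is generous. *)
  exists 20, (/ 2). split; [lra|]. split; [lra|].
  intros [x y] Ht. destruct (Cmod_components_le (x, y) (/ 2) ltac:(lra)) as [Hx Hy].
  simpl in Hx, Hy.
  assert (Hsq := Cmod_sq (x, y)). simpl fst in Hsq. simpl snd in Hsq.
  rewrite Hsq.
  assert (Ax := exp_taylor1 x ltac:(apply Rabs_le; lra)).
  assert (Ac := Rabs_cos_minus_1_le y).
  assert (As := Rabs_sin_minus_id_le y ltac:(apply Rabs_le; lra)).
  assert (Bc : Rabs (cos y) <= 1) by (apply Rabs_le, COS_bound).
  assert (Bs := Rabs_sin_le y).
  assert (Bx : Rabs (1 + x) <= 2) by (apply Rabs_le; lra).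
  assert (Be : Rabs (exp x - 1) <= 2 * Rabs x).
  { replace (exp x - 1) with ((exp x - 1 - x) + x) by ring.
    eapply Rle_trans; [apply Rabs_triang|]. rewrite <- (pow2_abs x) in Ax.
    assert (Rabs x <= / 2) by (apply Rabs_le; lra). assert (P := Rabs_pos x). nra. }
  assert (Qx := pow2_ge_0 x). assert (Qy := pow2_ge_0 y).
  assert (R1 : Rabs (exp x * cos y - (1 + x)) <= 2 * x ^ 2 + 2 * y ^ 2).
  { replace (exp x * cos y - (1 + x))
      with ((exp x - 1 - x) * cos y + (1 + x) * (cos y - 1)) by ring.
    eapply Rle_trans; [apply Rabs_triang|]. rewrite !Rabs_mult.
    assert (P1 := Rabs_pos (exp x - 1 - x)). assert (P2 := Rabs_pos (cos y)).
    assert (P3 := Rabs_pos (1 + x)). assert (P4 := Rabs_pos (cos y - 1)). nra. }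
  assert (R2 : Rabs (exp x * sin y - y) <= 2 * x ^ 2 + 2 * y ^ 2).
  { replace (exp x * sin y - y) with ((exp x - 1) * sin y + (sin y - y)) by ring.
    eapply Rle_trans; [apply Rabs_triang|]. rewrite !Rabs_mult.
    assert (P1 := Rabs_pos (exp x - 1)). assert (P2 := Rabs_pos (sin y)).
    assert (P3 := Rabs_pos x). assert (P4 := Rabs_pos y).
    rewrite <- (pow2_abs x), <- (pow2_abs y) in *.
    assert (E : Rabs (exp x - 1) * Rabs (sin y) <= (2 * Rabs x) * Rabs y)
      by (apply Rmult_le_compat; lra).
    assert (F := pow2_ge_0 (Rabs x - Rabs y)). nra. }
  eapply Rle_trans; [apply Cmod_2Rmax|].
  assert (Hs : sqrt 2 <= 2).
  { rewrite <- (sqrt_square 2) at 2 by lra. apply sqrt_le_1; lra. }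
  assert (Hs0 := sqrt_pos 2).
  set (m := Rmax _ _).
  assert (Hm : m <= 2 * x ^ 2 + 2 * y ^ 2).
  { unfold m. apply Rmax_lub.
    - refine (Rle_trans _ _ _ _ R1). apply Req_le, (f_equal Rabs). simpl. ring.
    - refine (Rle_trans _ _ _ _ R2). apply Req_le, (f_equal Rabs). simpl. ring. }
  assert (Hm0 : 0 <= m) by (unfold m; eapply Rle_trans; [apply Rabs_pos|apply Rmax_l]).
  nra.
Qed.

Definition Csinh (z : C) : C := ((Cexp z - Cexp (- z)) / 2)%C.

Lemma Csinh_components (x y : R) : Csinh (x, y) = (sinh x * cos y, cosh x * sin y).
Proof.
  unfold Csinh, Cexp, sinh, cosh. simpl. rewrite cos_neg, sin_neg.
  apply injective_projections; simpl; field.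
Qed.

Lemma Csinh_0 : Csinh (RtoC 0) = RtoC 0.
Proof.
  unfold Csinh. replace (- RtoC 0)%C with (RtoC 0) by ring. field.
Qed.

Lemma Cderiv_Csinh (z : C) : Cderiv Csinh z ((Cexp z + Cexp (- z)) * / 2)%C.
Proof.
  replace ((Cexp z + Cexp (- z)) * / 2)%C
    with ((Cexp z - (0 - 1) * Cexp (- z)) * / 2 + (Cexp z - Cexp (- z)) * 0)%C by ring.
  apply (Cderiv_mult (fun z => Cexp z - Cexp (- z))%C (fun _ => / 2)%C);
    [|apply Cderiv_const].
  apply Cderiv_minus; [apply Cderiv_Cexp|].
  apply (Cderiv_comp Cexp (fun x => - x)%C); [apply Cderiv_Cexp|].
  apply (Cderiv_ext_near (fun x => 0 - x)%C _ _ _ 1); [lra|intros; ring|].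
  apply (Cderiv_minus (fun _ => RtoC 0) (fun x => x)); [apply Cderiv_const|apply Cderiv_id].
Qed.

Lemma Csinh_sq (x y : R) : Cmod (Csinh (x, y)) ^ 2 = sinh x ^ 2 + sin y ^ 2.
Proof.
  rewrite Csinh_components, Cmod_sq. simpl fst. simpl snd.
  rewrite !Rpow_mult_distr, cosh_sq.
  assert (A := sin2_cos2 y). rewrite !Rsqr_pow2 in A. nra.
Qed.

Lemma sinh_sq_diff (a b : R) : sinh a ^ 2 - sinh b ^ 2 = sinh (a - b) * sinh (a + b).
Proof.
  unfold sinh, Rminus. rewrite !Ropp_plus_distr, Ropp_involutive, !exp_plus, !exp_Ropp.
  field. split; apply Rgt_not_eq, exp_pos.
Qed.

(** Here [|sinh v| ^ 2 = sinh x ^ 2 + sin y ^ 2], while with [m = |v|] the difference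
    [sinh m ^ 2 - sinh x ^ 2] equals [sinh (m - |x|) sinh (m + |x|)], which is at least
    [m ^ 2 - x ^ 2 = y ^ 2]. *)
Lemma Cmod_Csinh_le (v : C) : Cmod (Csinh v) <= sinh (Cmod v).
Proof.
  destruct v as [x y].
  apply Rsqr_incr_0_var; [|apply sinh_nonneg, Cmod_ge_0].
  rewrite !Rsqr_pow2, Csinh_sq.
  assert (H := Cmod_sq (x, y)). simpl fst in H. simpl snd in H.
  set (m := Cmod (x, y)) in *. assert (Hm : 0 <= m) by apply Cmod_ge_0.
  assert (Hx : Rabs x <= m).
  { apply Rsqr_incr_0_var; [|assumption]. rewrite !Rsqr_pow2, pow2_abs.
    assert (Q := pow2_ge_0 y). lra. }
  assert (Hsx : sinh x ^ 2 = sinh (Rabs x) ^ 2).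
  { unfold Rabs. destruct (Rcase_abs x); [|reflexivity].
    unfold sinh. rewrite Ropp_involutive. field. }
  assert (E := sinh_sq_diff m (Rabs x)).
  assert (Px := Rabs_pos x).
  assert (A1 := sinh_ge_id (m - Rabs x) ltac:(lra)).
  assert (A2 := sinh_ge_id (m + Rabs x) ltac:(lra)).
  assert (A3 : (m - Rabs x) * (m + Rabs x) <= sinh (m - Rabs x) * sinh (m + Rabs x))
    by (apply Rmult_le_compat; lra).
  assert (A4 : sin y ^ 2 <= y ^ 2).
  { rewrite <- (pow2_abs (sin y)), <- (pow2_abs y). apply pow_incr.
    split; [apply Rabs_pos|apply Rabs_sin_le]. }
  assert (A5 := pow2_abs x). nra.
Qed.

(** * Principal branches and inversion of sinh *)

Lemma Csqrt_sq (z : C) : (Csqrt z * Csqrt z)%C = z.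
Proof.
  destruct z as [x y]. unfold Csqrt. set (m := Cmod (x, y)). simpl Re. simpl Im.
  assert (Hm := Cmod_sq (x, y)). fold m in Hm. simpl fst in Hm. simpl snd in Hm.
  assert (Hm0 : 0 <= m) by apply Cmod_ge_0.
  assert (Hx : - m <= x <= m).
  { apply Rabs_le_between. apply Rsqr_incr_0_var; [|assumption].
    rewrite !Rsqr_pow2, pow2_abs. assert (Q := pow2_ge_0 y). lra. }
  assert (E1 := sqrt_sqrt ((m + x) / 2) ltac:(lra)).
  assert (E2 := sqrt_sqrt ((m - x) / 2) ltac:(lra)).
  assert (E3 : sqrt ((m + x) / 2) * sqrt ((m - x) / 2) = Rabs y / 2).
  { rewrite <- sqrt_mult by lra.
    replace ((m + x) / 2 * ((m - x) / 2)) with ((Rabs y / 2) ^ 2).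
    - rewrite <- Rsqr_pow2. apply sqrt_Rsqr. assert (P := Rabs_pos y). lra.
    - unfold Rdiv at 1. rewrite Rpow_mult_distr, pow2_abs. nra. }
  destruct (Rle_dec 0 y) as [Hy|Hy].
  - rewrite Rabs_pos_eq in E3 by assumption.
    apply injective_projections; simpl; lra.
  - rewrite Rabs_left in E3 by lra.
    apply injective_projections; simpl; lra.
Qed.

Lemma Csqrt_of_sq (c : C) : 0 < fst c -> Csqrt (c * c) = c.
Proof.
  intros Hc. destruct c as [a b]. simpl in Hc.
  assert (Hm : Cmod ((a, b) * (a, b))%C = a ^ 2 + b ^ 2)
    by (rewrite Cmod_mult; assert (A := Cmod_sq (a, b)); simpl in *; lra).
  unfold Csqrt. rewrite Hm. simpl Re. simpl Im.
  replace ((a ^ 2 + b ^ 2 + (a * a - b * b)) / 2) with (a ^ 2) by field.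
  replace ((a ^ 2 + b ^ 2 - (a * a - b * b)) / 2) with (b ^ 2) by field.
  rewrite <- !Rsqr_pow2, !sqrt_Rsqr_abs, (Rabs_pos_eq a) by lra.
  apply injective_projections; simpl; [reflexivity|].
  destruct (Rle_dec 0 (a * b + b * a)) as [H|H].
  - apply Rabs_pos_eq. nra.
  - rewrite Rabs_left by nra. ring.
Qed.

Lemma Clog_Cexp (x y : R) : - PI < y <= PI -> Clog (Cexp (x, y)) = (x, y).
Proof.
  intros Hy. unfold Clog, Carg, Cexp. simpl fst. simpl snd.
  assert (Px := exp_pos x).
  assert (Hm : Cmod (exp x * cos y, exp x * sin y) = exp x).
  { unfold Cmod. simpl fst. simpl snd.
    replace ((exp x * cos y) ^ 2 + (exp x * sin y) ^ 2) with (Rsqr (exp x)).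
    - apply sqrt_Rsqr. lra.
    - assert (A := sin2_cos2 y). rewrite !Rsqr_pow2 in *.
      rewrite !Rpow_mult_distr. nra. }
  rewrite Hm, ln_exp. simpl Re. simpl Im.
  replace (exp x * cos y / exp x) with (cos y) by (field; lra).
  apply injective_projections; simpl; [reflexivity|].
  destruct (Rle_dec 0 y) as [Hy0|Hy0].
  - assert (S := sin_ge_0 y Hy0 ltac:(lra)).
    destruct (Rle_dec 0 (exp x * sin y)) as [H|H]; [|nra].
    apply acos_cos. lra.
  - assert (S := sin_gt_0 (- y) ltac:(lra) ltac:(lra)). rewrite sin_neg in S.
    destruct (Rle_dec 0 (exp x * sin y)) as [H|H]; [nra|].
    rewrite <- cos_neg, acos_cos by lra. ring.
Qed.

(** As [1 < PI / 2], the number [c = cosh v] has positive real part, so it is the principal root of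
    [1 + sinh v ^ 2]; then [sinh v + cosh v = exp v] has argument [y]. *)
Lemma Casinh_Csinh (v : C) : Cmod v <= 1 -> Casinh (Csinh v) = v.
Proof.
  intros Hv. destruct v as [x y].
  destruct (Cmod_components_le _ _ Hv) as [_ Hy]. simpl in Hy.
  assert (HPI := PI2_1).
  unfold Casinh. rewrite Csinh_components.
  set (c := (cosh x * cos y, sinh x * sin y) : C).
  set (s := (sinh x * cos y, cosh x * sin y) : C).
  replace (1 + s * s)%C with (c * c)%C.
  2:{ assert (A := cosh_sq x). assert (B := sin2_cos2 y). rewrite !Rsqr_pow2 in B.
      apply injective_projections; simpl; [|ring].
      replace (cosh x * cos y * (cosh x * cos y) - sinh x * sin y * (sinh x * sin y))
        with (cosh x ^ 2 * cos y ^ 2 - sinh x ^ 2 * sin y ^ 2) by ring.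
      replace (sinh x * cos y * (sinh x * cos y) - cosh x * sin y * (cosh x * sin y))
        with (sinh x ^ 2 * cos y ^ 2 - cosh x ^ 2 * sin y ^ 2) by ring.
      rewrite A. replace (sin y ^ 2) with (1 - cos y ^ 2) by lra. ring. }
  rewrite Csqrt_of_sq.
  2:{ simpl. apply Rmult_lt_0_compat; [apply cosh_pos|]. apply cos_gt_0; lra. }
  replace (s + c)%C with (Cexp (x, y)).
  2:{ unfold Cexp. simpl fst. simpl snd. rewrite <- (sinh_plus_cosh x).
      apply injective_projections; simpl; ring. }
  apply Clog_Cexp. lra.
Qed.

(** Sharpness needs this converse at a single real value, with no restriction on [w]: the logarithm
    forces [w + s = exp a], and [s ^ 2 = 1 + w ^ 2] then determines [w]. *)
Lemma Casinh_real (w : C) (a : R) :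
  0 < a -> Casinh w = RtoC a -> w = RtoC (sinh a).
Proof.
  intros Ha H. unfold Casinh in H.
  set (s := Csqrt (1 + w * w)) in *.
  assert (Hs : (s * s)%C = (1 + w * w)%C) by apply Csqrt_sq.
  set (u := (w + s)%C) in *.
  unfold Clog in H. injection H as Hln Harg.
  assert (Hu : 0 < Cmod u).
  { destruct (Cmod_ge_0 u) as [L|E]; [assumption|].
    exfalso. rewrite <- E in Hln. unfold ln in Hln.
    destruct (Rlt_dec 0 0); lra. }
  assert (Hmu : Cmod u = exp a) by (rewrite <- Hln, exp_ln; auto).
  assert (Hac : acos (Re u / Cmod u) = 0).
  { unfold Carg in Harg. destruct (Rle_dec 0 (Im u)); lra. }
  assert (Hre : Re u / Cmod u = 1).
  { rewrite <- cos_0, <- Hac, cos_acos; [reflexivity|].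
    assert (A := re_le_Cmod u). apply Rabs_le_between in A.
    split; apply (Rmult_le_reg_r (Cmod u)); try assumption;
      unfold Rdiv; rewrite Rmult_assoc, Rinv_l; lra. }
  assert (Hre2 : Re u = exp a).
  { rewrite <- Hmu. apply (Rmult_eq_compat_r (Cmod u)) in Hre.
    unfold Rdiv in Hre. rewrite Rmult_assoc, Rinv_l in Hre; lra. }
  assert (Him : Im u = 0).
  { assert (A := Cmod2_alt u). rewrite Hre2, Hmu in A. nra. }
  assert (Hue : u = RtoC (exp a)).
  { apply injective_projections; simpl; [exact Hre2|exact Him]. }
  assert (Hsw : s = (RtoC (exp a) - w)%C) by (rewrite <- Hue; unfold u; ring).
  rewrite Hsw in Hs.
  assert (E : (2 * RtoC (exp a) * w)%C = (RtoC (exp a) * RtoC (exp a) - 1)%C).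
  { replace (RtoC (exp a) * RtoC (exp a) - 1)%C
      with ((RtoC (exp a) - w) * (RtoC (exp a) - w) + 2 * RtoC (exp a) * w - 1 - w * w)%C
      by ring.
    rewrite Hs. ring. }
  assert (Hea := exp_pos a).
  assert (Hne : RtoC (exp a) <> RtoC 0) by (intros Z; apply RtoC_inj in Z; lra).
  assert (H2 : RtoC 2 <> RtoC 0) by (intros Z; apply RtoC_inj in Z; lra).
  replace w with ((2 * RtoC (exp a) * w) / (2 * RtoC (exp a)))%C by (field; auto).
  rewrite E. unfold sinh. rewrite exp_Ropp.
  rewrite RtoC_div, RtoC_minus, RtoC_inv by lra. field. auto.
Qed.

(** * Membership of the dilations *)

Lemma one_minus_nonzero (w : C) : Cmod w < 1 -> (1 - w)%C <> RtoC 0.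
Proof.
  intros H E. assert (A := Cmod_minus_ge 1 w). rewrite E, Cmod_0, Cmod_1 in A. lra.
Qed.

Lemma Cmod_pow_le_self (n : nat) (z : C) : (1 <= n)%nat -> Cmod z < 1 -> Cmod (z ^ n) <= Cmod z.
Proof.
  intros Hn Hz. rewrite Cmod_pow. destruct n as [|n]; [lia|]. simpl.
  assert (A := Cmod_ge_0 z).
  assert (B : Cmod z ^ n <= 1) by (rewrite <- (pow1 n); apply pow_incr; lra). nra.
Qed.

(** Inverting the half-plane map gives [w = (p - 1) / D], where [D = 2 (1 - alpha) / (1 - w)] has
    modulus at least [1 - alpha]. Hence [w] has second-order expansions and vanishes to order [n],
    like [p - 1]. *)
Lemma class_P_schwarz (n : nat) (alpha : R) (p : C -> C) :
  (1 <= n)%nat -> 0 <= alpha < 1 -> class_P n alpha p ->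
  exists w : C -> C,
    (forall z, Cmod z < 1 -> exists b c, taylor2 w z b c) /\
    (forall z, Cmod z < 1 -> Cmod (w z) <= Cmod z ^ n) /\
    (forall z, Cmod z < 1 -> Cmod (w z) < 1) /\
    (forall z, Cmod z < 1 -> p z = ((1 + RtoC (1 - 2 * alpha) * w z) / (1 - w z))%C).
Proof.
  intros Hn Ha (_ & (c & Hc0 & Hck & Hexp) & (w & _ & _ & Hwz & Hpw)).
  exists w.
  assert (Hw1 : forall z, Cmod z < 1 -> Cmod (w z) < 1).
  { intros z Hz. eapply Rle_lt_trans; [now apply Hwz|assumption]. }
  set (D := fun z => (p z + RtoC (1 - 2 * alpha))%C).
  assert (HD : forall z, Cmod z < 1 -> D z = (RtoC (2 * (1 - alpha)) / (1 - w z))%C).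
  { intros z Hz. unfold D. rewrite Hpw by assumption.
    rewrite !RtoC_minus, !RtoC_mult, !RtoC_minus. field. now apply one_minus_nonzero, Hw1. }
  assert (HDm : forall z, Cmod z < 1 -> 1 - alpha <= Cmod (D z)).
  { intros z Hz. rewrite HD by assumption. specialize (Hw1 z Hz).
    assert (N := one_minus_nonzero _ Hw1).
    rewrite Cmod_div, Cmod_R, Rabs_pos_eq by (assumption || lra).
    assert (A := Cmod_minus_le 1 (w z)). rewrite Cmod_1 in A.
    assert (B : 0 < Cmod (1 - w z)) by now apply Cmod_gt_0.
    apply (Rmult_le_reg_r (Cmod (1 - w z))); [assumption|].
    unfold Rdiv. rewrite Rmult_assoc, Rinv_l by lra. nra. }
  assert (HDn : forall z, Cmod z < 1 -> D z <> RtoC 0).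
  { intros z Hz. apply Cmod_gt_0. specialize (HDm z Hz). lra. }
  assert (Hwp : forall z, Cmod z < 1 -> w z = ((p z - 1) / D z)%C).
  { intros z Hz. assert (N := one_minus_nonzero _ (Hw1 z Hz)).
    rewrite HD, Hpw by assumption.
    assert (N2 : RtoC (2 * (1 - alpha)) <> RtoC 0) by (intros E; apply RtoC_inj in E; lra).
    assert (E1 : RtoC (1 - 2 * alpha) = (RtoC (2 * (1 - alpha)) - 1)%C)
      by (rewrite <- RtoC_minus; f_equal; ring).
    rewrite E1. field. split; assumption. }
  assert (HT : forall z, Cmod z < 1 -> exists b c, taylor2 w z b c).
  { intros z Hz. destruct (expansion_taylor2 p c z Hexp Hz) as [c2 Hc2].
    destruct (taylor2_div _ _ _ _ _ _ _
       (taylor2_minus _ _ _ _ _ _ _ Hc2 (taylor2_const 1 z))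
       (taylor2_plus _ _ _ _ _ _ _ Hc2 (taylor2_const (RtoC (1 - 2 * alpha)) z)))
      as [c3 Hc3]; [now apply HDn|].
    do 2 eexists. refine (taylor2_ext _ _ _ _ _ (1 - Cmod z) _ _ Hc3); [lra|].
    intros t Ht. symmetry. apply Hwp. assert (A := Cmod_triangle z t). lra. }
  split; [assumption|]. split; [|split; assumption].
  apply schwarz_order; [assumption|assumption|intros z Hz; left; now apply Hw1|].
  destruct (expansion_order p c n Hexp Hck) as (K & d & HK & Hd & HKd).
  rewrite Hc0 in HKd.
  exists (K * / (1 - alpha)), (Rmin d 1).
  assert (Hia : 0 < / (1 - alpha)) by (apply Rinv_0_lt_compat; lra).
  split; [apply Rmult_le_pos; lra|]. split; [apply Rmin_pos; lra|].
  intros t Ht.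
  assert (T1 := HKd t (Rlt_le_trans _ _ _ Ht (Rmin_l _ _))).
  assert (T2 := Rlt_le_trans _ _ _ Ht (Rmin_r _ _)).
  rewrite Hwp by assumption. rewrite Cmod_div by now apply HDn.
  replace (K * / (1 - alpha) * Cmod t ^ n) with (K * Cmod t ^ n * / (1 - alpha)) by ring.
  apply Rmult_le_compat; [apply Cmod_ge_0| |assumption|].
  - left. apply Rinv_0_lt_compat. apply Cmod_gt_0. now apply HDn.
  - apply Rinv_le_contravar; [lra|]. now apply HDm.
Qed.

Lemma class_P_distance_to_1 (n : nat) (alpha : R) (p : C -> C) (z : C) :
  (1 <= n)%nat -> 0 <= alpha < 1 -> class_P n alpha p -> Cmod z < 1 ->
  Cmod (p z - 1) <= 2 * (1 - alpha) * Cmod z ^ n / (1 - Cmod z ^ n).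
Proof.
  intros Hn Ha Hp Hz.
  destruct (class_P_schwarz n alpha p Hn Ha Hp) as (w & _ & Hw & Hw1 & Hpw).
  specialize (Hw z Hz). specialize (Hw1 z Hz). rewrite Hpw by assumption.
  assert (N := one_minus_nonzero _ Hw1).
  replace ((1 + RtoC (1 - 2 * alpha) * w z) / (1 - w z) - 1)%C
    with (RtoC (2 * (1 - alpha)) * w z / (1 - w z))%C
    by (rewrite !RtoC_minus, !RtoC_mult, !RtoC_minus; field; assumption).
  rewrite Cmod_div, Cmod_mult, Cmod_R, Rabs_pos_eq by (assumption || lra).
  assert (Hs : Cmod z ^ n < 1).
  { rewrite <- Cmod_pow. eapply Rle_lt_trans; [now apply Cmod_pow_le_self|assumption]. }
  assert (A := Cmod_minus_ge 1 (w z)). rewrite Cmod_1 in A.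
  assert (W := Cmod_ge_0 (w z)).
  apply Rmult_le_compat.
  - apply Rmult_le_pos; lra.
  - left. apply Rinv_0_lt_compat. now apply Cmod_gt_0.
  - apply Rmult_le_compat_l; lra.
  - apply Rinv_le_contravar; lra.
Qed.

Lemma class_P0_nonzero (n : nat) (p : C -> C) (z : C) :
  (1 <= n)%nat -> class_P n 0 p -> Cmod z < 1 -> p z <> RtoC 0.
Proof.
  intros Hn Hp Hz E.
  destruct (class_P_schwarz n 0 p Hn ltac:(lra) Hp) as (w & _ & _ & Hw1 & Hpw).
  specialize (Hw1 z Hz). specialize (Hpw z Hz). rewrite E in Hpw.
  assert (N := one_minus_nonzero _ Hw1).
  assert (F : w z = (- (1))%C).
  { replace (w z) with (0 * (1 - w z) - 1
       + ((1 + RtoC (1 - 2 * 0) * w z) - 0 * (1 - w z)))%C.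
    - rewrite Hpw at 2. rewrite Rmult_0_r, Rminus_0_r. field. assumption.
    - rewrite Rmult_0_r, Rminus_0_r. ring. }
  rewrite F, Cmod_m1 in Hw1. lra.
Qed.

(** Since [p = (1 + w) / (1 - w)], one has [z p' / p = 2 z w' / (1 - w ^ 2)]; the bound
    [|1 - w ^ 2| >= 1 - |w| ^ 2] cancels the factor supplied by [schwarz_pick_order]. *)
Lemma class_P0_log_derivative (n : nat) (p : C -> C) (z : C) :
  (1 <= n)%nat -> class_P n 0 p -> Cmod z < 1 ->
  Cmod (z * C_derive p z / p z)%C <= 2 * INR n * Cmod z ^ n / (1 - (Cmod z ^ n) ^ 2).
Proof.
  intros Hn Hp Hz.
  assert (Hs : Cmod z ^ n < 1).
  { rewrite <- Cmod_pow. eapply Rle_lt_trans; [now apply Cmod_pow_le_self|assumption]. }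
  assert (Hs0 : 0 <= Cmod z ^ n) by apply pow_le, Cmod_ge_0.
  assert (Hsq : 0 < 1 - (Cmod z ^ n) ^ 2) by nra.
  assert (Hpz := class_P0_nonzero n p z Hn Hp Hz).
  (* The origin is separate because [schwarz_pick_order] is stated off 0. *)
  destruct (Ceq_dec z (RtoC 0)) as [->|Hz0].
  { replace (0 * C_derive p 0 / p (RtoC 0))%C with (RtoC 0) by (field; assumption).
    rewrite Cmod_0. apply Rmult_le_pos.
    - apply Rmult_le_pos; [|rewrite Cmod_0 in Hs0; assumption].
      assert (Q := pos_INR n). lra.
    - left. apply Rinv_0_lt_compat. rewrite Cmod_0 in Hsq. assumption. }
  destruct (class_P_schwarz n 0 p Hn ltac:(lra) Hp) as (w & HT & Hw & Hw1 & Hpw).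
  destruct (HT z Hz) as (b & c & Hb).
  assert (SP := schwarz_pick_order n w z b c Hn HT Hw Hz Hz0 Hb).
  assert (W1 := Hw1 z Hz). assert (N := one_minus_nonzero _ W1).
  assert (Hbd := taylor2_is_derive _ _ _ _ Hb).
  assert (Hder : C_derive p z = (2 * b / ((1 - w z) * (1 - w z)))%C).
  { apply Cderiv_unique.
    apply (Cderiv_ext_near (fun x => (1 + w x) / (1 - w x))%C _ _ _ (1 - Cmod z)); [lra| |].
    { intros x Hx. rewrite Hpw.
      - rewrite Rmult_0_r, Rminus_0_r, Cmult_1_l. reflexivity.
      - assert (A := Cmod_minus_ge x z). lra. }
    replace (2 * b / ((1 - w z) * (1 - w z)))%C
      with (((0 + b) * (1 - w z) - (1 + w z) * (0 - b)) / ((1 - w z) * (1 - w z)))%C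
      by (field; assumption).
    apply (Cderiv_div (fun x => 1 + w x)%C (fun x => 1 - w x)%C); [| |assumption].
    - apply (Cderiv_plus (fun _ => RtoC 1) w); [apply Cderiv_const|exact Hbd].
    - apply (Cderiv_minus (fun _ => RtoC 1) w); [apply Cderiv_const|exact Hbd]. }
  assert (Hpz2 : p z = ((1 + w z) / (1 - w z))%C).
  { rewrite Hpw, Rmult_0_r, Rminus_0_r, Cmult_1_l by assumption. reflexivity. }
  assert (N2 : (1 + w z)%C <> RtoC 0).
  { intros E. apply Hpz. rewrite Hpz2, E. field. assumption. }
  replace (z * C_derive p z / p z)%C with (2 * (z * b) / (1 - w z * w z))%C.
  2:{ rewrite Hder, Hpz2. field. repeat split; try assumption.
      replace (1 - w z * w z)%C with ((1 - w z) * (1 + w z))%C by ring.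
      now apply Cmult_neq_0. }
  assert (A := Cmod_minus_ge 1 (w z * w z)). rewrite Cmod_1, Cmod_mult in A.
  assert (W := Cmod_ge_0 (w z)).
  assert (B : 0 < 1 - Cmod (w z) ^ 2) by nra.
  assert (N3 : (1 - w z * w z)%C <> RtoC 0) by (apply Cmod_gt_0; simpl in B; lra).
  rewrite Cmod_div, Cmod_mult, Cmod_R, Rabs_pos_eq by (assumption || lra).
  apply Rle_trans with (2 * Cmod (z * b) / (1 - Cmod (w z) ^ 2)).
  - apply Rmult_le_compat_l.
    + apply Rmult_le_pos; [lra|apply Cmod_ge_0].
    + apply Rinv_le_contravar; [assumption|simpl; lra].
  - apply (Rmult_le_reg_r ((1 - Cmod (w z) ^ 2) * (1 - (Cmod z ^ n) ^ 2))).
    { now apply Rmult_lt_0_compat. }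
    replace (2 * Cmod (z * b) / (1 - Cmod (w z) ^ 2) * ((1 - Cmod (w z) ^ 2) * (1 - (Cmod z ^ n) ^ 2)))
      with (2 * (Cmod (z * b) * (1 - (Cmod z ^ n) ^ 2))) by (field; lra).
    replace (2 * INR n * Cmod z ^ n / (1 - (Cmod z ^ n) ^ 2)
              * ((1 - Cmod (w z) ^ 2) * (1 - (Cmod z ^ n) ^ 2)))
      with (2 * (INR n * Cmod z ^ n * (1 - Cmod (w z) ^ 2))) by (field; lra).
    lra.
Qed.

Lemma close_to_starlike_log_derivative (n : nat) (alpha : R) (f : C -> C) :
  (1 <= n)%nat -> 0 <= alpha < 1 -> close_to_starlike n alpha f ->
  exists Q : C -> C, log_derivative f Q /\ Q (RtoC 0) = RtoC 1 /\
    forall z, Cmod z < 1 ->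
    Cmod (Q z - 1) <= (2 * (INR n - alpha + 1) * Cmod z ^ n
                       + 2 * (1 - alpha) * (Cmod z ^ n) ^ 2) / (1 - (Cmod z ^ n) ^ 2).
Proof.
  intros Hn Ha ((Hfa & _) & g & ((Hga & _) & q & (Hqa & Hq) & HqP) & p & (Hpa & Hp) & HpP).
  exists (fun z => q z + z * C_derive p z / p z)%C.
  assert (Hpn : forall z, Cmod z < 1 -> p z <> RtoC 0)
    by (intros z Hz; now apply (class_P0_nonzero n)).
  split; [split|split].
  - intros z Hz. eexists.
    apply (Cderiv_plus q (fun z => z * C_derive p z / p z)%C).
    + now apply analytic_Cderiv.
    + apply (Cderiv_div (fun z => z * C_derive p z)%C p);
        [|now apply analytic_Cderiv|now apply Hpn].
      apply (Cderiv_mult (fun z => z) (C_derive p)); [apply Cderiv_id|].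
      destruct HpP as (_ & (c & _ & _ & Hc) & _).
      apply analytic_Cderiv; [|assumption].
      exact (expansion_analytic _ _ (expansion_C_derive _ _ Hc)).
  - intros z Hz Hz0.
    destruct (Hp z Hz Hz0) as [Hgn Hpz]. destruct (Hq z Hz Hz0) as [_ Hqz].
    assert (Hfz : f z = (p z * g z)%C) by (rewrite Hpz; field; assumption).
    split; [rewrite Hfz; now apply Cmult_neq_0, Hgn; apply Hpn|].
    assert (Hd : C_derive f z = (C_derive p z * g z + p z * C_derive g z)%C).
    { apply Cderiv_unique.
      apply (Cderiv_ext_near (fun x => p x * g x)%C _ _ _ (Rmin (1 - Cmod z) (Cmod z))).
      (* The neighbourhood must avoid 0 as well as the circle: [f = p g] is derived from the
         quotient only on the punctured disc. *)
      - apply Rmin_pos; [unfold in_disc in Hz; lra|now apply Cmod_gt_0].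
      - intros x Hx.
        assert (X1 := Rlt_le_trans _ _ _ Hx (Rmin_l _ _)).
        assert (X2 := Rlt_le_trans _ _ _ Hx (Rmin_r _ _)).
        assert (X3 := Cmod_minus_ge x z).
        destruct (Hp x) as [Hgx Hpx].
        + unfold in_disc. lra.
        + intros ->. replace (0 - z)%C with (- z)%C in X2 by ring.
          rewrite Cmod_opp in X2. lra.
        + rewrite Hpx. field. assumption.
      - apply (Cderiv_mult p g); now apply analytic_Cderiv. }
    rewrite Hd, Hqz, Hfz. field. split; [assumption|now apply Hpn].
  - destruct HqP as (_ & (c & Hc0 & _ & Hc) & _).
    rewrite (expansion_at_0 _ _ Hc), Hc0. field. apply Hpn. rewrite Cmod_0. lra.
  - intros z Hz.
    assert (A := class_P_distance_to_1 n alpha q z Hn Ha HqP Hz).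
    assert (B := class_P0_log_derivative n p z Hn HpP Hz).
    replace (q z + z * C_derive p z / p z - 1)%C
      with ((q z - 1) + z * C_derive p z / p z)%C by ring.
    eapply Rle_trans; [apply Cmod_triangle|].
    assert (Hs : Cmod z ^ n < 1).
    { rewrite <- Cmod_pow. eapply Rle_lt_trans; [now apply Cmod_pow_le_self|assumption]. }
    assert (Hs0 : 0 <= Cmod z ^ n) by apply pow_le, Cmod_ge_0.
    set (s := Cmod z ^ n) in *.
    replace ((2 * (INR n - alpha + 1) * s + 2 * (1 - alpha) * s ^ 2) / (1 - s ^ 2))
      with (2 * (1 - alpha) * s / (1 - s) + 2 * INR n * s / (1 - s ^ 2)); [lra|].
    field. split; nra.
Qed.

Lemma Cmod_real_mult (r : R) (z : C) : 0 <= r -> Cmod (RtoC r * z) = r * Cmod z.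
Proof. intros Hr. rewrite Cmod_mult, Cmod_R, Rabs_pos_eq by assumption. reflexivity. Qed.

Lemma Cderiv_dilation (r : R) (f : C -> C) (z : C) :
  0 < r <= 1 -> analytic f -> Cmod z < 1 ->
  Cderiv (dilation r f) z (C_derive f (RtoC r * z)%C).
Proof.
  intros Hr Hf Hz.
  assert (Nr : RtoC r <> RtoC 0) by (intros E; apply RtoC_inj in E; lra).
  replace (C_derive f (RtoC r * z)%C)
    with (0 * f (RtoC r * z)%C + / RtoC r * ((0 * z + RtoC r * 1) * C_derive f (RtoC r * z)%C))%C
    by (field; assumption).
  apply (Cderiv_mult (fun _ => / RtoC r)%C (fun z => f (RtoC r * z)%C)); [apply Cderiv_const|].
  apply (Cderiv_comp f (fun z => RtoC r * z)%C).
  - apply analytic_Cderiv; [assumption|]. rewrite Cmod_real_mult by lra.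
    assert (A := Cmod_ge_0 z). nra.
  - apply (Cderiv_mult (fun _ => RtoC r) (fun z => z)); [apply Cderiv_const|apply Cderiv_id].
Qed.

Lemma class_A_dilation (n : nat) (r : R) (f : C -> C) :
  0 < r <= 1 -> class_A n f -> class_A n (dilation r f).
Proof.
  intros Hr (Hf & a & Ha0 & Ha1 & Hak & Hexp).
  assert (Nr : RtoC r <> RtoC 0) by (intros E; apply RtoC_inj in E; lra).
  split.
  - intros z Hz. eexists. now apply Cderiv_dilation.
  - exists (fun k => / RtoC r * (a k * RtoC r ^ k))%C. repeat split.
    + rewrite Ha0. ring.
    + rewrite Ha1. simpl. field. assumption.
    + intros k Hk. rewrite Hak by assumption. ring.
    + apply Cseries_has_expansion. intros z Hz. unfold dilation.
      assert (Hrz : Cmod (RtoC r * z) < 1).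
      { rewrite Cmod_real_mult by lra. assert (A := Cmod_ge_0 z). nra. }
      refine (Cseries_ext _ _ _ _
        (Cseries_scal (/ RtoC r) _ _ (has_expansion_Cseries f a _ Hexp Hrz))).
      intros k. rewrite Cpow_mult_l. ring.
Qed.

Lemma log_derivative_dilation (r : R) (f Q : C -> C) :
  0 < r <= 1 -> analytic f -> log_derivative f Q ->
  log_derivative (dilation r f) (fun z => Q (RtoC r * z)%C).
Proof.
  intros Hr Hf (HQ & Hlog).
  assert (Nr : RtoC r <> RtoC 0) by (intros E; apply RtoC_inj in E; lra).
  assert (Hrz : forall z, Cmod z < 1 -> Cmod (RtoC r * z) < 1).
  { intros z Hz. rewrite Cmod_real_mult by lra. assert (A := Cmod_ge_0 z). nra. }
  split.
  - intros z Hz. eexists.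
    apply (Cderiv_comp Q (fun z => RtoC r * z)%C).
    + apply analytic_Cderiv; [assumption|]. now apply Hrz.
    + apply (Cderiv_mult (fun _ => RtoC r) (fun z => z)); [apply Cderiv_const|apply Cderiv_id].
  - intros z Hz Hz0.
    destruct (Hlog (RtoC r * z)%C) as [Hn HQz]; [now apply Hrz|now apply Cmult_neq_0|].
    rewrite (Cderiv_unique _ _ _ (Cderiv_dilation r f z Hr Hf Hz)). unfold dilation.
    split.
    + apply Cmult_neq_0; [|assumption]. intros E. apply Nr.
      replace (RtoC r) with (RtoC r * RtoC r * / RtoC r)%C by (field; assumption).
      rewrite E. ring.
    + rewrite HQz. field. split; assumption.
Qed.

(** The upper bound places [z f' / f - 1] in the disc where [Casinh_Csinh] applies, and it also
    gives [s0 < 1] in [radius_root]. *)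
Lemma arcsinh_1_bounds : 0 < arcsinh 1 <= 1.
Proof.
  assert (A : 0 < arcsinh 1) by (rewrite <- arcsinh_0; apply arcsinh_lt; lra).
  split; [assumption|].
  assert (B := sinh_ge_id (arcsinh 1) ltac:(lra)). rewrite sinh_arcsinh in B. assumption.
Qed.

(* The majorant of [|z f' / f - 1|] vanishes at [0] and is convex in [s], so it
   lies below its chord. *)
Lemma majorant_chord (n : nat) (alpha s s0 a : R) :
  0 <= alpha < 1 -> 0 < s0 < 1 -> 0 <= s <= s0 ->
  2 * (INR n - alpha + 1) * s0 + 2 * (1 - alpha) * s0 ^ 2 = a * (1 - s0 ^ 2) ->
  (2 * (INR n - alpha + 1) * s + 2 * (1 - alpha) * s ^ 2) / (1 - s ^ 2) <= a * (s / s0).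
Proof.
  intros Ha Hs0 Hs E.
  assert (Pn := pos_INR n).
  assert (Hd : 0 < 1 - s ^ 2) by nra. assert (Hd0 : 0 < 1 - s0 ^ 2) by nra.
  apply (Rmult_le_reg_r (s0 * (1 - s ^ 2))); [apply Rmult_lt_0_compat; lra|].
  replace ((2 * (INR n - alpha + 1) * s + 2 * (1 - alpha) * s ^ 2) / (1 - s ^ 2)
     * (s0 * (1 - s ^ 2)))
    with (s * ((2 * (INR n - alpha + 1) + 2 * (1 - alpha) * s) * s0)) by (field; lra).
  replace (a * (s / s0) * (s0 * (1 - s ^ 2))) with (s * (a * (1 - s ^ 2))) by (field; lra).
  apply Rmult_le_compat_l; [lra|].
  set (c := 2 * (INR n - alpha + 1)) in *. set (d := 2 * (1 - alpha)) in *.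
  assert (Hc : 0 <= c) by (unfold c; lra). assert (Hdd : 0 <= d) by (unfold d; lra).
  assert (Hap : 0 <= a).
  { apply (Rmult_le_reg_r (1 - s0 ^ 2)); [assumption|]. rewrite <- E, Rmult_0_l.
    assert (0 <= c * s0) by (apply Rmult_le_pos; lra).
    assert (0 <= d * s0 ^ 2) by (apply Rmult_le_pos; [lra|apply pow2_ge_0]). lra. }
  (* After division by [s], convexity is no longer needed: [(c + d s) s0 <= (c + d s0) s0 = a (1 -
     s0 ^ 2) <= a (1 - s ^ 2)]. *)
  apply Rle_trans with (a * (1 - s0 ^ 2)).
  - rewrite <- E.
    assert (0 <= d * s0 * (s0 - s)) by (apply Rmult_le_pos; [apply Rmult_le_pos|]; lra).
    lra.
  - apply Rmult_le_compat_l; [assumption|]. nra.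
Qed.

Lemma close_to_starlike_dilations (n : nat) (alpha s0 r0 : R) :
  (1 <= n)%nat -> 0 <= alpha < 1 -> 0 < s0 < 1 -> 0 < r0 <= 1 -> r0 ^ n = s0 ->
  2 * (INR n - alpha + 1) * s0 + 2 * (1 - alpha) * s0 ^ 2 = arcsinh 1 * (1 - s0 ^ 2) ->
  dilations_belong (starlike_rho_n n) (close_to_starlike n alpha) r0.
Proof.
  intros Hn Ha Hs0 Hr0 Hr0n E f Hf r Hr.
  destruct (close_to_starlike_log_derivative n alpha f Hn Ha Hf) as (Q & HQ & HQ0 & HQb).
  assert (HfA : class_A n f) by apply Hf.
  assert (Hr1 : 0 < r <= 1) by lra.
  assert (HA := class_A_dilation n r f Hr1 HfA).
  split; [assumption|]. split.
  { destruct HA as (H1 & a & A0 & A1 & _ & A3). split; [assumption|].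
    exists a. split; [assumption|]. split; [assumption|]. split; [lia|assumption]. }
  exists (fun z => Q (RtoC r * z)%C).
  assert (HL := log_derivative_dilation r f Q Hr1 (proj1 HfA) HQ).
  split; [assumption|].
  destruct arcsinh_1_bounds as [Ap A1].
  assert (Hv : forall z, Cmod z < 1 ->
     Cmod (Q (RtoC r * z)%C - 1) <= arcsinh 1 * Cmod z).
  { intros z Hz. assert (Pz := Cmod_ge_0 z).
    assert (Hm := Cmod_real_mult r z ltac:(lra)).
    assert (Hrz : Cmod (RtoC r * z) < 1) by (rewrite Hm; nra).
    eapply Rle_trans; [now apply HQb|].
    assert (Hzn := Cmod_pow_le_self n z Hn Hz). rewrite Cmod_pow in Hzn.
    assert (Pzn : 0 <= Cmod z ^ n) by now apply pow_le.
    assert (Hrn : 0 <= r ^ n <= s0).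
    { split; [apply pow_le; lra|]. rewrite <- Hr0n. apply pow_incr. lra. }
    assert (Hs : Cmod (RtoC r * z) ^ n = r ^ n * Cmod z ^ n)
      by (rewrite Hm; apply Rpow_mult_distr).
    (* Using [|z| ^ n <= |z|] turns the chord bound into one linear in [|z|]. *)
    assert (Hss : 0 <= Cmod (RtoC r * z) ^ n <= s0 * Cmod z).
    { rewrite Hs. split; [apply Rmult_le_pos; lra|]. apply Rmult_le_compat; lra. }
    eapply Rle_trans.
    { apply (majorant_chord n alpha _ s0 (arcsinh 1)); try assumption. nra. }
    apply Rmult_le_compat_l; [lra|].
    apply (Rmult_le_reg_r s0); [lra|]. unfold Rdiv. rewrite Rmult_assoc, Rinv_l; lra. }
  exists (fun z => Csinh (Q (RtoC r * z)%C - 1)%C). split; [|split; [|split]].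
  - intros z Hz. eexists.
    apply (Cderiv_comp Csinh (fun z => Q (RtoC r * z) - 1)%C); [apply Cderiv_Csinh|].
    apply (Cderiv_minus (fun z => Q (RtoC r * z)%C) (fun _ => RtoC 1)); [|apply Cderiv_const].
    apply (analytic_Cderiv (fun z => Q (RtoC r * z)%C)); [apply HL|assumption].
  - replace (RtoC r * RtoC 0)%C with (RtoC 0) by ring. rewrite HQ0.
    replace (1 - 1)%C with (RtoC 0) by ring. apply Csinh_0.
  - intros z Hz. specialize (Hv z Hz). assert (Pz := Cmod_ge_0 z).
    eapply Rle_trans; [apply Cmod_Csinh_le|].
    (* The chord of [sinh] over [[0, arcsinh 1]] gives [|w z| <= |z|] directly, without Schwarz's
       lemma for [w]. *)
    apply Rle_trans with (sinh (arcsinh 1 * Cmod z)).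
    { destruct Hv as [L| ->]; [left; now apply sinh_lt|lra]. }
    rewrite <- (Rmult_1_r (Cmod z)) at 2. rewrite <- (sinh_arcsinh 1) at 2.
    apply sinh_chord; unfold in_disc in Hz; lra.
  - intros z Hz. specialize (Hv z Hz). unfold in_disc in Hz.
    rewrite Casinh_Csinh; [ring|]. assert (Pz := Cmod_ge_0 z). nra.
Qed.

(** * The extremal function *)

Lemma Cseries_geom (x : C) : Cmod x < 1 -> Cseries (fun k => x ^ k)%C (/ (1 - x))%C.
Proof.
  intros Hx.
  destruct (Cseries_exists (fun k => x ^ k)%C (fun k => Cmod x ^ k)) as [l Hl].
  { intros k. rewrite Cmod_pow. lra. }
  { eexists. apply is_series_geom. rewrite Rabs_pos_eq; [assumption|apply Cmod_ge_0]. }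
  assert (N := one_minus_nonzero x Hx).
  assert (E : (l - x ^ 0)%C = (x * l)%C).
  { apply (Cseries_unique (fun k => x ^ S k)%C).
    - exact (Cseries_shift _ _ Hl).
    - exact (Cseries_scal x _ _ Hl). }
  replace (/ (1 - x))%C with l; [assumption|].
  assert (F : (l * (1 - x))%C = RtoC 1).
  { replace (l * (1 - x))%C with ((l - x ^ 0) + 1 - x * l)%C by (simpl; ring).
    rewrite E. ring. }
  replace l with (l * (1 - x) * / (1 - x))%C by (field; assumption).
  rewrite F. ring.
Qed.

(** Coefficients of [F (z ^ n)] when [u] are those of [F]. *)
Definition sparse (n : nat) (u : nat -> C) (m : nat) : C :=
  if (m mod n =? 0)%nat then u (m / n)%nat else RtoC 0.

Lemma sum_n_sparse (n : nat) (u : nat -> C) (m : nat) :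
  (1 <= n)%nat ->
  sum_n (sparse n u : nat -> C_NormedModule) m = sum_n (u : nat -> C_NormedModule) (m / n)%nat.
Proof.
  intros Hn. induction m as [|m IH].
  - rewrite Nat.Div0.div_0_l, !sum_O. unfold sparse.
    rewrite Nat.Div0.mod_0_l, Nat.Div0.div_0_l. reflexivity.
  - rewrite sum_Sn, IH.
    assert (E := Nat.div_mod (S m) n ltac:(lia)).
    assert (L := Nat.mod_upper_bound (S m) n ltac:(lia)).
    unfold sparse. destruct (Nat.eqb_spec (S m mod n) 0) as [E0|E0].
    + assert (Q : (m / n = pred (S m / n))%nat).
      { rewrite E0 in E. destruct (S m / n)%nat as [|j] eqn:F; [lia|].
        simpl pred. symmetry. apply (Nat.div_unique m n j (n - 1)); nia. }
      destruct (S m / n)%nat as [|j] eqn:F; [lia|].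
      rewrite Q. simpl pred. now rewrite sum_Sn.
    + assert (Q : (m / n = S m / n)%nat).
      { symmetry. apply (Nat.div_unique m n (S m / n) (pred (S m mod n))); lia. }
      rewrite Q. apply (@plus_zero_r C_NormedModule).
Qed.

(** The partial sums are those of [u] precomposed with [m / n], which tends to infinity. *)
Lemma Cseries_sparse (n : nat) (u : nat -> C) (l : C) :
  (1 <= n)%nat -> Cseries u l -> Cseries (sparse n u) l.
Proof.
  intros Hn H.
  apply (filterlim_ext (fun m => sum_n (u : nat -> C_NormedModule) (m / n)%nat)).
  { intros m. symmetry. now apply sum_n_sparse. }
  apply (filterlim_comp _ _ _ (fun m => (m / n)%nat) (sum_n (u : nat -> C_NormedModule))
           _ eventually); [|exact H].
  intros P [N HN]. exists (N * n)%nat. intros m Hm. apply HN.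
  apply Nat.div_le_lower_bound; lia.
Qed.

Lemma expansion_comp_pow (n : nat) (F : C -> C) (a : nat -> C) :
  (1 <= n)%nat -> has_expansion F a -> has_expansion (fun z => F (z ^ n)%C) (sparse n a).
Proof.
  intros Hn HF. apply Cseries_has_expansion. intros z Hz.
  assert (Hzn : Cmod (z ^ n) < 1)
    by (eapply Rle_lt_trans; [now apply Cmod_pow_le_self|assumption]).
  refine (Cseries_ext _ _ _ _ (Cseries_sparse n _ _ Hn (has_expansion_Cseries F a _ HF Hzn))).
  intros m. unfold sparse. destruct (Nat.eqb_spec (m mod n) 0) as [E|E]; [|ring].
  rewrite <- Cpow_mult_r. f_equal. f_equal.
  assert (D := Nat.div_mod m n ltac:(lia)). lia.
Qed.

Definition shift_coef (a : nat -> C) (k : nat) : C :=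
  match k with O => RtoC 0 | S j => a j end.

Lemma expansion_mult_id (F : C -> C) (a : nat -> C) :
  has_expansion F a -> has_expansion (fun z => z * F z)%C (shift_coef a).
Proof.
  intros HF. apply Cseries_has_expansion. intros z Hz.
  replace (z * F z)%C with (z * F z + shift_coef a 0 * z ^ 0)%C by (simpl; ring).
  apply (Cseries_unshift (fun k => shift_coef a k * z ^ k)%C).
  refine (Cseries_ext _ _ _ _ (Cseries_scal z _ _ (has_expansion_Cseries F a z HF Hz))).
  intros k. simpl. ring.
Qed.

Lemma expansion_plus (F G : C -> C) (a b : nat -> C) :
  has_expansion F a -> has_expansion G b ->
  has_expansion (fun z => F z + G z)%C (fun k => a k + b k)%C.
Proof.
  intros HF HG. apply Cseries_has_expansion. intros z Hz.
  refine (Cseries_ext _ _ _ _ (Cseries_plus _ _ _ _ (has_expansion_Cseries F a z HF Hz)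
    (has_expansion_Cseries G b z HG Hz))).
  intros k. simpl. ring.
Qed.

Lemma expansion_scal (c : C) (F : C -> C) (a : nat -> C) :
  has_expansion F a -> has_expansion (fun z => c * F z)%C (fun k => c * a k)%C.
Proof.
  intros HF. apply Cseries_has_expansion. intros z Hz.
  refine (Cseries_ext _ _ _ _ (Cseries_scal c _ _ (has_expansion_Cseries F a z HF Hz))).
  intros k. simpl. ring.
Qed.

Lemma expansion_ext (F G : C -> C) (a b : nat -> C) :
  (forall z, Cmod z < 1 -> F z = G z) -> (forall k, a k = b k) ->
  has_expansion F a -> has_expansion G b.
Proof.
  intros HFG Hab HF. apply Cseries_has_expansion. intros z Hz. rewrite <- HFG by assumption.
  refine (Cseries_ext _ _ _ _ (has_expansion_Cseries F a z HF Hz)).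
  intros k. simpl. now rewrite Hab.
Qed.

Lemma sparse_0 (n : nat) (a : nat -> C) : sparse n a 0 = a O.
Proof.
  unfold sparse. now rewrite Nat.Div0.mod_0_l, Nat.Div0.div_0_l.
Qed.

Lemma sparse_gap (n : nat) (a : nat -> C) (k : nat) : (1 <= k < n)%nat -> sparse n a k = RtoC 0.
Proof.
  intros Hk. unfold sparse. rewrite Nat.mod_small by lia.
  destruct (Nat.eqb_spec k 0); [lia|reflexivity].
Qed.

Lemma class_A_of_pow (n : nat) (F : C -> C) (a : nat -> C) :
  (1 <= n)%nat -> has_expansion F a -> a O = RtoC 1 ->
  class_A n (fun z => z * F (z ^ n))%C.
Proof.
  intros Hn HF Ha.
  assert (H := expansion_mult_id _ _ (expansion_comp_pow n F a Hn HF)).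
  split; [exact (expansion_analytic _ _ H)|].
  exists (shift_coef (sparse n a)). repeat split; [|intros k Hk|exact H].
  - simpl. now rewrite sparse_0.
  - destruct k as [|k]; [lia|]. apply sparse_gap. lia.
Qed.

Definition half_plane_map (alpha : R) (x : C) : C :=
  ((1 + RtoC (1 - 2 * alpha) * x) / (1 - x))%C.

Lemma half_plane_map_expansion (alpha : R) :
  has_expansion (half_plane_map alpha)
    (fun k => match k with O => RtoC 1 | S _ => RtoC (2 * (1 - alpha)) end).
Proof.
  assert (Hg : has_expansion (fun x => / (1 - x))%C (fun _ => RtoC 1)).
  { apply Cseries_has_expansion. intros z Hz.
    refine (Cseries_ext _ _ _ _ (Cseries_geom z Hz)). intros k. ring. }
  assert (H1 := expansion_scal (RtoC (2 * (1 - alpha))) _ _ (expansion_mult_id _ _ Hg)).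
  (* The constant is expanded as [1 / (1 - x) - x / (1 - x)]. *)
  assert (H0 : has_expansion (fun _ => RtoC 1)
            (fun k => match k with O => RtoC 1 | S _ => RtoC 0 end)).
  { refine (expansion_ext _ _ _ _ _ _ (expansion_plus _ _ _ _ Hg
      (expansion_scal (RtoC (-1)) _ _ (expansion_mult_id _ _ Hg)))).
    - intros z Hz. simpl. replace (RtoC (-1)) with (- (1))%C
        by (apply injective_projections; simpl; ring).
      field. now apply one_minus_nonzero.
    - intros [|k]; apply injective_projections; simpl; ring. }
  refine (expansion_ext _ _ _ _ _ _ (expansion_plus _ _ _ _ H0 H1)).
  - intros z Hz. unfold half_plane_map. simpl.
    replace (RtoC (1 - 2 * alpha)) with (RtoC (2 * (1 - alpha)) - 1)%C
      by (rewrite <- RtoC_minus; f_equal; ring).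
    field. now apply one_minus_nonzero.
  - intros [|k]; simpl; ring.
Qed.

Lemma half_plane_map_pow_class_P (n : nat) (alpha : R) :
  (1 <= n)%nat -> class_P n alpha (fun z => half_plane_map alpha (z ^ n)%C).
Proof.
  intros Hn.
  assert (H := expansion_comp_pow n _ _ Hn (half_plane_map_expansion alpha)).
  split; [exact (expansion_analytic _ _ H)|]. split.
  - eexists. split; [|split; [|exact H]].
    + apply sparse_0.
    + intros k Hk. now apply sparse_gap.
  - exists (fun z => z ^ n)%C. repeat split.
    + intros z Hz. eexists. apply Cderiv_pow.
    + destruct n as [|n]; [lia|]. simpl. ring.
    + intros z Hz. now apply Cmod_pow_le_self.
Qed.

(* Coefficients of [(1 - x) ^ (- gam)]. *)
Fixpoint binomial_coef (gam : R) (k : nat) : R :=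
  match k with
  | O => 1
  | S j => (INR j + gam) / (INR j + 1) * binomial_coef gam j
  end.

(** The upper bound is the coefficient for [gam = 3], the largest exponent that occurs. *)
Lemma binomial_coef_bound (gam : R) (k : nat) :
  1 <= gam <= 3 -> 0 <= binomial_coef gam k <= (INR k + 1) * (INR k + 2) / 2.
Proof.
  intros Hg. induction k as [|k IH]; [simpl; lra|].
  assert (Pk := pos_INR k). rewrite S_INR. simpl binomial_coef.
  assert (Hd : 0 <= (INR k + gam) / (INR k + 1)).
  { apply Rmult_le_pos; [lra|]. left. apply Rinv_0_lt_compat. lra. }
  split; [apply Rmult_le_pos; lra|].
  apply Rle_trans with ((INR k + 3) / (INR k + 1) * ((INR k + 1) * (INR k + 2) / 2)).
  - apply Rmult_le_compat; try lra. apply Rmult_le_compat_r; [|lra].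
    left. apply Rinv_0_lt_compat. lra.
  - right. field. lra.
Qed.

Lemma binomial_function_exists (gam : R) :
  1 <= gam <= 3 -> exists G : C -> C, has_expansion G (fun k => RtoC (binomial_coef gam k)).
Proof.
  intros Hg.
  assert (Hgeo : has_expansion (fun x => / (1 - x))%C (fun _ => RtoC 1)).
  { apply Cseries_has_expansion. intros z Hz.
    refine (Cseries_ext _ _ _ _ (Cseries_geom z Hz)). intros k. ring. }
  (* The condition sits under the existential so that choice yields a total function. *)
  assert (Hex : forall z, exists l, Cmod z < 1 ->
     Cseries (fun k => RtoC (binomial_coef gam k) * z ^ k)%C l).
  { intros z. destruct (Rlt_dec (Cmod z) 1) as [Hz|Hz]; [|exists (RtoC 0); tauto].
    set (x := (1 + Cmod z) / 2). assert (Pz := Cmod_ge_0 z).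
    destruct (coefficients_cubic_bound _ _ x Hgeo) as (M & q & HM & Hq & HMk);
      [unfold x; lra|].
    destruct (Cseries_exists (fun k => RtoC (binomial_coef gam k) * z ^ k)%C
       (fun k => 3 * M * q ^ k)) as [l Hl].
    - intros k. destruct (binomial_coef_bound gam k Hg) as [B0 B].
      rewrite Cmod_mult, Cmod_R, Cmod_pow, Rabs_pos_eq by assumption.
      specialize (HMk k). rewrite Cmod_1, Rmult_1_l in HMk.
      assert (Pk := pos_INR k).
      assert (Pzk : 0 <= Cmod z ^ k) by now apply pow_le.
      assert (Hzx : Cmod z ^ k <= x ^ k) by (apply pow_incr; unfold x; lra).
      assert (B2 : (INR k + 1) * (INR k + 2) / 2 <= 3 * (INR k ^ 3 + 1)).
      { assert (0 <= (INR k - 1) ^ 2 * (INR k + 2)) by (apply Rmult_le_pos; [apply pow2_ge_0|lra]).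
        assert (0 <= (INR k - 1) ^ 2 * (INR k + 1)) by (apply Rmult_le_pos; [apply pow2_ge_0|lra]).
        simpl in *. nra. }
      apply Rle_trans with (3 * (INR k ^ 3 + 1) * x ^ k); [|lra].
      apply Rmult_le_compat; lra.
    - eexists. apply is_series_geom_scal. exact Hq.
    - exists l. intros _. exact Hl. }
  exists (fun z => proj1_sig (constructive_indefinite_description _ (Hex z))).
  apply Cseries_has_expansion. intros z Hz.
  destruct (constructive_indefinite_description _ (Hex z)) as [l Hl]. simpl. auto.
Qed.

(** On coefficients this reads [(k + 1) b_(k+1) - k b_k = gam b_k], the recursion defining
    [binomial_coef]. *)
Lemma binomial_function_ode (gam : R) (G : C -> C) (x : C) :
  has_expansion G (fun k => RtoC (binomial_coef gam k)) -> Cmod x < 1 ->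
  ((1 - x) * C_derive G x)%C = (RtoC gam * G x)%C.
Proof.
  intros HG Hx.
  assert (HG' := expansion_C_derive _ _ HG).
  apply (Cseries_unique (fun k => RtoC gam * (RtoC (binomial_coef gam k) * x ^ k))%C).
  - assert (H1 := has_expansion_Cseries _ _ x HG' Hx).
    assert (H2 := has_expansion_Cseries _ _ x (expansion_mult_id _ _ HG') Hx).
    replace ((1 - x) * C_derive G x)%C with (C_derive G x - x * C_derive G x)%C by ring.
    refine (Cseries_ext _ _ _ _ (Cseries_minus _ _ _ _ H1 H2)).
    intros k.
    assert (E : (RtoC (INR (S k)) * RtoC (binomial_coef gam (S k)))%C
              = ((RtoC (INR k) + RtoC gam) * RtoC (binomial_coef gam k))%C).
    { rewrite <- RtoC_plus, <- !RtoC_mult. apply f_equal.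
      rewrite S_INR. simpl binomial_coef.
      assert (P := pos_INR k). field. lra. }
    rewrite E. destruct k as [|k]; unfold shift_coef; [simpl INR|]; ring.
  - apply Cseries_scal. now apply has_expansion_Cseries.
Qed.

(** With [A] the first-order approximation of [G] at parameter [t + h], [|A| ^ 2] is a quadratic in
    [h] with the claimed linear coefficient; replacing [A] by [G] costs [O(h ^ 2)]. *)
Lemma derivable_sq_modulus_on_ray (G : C -> C) (x b c : C) (t : R) :
  taylor2 G (RtoC t * x)%C b c ->
  derivable_pt_lim (fun s => Cmod (G (RtoC s * x)%C) ^ 2) t
    (2 * Re (Cconj (G (RtoC t * x)%C) * (b * x))%C).
Proof.
  intros HT. destruct (taylor2_order1 _ _ _ _ HT) as (K & d & HK & Hd & HKd).
  set (g := G (RtoC t * x)%C) in *. set (X := Cmod x).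
  assert (HX : 0 <= X) by apply Cmod_ge_0.
  set (m := Cmod g). assert (Hm : 0 <= m) by apply Cmod_ge_0.
  set (p := Cmod (b * x)). assert (Hp : 0 <= p) by apply Cmod_ge_0.
  set (L := K * X ^ 2). assert (HL : 0 <= L) by (apply Rmult_le_pos; [assumption|apply pow2_ge_0]).
  (* For [|h| <= 1] the total error is at most [(T - 1) h ^ 2]; the added 1 keeps [T] positive. *)
  set (T := p ^ 2 + 2 * L * (m + p) + L ^ 2 + 1).
  assert (HT0 : 0 < T).
  { assert (0 <= L * (m + p)) by (apply Rmult_le_pos; lra).
    assert (A := pow2_ge_0 p). assert (A2 := pow2_ge_0 L). unfold T. lra. }
  intros eps Heps.
  assert (He : 0 < Rmin (Rmin 1 (d / (X + 1))) (eps / T)).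
  { apply Rmin_pos; [apply Rmin_pos; [lra|]|]; apply Rdiv_lt_0_compat; lra. }
  exists (mkposreal _ He). intros h Hh0 Hh. simpl in Hh.
  assert (H1 := Rlt_le_trans _ _ _ Hh (Rle_trans _ _ _ (Rmin_l _ _) (Rmin_l _ _))).
  assert (H2 := Rlt_le_trans _ _ _ Hh (Rle_trans _ _ _ (Rmin_l _ _) (Rmin_r _ _))).
  assert (H3 := Rlt_le_trans _ _ _ Hh (Rmin_r _ _)).
  set (u := Rabs h) in *. assert (Hu : 0 < u) by now apply Rabs_pos_lt.
  assert (Hhx : Cmod (RtoC h * x) = u * X) by (rewrite Cmod_mult, Cmod_R; reflexivity).
  assert (Hhd : Cmod (RtoC h * x) < d).
  { rewrite Hhx. apply (Rmult_lt_compat_r (X + 1)) in H2; [|lra].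
    unfold Rdiv in H2. rewrite Rmult_assoc, Rinv_l in H2 by lra. nra. }
  specialize (HKd _ Hhd). rewrite Hhx in HKd.
  replace (RtoC t * x + RtoC h * x)%C with (RtoC (t + h) * x)%C in HKd
    by (rewrite RtoC_plus; ring).
  set (g' := G (RtoC (t + h) * x)%C) in *.
  set (A := (g + b * (RtoC h * x))%C) in *.
  assert (HA : Cmod A ^ 2 = m ^ 2 + 2 * h * Re (Cconj g * (b * x))%C + h ^ 2 * p ^ 2).
  { unfold A, m, p. rewrite !Cmod_sq. destruct g, b, x. simpl. ring. }
  assert (HAm : Cmod A <= m + p).
  { unfold A. eapply Rle_trans; [apply Cmod_triangle|]. apply Rplus_le_compat_l.
    replace (b * (RtoC h * x))%C with (RtoC h * (b * x))%C by ring.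
    rewrite Cmod_mult, Cmod_R. fold u p. nra. }
  assert (HK2 : Cmod (g' - A) <= L * u ^ 2).
  { eapply Rle_trans; [exact HKd|]. unfold L. right. ring. }
  assert (D1 := Cmod_minus_ge g' A). assert (D2 := Cmod_minus_ge A g').
  rewrite Cmod_minus_sym in D2.
  assert (PA := Cmod_ge_0 A). assert (Pg := Cmod_ge_0 g').
  set (v := L * u ^ 2) in *.
  assert (Hv : 0 <= v) by (apply Rmult_le_pos; [assumption|apply pow2_ge_0]).
  assert (B1 : Rabs (Cmod g' ^ 2 - Cmod A ^ 2) <= v * (2 * (m + p) + v)).
  { replace (Cmod g' ^ 2 - Cmod A ^ 2) with ((Cmod g' - Cmod A) * (Cmod g' + Cmod A)) by ring.
    rewrite Rabs_mult. apply Rmult_le_compat; try apply Rabs_pos.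
    - apply Rabs_le. lra.
    - rewrite Rabs_pos_eq; lra. }
  assert (B2 : Rabs (Cmod g' ^ 2 - m ^ 2 - h * (2 * Re (Cconj g * (b * x))%C)) <= u ^ 2 * (T - 1)).
  { replace (Cmod g' ^ 2 - m ^ 2 - h * (2 * Re (Cconj g * (b * x))%C))
      with ((Cmod g' ^ 2 - Cmod A ^ 2) + h ^ 2 * p ^ 2) by (rewrite HA; ring).
    eapply Rle_trans; [apply Rabs_triang|].
    rewrite <- (pow2_abs h). fold u.
    assert (P1 := pow2_ge_0 u). assert (P2 := pow2_ge_0 p).
    rewrite (Rabs_pos_eq (u ^ 2 * p ^ 2)) by now apply Rmult_le_pos.
    assert (Hu2 : u ^ 2 <= 1) by nra.
    assert (v * v <= u ^ 2 * L ^ 2).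
    { replace (v * v) with (u ^ 2 * (u ^ 2 * L ^ 2)) by (unfold v; ring).
      apply Rmult_le_compat_l; [assumption|]. assert (Q := pow2_ge_0 L). nra. }
    unfold T. replace (u ^ 2 * (p ^ 2 + 2 * L * (m + p) + L ^ 2 + 1 - 1))
      with (u ^ 2 * p ^ 2 + v * (2 * (m + p)) + u ^ 2 * L ^ 2) by (unfold v; ring).
    nra. }
  fold g. fold m.
  replace ((Cmod g' ^ 2 - m ^ 2) / h - 2 * Re (Cconj g * (b * x))%C)
    with ((Cmod g' ^ 2 - m ^ 2 - h * (2 * Re (Cconj g * (b * x))%C)) / h) by (field; assumption).
  unfold Rdiv. rewrite Rabs_mult, Rabs_inv. fold u.
  apply (Rmult_lt_reg_r u); [assumption|]. rewrite Rmult_assoc, Rinv_l, Rmult_1_r by lra.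
  eapply Rle_lt_trans; [exact B2|].
  apply (Rmult_lt_compat_r T) in H3; [|assumption].
  unfold Rdiv in H3. rewrite Rmult_assoc, Rinv_l, Rmult_1_r in H3 by lra.
  nra.
Qed.

(* Along a ray, [|G| ^ 2 * exp (2 k t)] is nondecreasing as soon as [|x G'| <= k |G|]. *)
Lemma binomial_function_nonzero (gam : R) (G : C -> C) (x : C) :
  0 <= gam -> has_expansion G (fun k => RtoC (binomial_coef gam k)) -> Cmod x < 1 ->
  G x <> RtoC 0.
Proof.
  intros Hg HG Hx E.
  assert (PX := Cmod_ge_0 x). set (X := Cmod x) in *.
  (* The differential equation and [|1 - t x| >= 1 - X] bound [|G'|] by [k |G|] along the
     segment. *)
  set (k := gam / (1 - X)).
  set (phi := fun s => Cmod (G (RtoC s * x)%C) ^ 2).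
  set (dphi := fun t => 2 * Re (Cconj (G (RtoC t * x)%C) * (C_derive G (RtoC t * x)%C * x))%C).
  assert (Hm : forall t, 0 <= t <= 1 -> Cmod (RtoC t * x) <= X).
  { intros t Ht. rewrite Cmod_real_mult by lra. fold X. nra. }
  assert (Hphi : forall t, 0 <= t <= 1 -> derivable_pt_lim phi t (dphi t)).
  { intros t Ht. specialize (Hm t Ht).
    destruct (expansion_taylor2 G _ (RtoC t * x)%C HG ltac:(lra)) as [c Hc].
    exact (derivable_sq_modulus_on_ray G x _ c t Hc). }
  assert (Hdphi : forall t, 0 <= t <= 1 -> 0 <= dphi t + 2 * k * phi t).
  { intros t Ht. specialize (Hm t Ht). unfold dphi, phi.
    set (y := (RtoC t * x)%C) in *.
    assert (O := binomial_function_ode gam G y HG ltac:(lra)).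
    assert (A := re_le_Cmod (Cconj (G y) * (C_derive G y * x))%C).
    apply Rabs_le_between in A.
    rewrite !Cmod_mult, Cmod_conj in A. fold X in A.
    apply (f_equal Cmod) in O. rewrite !Cmod_mult, Cmod_R, Rabs_pos_eq in O by assumption.
    assert (B := Cmod_minus_ge 1 y). rewrite Cmod_1 in B.
    assert (Pd := Cmod_ge_0 (C_derive G y)). assert (PG := Cmod_ge_0 (G y)).
    assert (D : Cmod (C_derive G y) <= k * Cmod (G y)).
    { apply (Rmult_le_reg_l (1 - X)); [lra|]. unfold k.
      replace ((1 - X) * (gam / (1 - X) * Cmod (G y))) with (gam * Cmod (G y)) by (field; lra).
      rewrite <- O. apply Rmult_le_compat_r; lra. }
    assert (F : Cmod (G y) * (Cmod (C_derive G y) * X) <= Cmod (G y) * (k * Cmod (G y))).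
    { apply Rmult_le_compat_l; [assumption|]. nra. }
    replace (2 * k * Cmod (G y) ^ 2) with (2 * (Cmod (G y) * (k * Cmod (G y)))) by ring.
    lra. }
  destruct (MVT_cor2 (fun s => phi s * exp (2 * k * s))
    (fun s => dphi s * exp (2 * k * s) + phi s * (exp (2 * k * s) * (2 * k * 1))) 0 1 Rlt_0_1)
    as (c & Hc & Hc01).
  { intros s Hs.
    apply (derivable_pt_lim_mult phi (fun s => exp (2 * k * s))); [now apply Hphi|].
    apply (derivable_pt_lim_comp (fun s => 2 * k * s) exp).
    - apply (derivable_pt_lim_scal (fun s => s) (2 * k)). apply derivable_pt_lim_id.
    - apply derivable_pt_lim_exp. }
  assert (P0 : phi 0 = 1).
  { unfold phi. replace (RtoC 0 * x)%C with (RtoC 0) by ring.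
    rewrite (expansion_at_0 _ _ HG). simpl. rewrite Cmod_1. ring. }
  assert (P1 : phi 1 = 0).
  { unfold phi. rewrite Cmult_1_l, E, Cmod_0. ring. }
  rewrite P0, P1, Rmult_0_r, exp_0 in Hc.
  specialize (Hdphi c ltac:(lra)). assert (Pe := exp_pos (2 * k * c)).
  nra.
Qed.

(** One formula serves both the extremal function ([sgn = 1]) and its starlike companion
    ([sgn = -1]). *)
Lemma Cderiv_extremal_factor (n : nat) (sgn : R) (G : C -> C) (z : C) :
  (1 <= n)%nat -> analytic G -> Cmod z < 1 ->
  Cderiv (fun z => z * ((1 + RtoC sgn * z ^ n) * G (z ^ n)))%C z
    ((1 + RtoC sgn * z ^ n) * G (z ^ n)
     + INR n * z ^ n * (RtoC sgn * G (z ^ n) + (1 + RtoC sgn * z ^ n) * C_derive G (z ^ n)))%C.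
Proof.
  intros Hn HG Hz.
  assert (Hzn : Cmod (z ^ n) < 1)
    by (eapply Rle_lt_trans; [now apply Cmod_pow_le_self|assumption]).
  replace ((1 + RtoC sgn * z ^ n) * G (z ^ n)
     + INR n * z ^ n * (RtoC sgn * G (z ^ n) + (1 + RtoC sgn * z ^ n) * C_derive G (z ^ n)))%C
    with (1 * ((1 + RtoC sgn * z ^ n) * G (z ^ n))
     + z * ((0 + (0 * z ^ n + RtoC sgn * (INR n * z ^ pred n))) * G (z ^ n)
       + (1 + RtoC sgn * z ^ n) * (INR n * z ^ pred n * C_derive G (z ^ n))))%C.
  2:{ destruct n as [|n]; [lia|]. simpl pred. rewrite Cpow_S. ring. }
  apply (Cderiv_mult (fun z => z) (fun z => (1 + RtoC sgn * z ^ n) * G (z ^ n))%C);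
    [apply Cderiv_id|].
  apply (Cderiv_mult (fun z => 1 + RtoC sgn * z ^ n)%C (fun z => G (z ^ n)%C)).
  - apply (Cderiv_plus (fun _ => RtoC 1) (fun z => RtoC sgn * z ^ n)%C); [apply Cderiv_const|].
    apply (Cderiv_mult (fun _ => RtoC sgn) (fun z => z ^ n)%C);
      [apply Cderiv_const|apply Cderiv_pow].
  - apply (Cderiv_comp G (fun z => z ^ n)%C); [now apply analytic_Cderiv|apply Cderiv_pow].
Qed.

Lemma class_A_extremal_factor (n : nat) (sgn gam : R) (G : C -> C) :
  (1 <= n)%nat -> has_expansion G (fun k => RtoC (binomial_coef gam k)) ->
  class_A n (fun z => z * ((1 + RtoC sgn * z ^ n) * G (z ^ n)))%C.
Proof.
  intros Hn HG.
  assert (H := expansion_plus _ _ _ _ HG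
    (expansion_scal (RtoC sgn) _ _ (expansion_mult_id _ _ HG))).
  refine (class_A_of_pow n (fun x => (1 + RtoC sgn * x) * G x)%C _ Hn
    (expansion_ext _ _ _ _ _ (fun k => eq_refl) H) _).
  - intros z Hz. ring.
  - simpl. ring.
Qed.

Lemma one_plus_nonzero (w : C) : Cmod w < 1 -> (1 + w)%C <> RtoC 0.
Proof.
  intros H E. apply (one_minus_nonzero (- w)%C); [now rewrite Cmod_opp|].
  rewrite <- E. ring.
Qed.

(** The companion is [g = z (1 - z ^ n) ^ (1 - gam)]. The choice of [gam] makes [z g' / g] the
    half-plane map of order [alpha] at [z ^ n], and [f / g] is the one of order 0. *)
Lemma extremal_function (n : nat) (alpha : R) :
  (1 <= n)%nat -> 0 <= alpha < 1 ->
  exists f, close_to_starlike n alpha f /\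
    forall z, Cmod z < 1 -> z <> RtoC 0 ->
      (z * C_derive f z / f z)%C
      = (1 + INR n * z ^ n / (1 + z ^ n)
           + RtoC (INR n + 2 * (1 - alpha)) * z ^ n / (1 - z ^ n))%C.
Proof.
  intros Hn Ha.
  assert (Hn0 : 1 <= INR n) by (apply (le_INR 1); assumption).
  set (gam := 1 + 2 * (1 - alpha) / INR n).
  assert (Hi : 0 < / INR n <= 1).
  { split; [apply Rinv_0_lt_compat; lra|]. rewrite <- Rinv_1. apply Rinv_le_contravar; lra. }
  assert (Hg : 1 <= gam <= 3) by (unfold gam, Rdiv; nra).
  assert (Hng : (RtoC (INR n) * RtoC gam)%C = RtoC (INR n + 2 * (1 - alpha))).
  { rewrite <- RtoC_mult. f_equal. unfold gam. field. lra. }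
  destruct (binomial_function_exists gam Hg) as [G HG].
  assert (HGa := expansion_analytic _ _ HG).
  assert (HGn : forall z, Cmod z < 1 -> G z <> RtoC 0)
    by (intros z Hz; apply (binomial_function_nonzero gam); [lra|assumption|assumption]).
  set (h := fun sgn z => (z * ((1 + RtoC sgn * z ^ n) * G (z ^ n)))%C).
  assert (Hzn : forall z, Cmod z < 1 -> Cmod (z ^ n) < 1)
    by (intros z Hz; eapply Rle_lt_trans; [now apply Cmod_pow_le_self|assumption]).
  assert (Hm1 : forall z, (1 + RtoC (-1) * z ^ n)%C = (1 - z ^ n)%C).
  { intros z. replace (RtoC (-1)) with (- (1))%C
      by (apply injective_projections; simpl; ring). ring. }
  assert (HG' : forall x, Cmod x < 1 -> C_derive G x = (RtoC gam * G x / (1 - x))%C).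
  { intros x Hx. rewrite <- (binomial_function_ode gam G x HG Hx). field.
    now apply one_minus_nonzero. }
  assert (Hhd : forall sgn z, Cmod z < 1 -> C_derive (h sgn) z = _)
    by (intros sgn z Hz; exact (Cderiv_unique _ _ _ (Cderiv_extremal_factor n sgn G z Hn HGa Hz))).
  assert (Hh1 : forall z, h (-1) z = (z * ((1 - z ^ n) * G (z ^ n)))%C)
    by (intros z; unfold h; now rewrite Hm1).
  assert (Hh2 : forall z, h 1 z = (z * ((1 + z ^ n) * G (z ^ n)))%C)
    by (intros z; unfold h; now rewrite Cmult_1_l).
  assert (Hh1n : forall z, Cmod z < 1 -> z <> RtoC 0 -> h (-1) z <> RtoC 0).
  { intros z Hz Hz0. rewrite Hh1. apply Cmult_neq_0; [assumption|].
    apply Cmult_neq_0; [now apply one_minus_nonzero, Hzn|now apply HGn, Hzn]. }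
  exists (h 1). split; [split|].
  - apply (class_A_extremal_factor n 1 gam G Hn HG).
  - exists (h (-1)). split.
    + split; [apply (class_A_extremal_factor n (-1) gam G Hn HG)|].
      assert (HP := half_plane_map_pow_class_P n alpha Hn).
      eexists. split; [|exact HP]. split; [apply HP|].
      intros z Hz Hz0. split; [now apply Hh1n|].
      cbv beta. rewrite Hhd by assumption. rewrite Hm1, HG', Hh1 by now apply Hzn.
      assert (N1 := one_minus_nonzero _ (Hzn z Hz)). assert (N2 := HGn _ (Hzn z Hz)).
      unfold half_plane_map.
      replace (RtoC (1 - 2 * alpha)) with (RtoC (INR n + 2 * (1 - alpha)) - RtoC (INR n) - 1)%C
        by (rewrite <- !RtoC_minus; f_equal; ring).
      rewrite <- Hng.
      replace (RtoC (-1)) with (- (1))%C by (apply injective_projections; simpl; ring).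
      field. repeat split; assumption.
    + assert (HP := half_plane_map_pow_class_P n 0 Hn).
      eexists. split; [|exact HP]. split; [apply HP|].
      intros z Hz Hz0. split; [now apply Hh1n|].
      assert (N1 := one_minus_nonzero _ (Hzn z Hz)). assert (N2 := HGn _ (Hzn z Hz)).
      rewrite Hh1, Hh2. unfold half_plane_map.
      rewrite Rmult_0_r, Rminus_0_r. field. repeat split; assumption.
  - intros z Hz Hz0.
    rewrite Hhd by assumption.
    assert (N1 := one_minus_nonzero _ (Hzn z Hz)). assert (N2 := HGn _ (Hzn z Hz)).
    assert (N3 := one_plus_nonzero _ (Hzn z Hz)).
    rewrite HG', Hh2, <- Hng by now apply Hzn. rewrite Cmult_1_l.
    field. repeat split; assumption.
Qed.

(** If [r1 > r0], the point [z = r0 / r1] of the disc is sent by the dilation to [r0], where the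
    logarithmic derivative is [1 + arcsinh 1]. This forces [w z = 1], against [|w z| <= |z| < 1]. *)
Lemma dilations_sharp (n : nat) (alpha s0 r0 r1 : R) :
  (1 <= n)%nat -> 0 <= alpha < 1 -> 0 < s0 < 1 -> 0 < r0 <= 1 -> r0 ^ n = s0 ->
  2 * (INR n - alpha + 1) * s0 + 2 * (1 - alpha) * s0 ^ 2 = arcsinh 1 * (1 - s0 ^ 2) ->
  0 < r1 <= 1 ->
  dilations_belong (starlike_rho_n n) (close_to_starlike n alpha) r1 -> r1 <= r0.
Proof.
  intros Hn Ha Hs0 Hr0 Hr0n E Hr1 Hdil. apply Rnot_lt_le. intros Hlt.
  destruct (extremal_function n alpha Hn Ha) as (f & Hf & Hlog).
  destruct (Hdil f Hf r1 ltac:(lra)) as (_ & _ & q & (_ & Hq) & (w & _ & _ & Hw & Hqw)).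
  set (z := RtoC (r0 / r1)).
  assert (Hrr : 0 < r0 / r1 < 1).
  { split; [apply Rdiv_lt_0_compat; lra|].
    apply (Rmult_lt_reg_r r1); [lra|]. unfold Rdiv. rewrite Rmult_assoc, Rinv_l; lra. }
  assert (Hz : Cmod z < 1) by (unfold z; rewrite Cmod_R, Rabs_pos_eq; lra).
  assert (Hz0 : z <> RtoC 0) by (intros F; apply RtoC_inj in F; lra).
  assert (N1 : RtoC r1 <> RtoC 0) by (intros F; apply RtoC_inj in F; lra).
  assert (N0 : RtoC r0 <> RtoC 0) by (intros F; apply RtoC_inj in F; lra).
  assert (Hrz : (RtoC r1 * z)%C = RtoC r0).
  { unfold z. rewrite <- RtoC_mult. f_equal. field. lra. }
  assert (Hr0lt : Cmod (RtoC r0) < 1) by (rewrite Cmod_R, Rabs_pos_eq; lra).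
  destruct (Hq z Hz Hz0) as [Hnz Hqz].
  rewrite (Cderiv_unique _ _ _ (Cderiv_dilation r1 f z ltac:(lra) (proj1 (proj1 Hf)) Hz)) in Hqz.
  unfold dilation in Hqz, Hnz. rewrite Hrz in Hqz, Hnz.
  assert (Hfn : f (RtoC r0) <> RtoC 0).
  { intros F. apply Hnz. rewrite F. ring. }
  replace (z * C_derive f (RtoC r0) / (/ RtoC r1 * f (RtoC r0)))%C
    with (RtoC r0 * C_derive f (RtoC r0) / f (RtoC r0))%C in Hqz
    by (rewrite <- Hrz at 1; field; split; assumption).
  rewrite Hlog, <- RtoC_pow, Hr0n in Hqz by assumption.
  assert (Hval : q z = RtoC (1 + arcsinh 1)).
  { rewrite Hqz, <- !RtoC_plus, <- RtoC_minus, <- !RtoC_mult, <- !RtoC_div, <- !RtoC_plus by lra.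
    f_equal. rewrite Rplus_assoc. f_equal.
    apply (Rmult_eq_reg_r (1 - s0 ^ 2)); [|nra]. rewrite <- E. field. split; lra. }
  rewrite Hqw in Hval by assumption.
  assert (HC : Casinh (w z) = RtoC (arcsinh 1)).
  { replace (Casinh (w z)) with (1 + Casinh (w z) - 1)%C by ring.
    rewrite Hval, RtoC_plus. ring. }
  apply Casinh_real in HC; [|apply arcsinh_1_bounds].
  specialize (Hw z Hz). rewrite HC, sinh_arcsinh, Cmod_1 in Hw. lra.
Qed.

(** With [a = arcsinh 1] and [m = n - alpha + 1], [s0] is the positive root of [(a + 2 (1 - alpha))
    s ^ 2 + 2 m s - a = 0], written with the radical in the denominator; [s0 < 1] because
    [a <= 1 < m]. *)
Lemma radius_root (n : nat) (alpha : R) :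
  (1 <= n)%nat -> 0 <= alpha < 1 ->
  let s0 := arcsinh 1 /
        (INR n - alpha + 1 +
         sqrt ((INR n - alpha + 1) ^ 2 +
               (arcsinh 1 + 2 * (1 - alpha)) * arcsinh 1)) in
  0 < s0 < 1 /\
  2 * (INR n - alpha + 1) * s0 + 2 * (1 - alpha) * s0 ^ 2 = arcsinh 1 * (1 - s0 ^ 2).
Proof.
  intros Hn Ha. cbv zeta.
  assert (Hn0 : 1 <= INR n) by (apply (le_INR 1); assumption).
  destruct arcsinh_1_bounds as [Ap A1]. set (a := arcsinh 1) in *.
  set (m := INR n - alpha + 1). assert (Hm : 1 < m) by (unfold m; lra).
  assert (Hp : 0 <= (a + 2 * (1 - alpha)) * a) by (apply Rmult_le_pos; lra).
  assert (Hrad : 0 <= m ^ 2 + (a + 2 * (1 - alpha)) * a) by nra.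
  assert (Hss := sqrt_sqrt _ Hrad).
  assert (Hs0 := sqrt_pos (m ^ 2 + (a + 2 * (1 - alpha)) * a)).
  set (s := sqrt (m ^ 2 + (a + 2 * (1 - alpha)) * a)) in *.
  split; [split|].
  - apply Rdiv_lt_0_compat; lra.
  - apply (Rmult_lt_reg_r (m + s)); [lra|].
    unfold Rdiv. rewrite Rmult_assoc, Rinv_l; lra.
  - apply (Rmult_eq_reg_r ((m + s) ^ 2)); [|nra].
    replace ((2 * m * (a / (m + s)) + 2 * (1 - alpha) * (a / (m + s)) ^ 2) * (m + s) ^ 2)
      with (2 * m * a * (m + s) + 2 * (1 - alpha) * a ^ 2) by (field; lra).
    replace (a * (1 - (a / (m + s)) ^ 2) * (m + s) ^ 2)
      with (a * ((m + s) ^ 2 - a ^ 2)) by (field; lra).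
    replace ((m + s) ^ 2) with (m ^ 2 + 2 * m * s + s * s) by ring.
    rewrite Hss. ring.
Qed.

Theorem theorem4p4 (n : nat) (alpha : R)
    (hn : (1 <= n)%nat) (halpha : 0 <= alpha < 1) :
  is_radius (starlike_rho_n n) (close_to_starlike n alpha)
    (Rpower
       (arcsinh 1 /
        (INR n - alpha + 1 +
         sqrt ((INR n - alpha + 1) ^ 2 +
               (arcsinh 1 + 2 * (1 - alpha)) * arcsinh 1)))
       (/ INR n)).
Proof.
  destruct (radius_root n alpha hn halpha) as [Hs E].
  set (s0 := arcsinh 1 / _) in *.
  assert (Hn0 : 0 < INR n) by (apply lt_0_INR; lia).
  set (r0 := Rpower s0 (/ INR n)).
  assert (Hr0 : 0 < r0) by apply exp_pos.
  assert (Hr0n : r0 ^ n = s0).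
  { unfold r0. rewrite <- Rpower_pow by (apply exp_pos).
    rewrite Rpower_mult, Rinv_l, Rpower_1; lra. }
  assert (Hr1 : r0 <= 1).
  { apply Rnot_lt_le. intros Hc. assert (A := pow_R1_Rle r0 n ltac:(lra)). lra. }
  split; [lra|]. split.
  - now apply close_to_starlike_dilations with s0.
  - intros r1 H1 Hd. now apply (dilations_sharp n alpha s0 r0 r1).
Qed.
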